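(* Assume that $\ln \ln L\geq 1$. Fix levels $\alpha$ and $\beta$ in $]0,1[$ and let $R,R',R''>0$. Let $\Phi_{\alpha/2}^{(1)}$ be the first test (defined in the context) at level $\alpha/2$ with $\mathcal{J}=\{1,\ldots,\lfloor\log_2(L^2/(\ln\ln L)^3)\rfloor\}$ and $W_{J}=\ln|\mathcal{J}|$ for every $J\in\mathcal{J}$. Let $\Phi_{\alpha/2}^{(2)}$ be the second test (defined in the context) at level $\alpha/2$ with $\bar{J}=\lfloor\log_2(L/\ln L)\rfloor$. Consider $\Phi_\alpha^{(3)}=\sup\{\Phi_{\alpha/2}^{(1)},\Phi_{\alpha/2}^{(2)}\}$. $(i)$ For all $\delta>0$ and $\gamma>0$, there exist some positive constants $L_0(\delta)$ and $C(\alpha,\beta,R,R'',\delta)$ such that if $L>L_0(\delta)$, then $$\rho(\Phi_\alpha^{(3)},\mathcal{B}_{2,\infty}^\delta(R)\cap W_\gamma(R')\cap\mathbb{L}^{\infty}(R''),\beta)\leq C(\alpha,\beta,R,R'',\delta) \left(\frac{\sqrt{\ln\ln L}}{L}\right)^{\frac{2\delta}{4\delta +1}}.$$ $(ii)$ For all $(\delta,\gamma)$ with $\delta,\gamma>0$ and $\gamma/(2\gamma+1)\leq \delta$, there exist some positive constants $L_0(\delta,\gamma)$ and $C(\alpha,\beta,R,R',R'',\delta,\gamma)$ such that if $L>L_0(\delta,\gamma)$, then $$\rho(\Phi_\alpha^{(3)},\mathcal{B}_{2,\infty}^\delta(R)\cap W_\gamma(R')\cap\mathbb{L}^{\infty}(R''),\beta)\leq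 C(\alpha,\beta,R,R',R'',\delta,\gamma)\left(\frac{\ln L}{L}\right)^{\frac{\gamma}{1+2\gamma}}.$$
   Context: A constant written $C(a,b,\dots)$ or $L_0(a,\dots)$ depends only on the listed parameters (in particular not on $L$). Setting. One observes a Poisson process $N$ on $[0,1]$ with intensity $s\ge0$, $s\in\mathbb{L}^2([0,1])$, with respect to $d\mu(x)=L\,dx$ (mean measure $L s(x)dx$); $\mathbb{P}_s$ is its distribution, $X_1,\dots,X_{N_L}$ its points, $N_L$ their number. $\|\cdot\|,\langle\cdot,\cdot\rangle,d$ are the norm, scalar product and distance of $\mathbb{L}^2([0,1],dx)$; $\mathcal{S}_0$ is the set of constant functions on $[0,1]$. Haar basis: $\phi_0=\mathbf{1}_{[0,1]}$, $\phi_{(j,k)}(x)=2^{j/2}\psi(2^jx-k)$, $j\in\mathbb{N}$, $0\le k\le 2^j-1$, $\psi=\mathbf{1}_{[0,1/2[}-\mathbf{1}_{[1/2,1[}$; $\alpha_{(j,k)}=\langle s,\phi_{(j,k)}\rangle$. For $J\ge1$, $\Lambda_{J}=\{(j,k): 0\le j\le J-1,\ 0\le k\le 2^j-1\}$. Classes: $\mathcal{B}_{2,\infty}^\delta(R)=\{s\ge0,\ s\in\mathbb{L}^2([0,1]):\forall j\in\mathbb{N},\ \sum_{k=0}^{2^j-1}\alpha_{(j,k)}^2\le R^22^{-2j\delta}\}$; $W_\gamma(R')=\{s\ge0,\ s\in\mathbb{L}^2([0,1]):\forall t>0,\ \sum_{j\in\mathbb{N}}\sum_{k=0}^{2^j-1}\alpha_{(j,k)}^2\mathbf{1}_{\alpha_{(j,k)}^2\le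 t}\le R'^2t^{2\gamma/(1+2\gamma)}\}$; $\mathbb{L}^\infty(R'')$ is the set of functions bounded by $R''$. Uniform separation rate: $\rho(\Phi,\mathcal{S}_1,\beta)=\inf\{\rho>0:\ \sup_{s\in\mathcal{S}_1,\,d(s,\mathcal{S}_0)>\rho}\mathbb{P}_s(\Phi=0)\le\beta\}$. Statistics. For $\lambda=(j,k)$ let $T_\lambda=\frac1{L^2}\sum_{l\ne l'=1}^{N_L}\phi_\lambda(X_l)\phi_\lambda(X_{l'})$, and $T'_J=\sum_{\lambda\in\Lambda_J}T_\lambda$. Under the null hypothesis $s\in\mathcal{S}_0$, conditionally on $N_L=n$, the points are $n$ i.i.d. uniform variables on $[0,1]$, so the conditional law of these statistics does not depend on $s\in\mathcal{S}_0$. For $u\in]0,1[$, $q_J'^{(n)}(u)$ and $q_\lambda^{(n)}(u)$ are the $(1-u)$ quantiles of $T'_J$ and $T_\lambda$ respectively, given $N_L=n$ under the null hypothesis. First test at level $a\in]0,1[$. Given a finite set $\mathcal{J}\subset\mathbb{N}\setminus\{0\}$ and positive weights $(W_J)_{J\in\mathcal{J}}$ with $\sum_{J\in\mathcal{J}}e^{-W_J}\le1$, $$u_{J,a}'^{(n)}=e^{-W_J}\sup\Big\{u\in]0,1[:\ \sup_{s\in\mathcal{S}_0}\mathbb{P}_s\Big(\sup_{J\in\mathcal{J}}\big(T'_J-q_J'^{(n)}(ue^{-W_J})\big)>0\,\Big|\,N_L=n\Big)\le a\Big\},$$ and $\Phi_a^{(1)}=1$ if $\sup_{J\in\mathcal{J}}\big(T'_J-q_J'^{(N_L)}(u_{J,a}'^{(N_L)})\big)>0$,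 $\Phi_a^{(1)}=0$ otherwise. Second test at level $a\in]0,1[$. Given an integer $\bar J\ge1$, $$u_a^{(n)}=\sup\Big\{u\in]0,1[:\ \sup_{s\in\mathcal{S}_0}\mathbb{P}_s\Big(\sup_{(j,k)\in\Lambda_{\bar J}}\Big(T_{(j,k)}-q_{(j,k)}^{(n)}\Big(\frac{u}{2^j\bar J}\Big)\Big)>0\,\Big|\,N_L=n\Big)\le a\Big\},$$ $u_{(j,k),a}^{(n)}=u_a^{(n)}/(2^j\bar J)$, and $\Phi_a^{(2)}=1$ if $\sup_{\lambda\in\Lambda_{\bar J}}\big(T_\lambda-q_\lambda^{(N_L)}(u_{\lambda,a}^{(N_L)})\big)>0$, $\Phi_a^{(2)}=0$ otherwise. *)

(* Defs.v *)
From HB Require Import structures.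
From mathcomp Require Import all_boot all_order all_algebra.
From mathcomp Require Import all_classical all_reals all_analysis.

Set Implicit Arguments.
Unset Strict Implicit.
Unset Printing Implicit Defensive.

Import Order.TTheory GRing.Theory Num.Theory.
Import numFieldNormedType.Exports.

Local Open Scope classical_set_scope.
Local Open Scope ring_scope.

(* Functions on [0, 1] are represented by functions R -> R; every definition
   below only looks at their values on [0, 1]. *)

Definition I01 {R : realType} : set R := `[0, 1]%classic.

Definition in_L2 {R : realType} (s : R -> R) : Prop :=
  (s \_ I01) \in Lfun (@lebesgue_measure R) 2%:E.

Definition L2norm {R : realType} (s : R -> R) : \bar R :=
  'N[@lebesgue_measure R]_(2%:E)[EFin \o (s \_ I01)]%E.

Definition L2scal {R : realType} (f g : R -> R) : R :=
  \int[@lebesgue_measure R]_(x in I01) (f x * g x).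

Definition intensity {R : realType} (s : R -> R) : Prop :=
  (forall x, I01 x -> 0 <= s x) /\ in_L2 s.

Definition constants {R : realType} : set (R -> R) :=
  [set s | exists c : R, forall x, I01 x -> s x = c].

Definition L2dist {R : realType} (s : R -> R) (S : set (R -> R)) : \bar R :=
  ereal_inf [set L2norm (s \- t) | t in S].

Definition null_hypothesis {R : realType} : set (R -> R) :=
  constants `&` [set s | intensity s].

Definition haar_mother {R : realType} (x : R) : R :=
  \1_(`[0, 2^-1[%classic) x - \1_(`[2^-1, 1[%classic) x.

Definition haar {R : realType} (l : nat * nat) (x : R) : R :=
  2 `^ (l.1%:R / 2) * haar_mother (2 ^+ l.1 * x - l.2%:R).

Definition haar_coef {R : realType} (s : R -> R) (l : nat * nat) : R :=
  L2scal s (haar l).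

Definition Lam (J : nat) : seq (nat * nat) :=
  [seq (j, k) | j <- iota 0 J, k <- iota 0 (2 ^ j)].

Definition besov {R : realType} (delta r : R) : set (R -> R) :=
  [set s | intensity s /\
    forall j : nat, \sum_(k < (2 ^ j)%N) haar_coef s (j, k : nat) ^+ 2
      <= r ^+ 2 * 2 `^ (- 2 * j%:R * delta)].

Definition weak_besov {R : realType} (gamma r : R) : set (R -> R) :=
  [set s | intensity s /\
    forall t : R, 0 < t ->
      (\sum_(0 <= j <oo)
         (\sum_(k < (2 ^ j)%N | haar_coef s (j, k : nat) ^+ 2 <= t)
            haar_coef s (j, k : nat) ^+ 2)%:E
       <= (r ^+ 2 * t `^ (2 * gamma / (1 + 2 * gamma)))%:E)%E].

Definition bounded_by {R : realType} (r : R) : set (R -> R) :=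
  [set s | forall x, I01 x -> `|s x| <= r].

Definition point_count {R : realType} {Omega : Type}
    (N : Omega -> nat) (X : nat -> Omega -> R) (A : set R) (w : Omega) : nat :=
  \sum_(l < N w) (X l w \in A).

(* Since the counts are nat-valued, their mutual independence is the product
   rule for the joint probability mass function. In the library,
   poisson_prob rate k ignores its nat argument k, and poisson_prob 0 k is the
   Dirac mass at 0. *)
Definition is_poisson_process {R : realType} {d : measure_display}
    {Omega : measurableType d} (P : probability Omega R) (N : Omega -> nat)
    (X : nat -> Omega -> R) (L : R) (s : R -> R) : Prop :=
  (forall (A : set R) (U : set nat), measurable A -> A `<=` I01 ->
     P (point_count N X A @^-1` U) =
     poisson_prob (\int[@lebesgue_measure R]_(x in A) (L * s x)) 0 U) /\
  (forall (m : nat) (A : 'I_m -> set R) (k : 'I_m -> nat),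
     (forall i, measurable (A i)) -> (forall i, A i `<=` I01) ->
     (forall i j, i != j -> A i `&` A j = set0) ->
     P [set w | forall i, point_count N X (A i) w = k i] =
     (\prod_(i < m) P [set w | point_count N X (A i) w = k i])%E).

(* The statistical experiment: one random configuration of points of [0, 1],
   observed through its number of points and a measurable enumeration of them,
   together with a probability P_s for every intensity s under which it is a
   Poisson process with mean measure L s(x) dx. Only the values of pts l w
   with l < npts w are points of the configuration. *)
Record poisson_experiment (R : realType) (L : R) := PoissonExperiment {
  disp : measure_display ;
  sample : measurableType disp ;
  npts : {mfun sample >-> nat} ;
  pts : nat -> {mfun sample >-> R} ;
  law : (R -> R) -> probability sample R ;
  pts_I01 : forall w l, (l < npts w)%N -> I01 (pts l w) ;
  lawP : forall s, intensity s -> is_poisson_process (law s) npts pts L s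
}.

Definition T_stat {R : realType} {L : R} (M : poisson_experiment L)
    (lam : nat * nat) (w : sample M) : R :=
  (L ^+ 2)^-1 *
  \sum_(l < npts M w) \sum_(l' < npts M w | l != l')
    haar lam (pts M l w) * haar lam (pts M l' w).
Arguments T_stat {R L} M lam w.

Definition T'_stat {R : realType} {L : R} (M : poisson_experiment L)
    (J : nat) (w : sample M) : R :=
  \sum_(lam <- Lam J) T_stat M lam w.
Arguments T'_stat {R L} M J w.

Definition cond_law {R : realType} {L : R} (M : poisson_experiment L)
    (s : R -> R) (A : set (sample M)) (n : nat) : R :=
  fine (law M s (A `&` [set w | npts M w = n])) /
  fine (law M s [set w | npts M w = n]).
Arguments cond_law {R L} M s A n.

(* The null intensities for which conditioning on N = n makes sense (only the
   zero intensity is excluded, when n > 0); all of them give the same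
   conditional law. *)
Definition null_given {R : realType} {L : R} (M : poisson_experiment L)
    (n : nat) : set (R -> R) :=
  null_hypothesis `&` [set s | law M s [set w | npts M w = n] != 0%E].

(* (1 - u)-quantile, for 0 < u < 1 (otherwise the set below may be empty or
   unbounded and inf is 0). *)
Definition null_quantile {R : realType} {L : R} (M : poisson_experiment L)
    (S : sample M -> R) (n : nat) (u : R) : R :=
  inf [set x | forall s, null_given M n s ->
                 1 - u <= cond_law M s [set w | S w <= x] n].
Arguments null_quantile {R L} M S n u.

Definition test_u {R : realType} {L : R} (M : poisson_experiment L)
    (reject : R -> set (sample M)) (a : R) (n : nat) : R :=
  sup [set u | 0 < u < 1 /\
         sup [set cond_law M s (reject u) n | s in null_given M n] <= a].
Arguments test_u {R L} M reject a n.

Definition test1_u {R : realType} {L : R} (M : poisson_experiment L)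
    (JJ : seq nat) (W : nat -> R) (a : R) (n : nat) (J : nat) : R :=
  expR (- W J) *
  test_u M (fun u => [set w | 0 < sup [set T'_stat M J w -
      null_quantile M (T'_stat M J) n (u * expR (- W J)) | J in [set` JJ]]])
    a n.
Arguments test1_u {R L} M JJ W a n J.

Definition test1 {R : realType} {L : R} (M : poisson_experiment L)
    (JJ : seq nat) (W : nat -> R) (a : R) (w : sample M) : nat :=
  `[< 0 < sup [set T'_stat M J w -
        null_quantile M (T'_stat M J) (npts M w)
          (test1_u M JJ W a (npts M w) J) | J in [set` JJ]] >].
Arguments test1 {R L} M JJ W a w.

Definition test2_u {R : realType} {L : R} (M : poisson_experiment L)
    (Jbar : nat) (a : R) (n : nat) (lam : nat * nat) : R :=
  test_u M (fun u => [set w | 0 < sup [set T_stat M lam w -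
      null_quantile M (T_stat M lam) n (u / (2 ^+ lam.1 * Jbar%:R))
        | lam in [set` Lam Jbar]]]) a n
  / (2 ^+ lam.1 * Jbar%:R).
Arguments test2_u {R L} M Jbar a n lam.

Definition test2 {R : realType} {L : R} (M : poisson_experiment L)
    (Jbar : nat) (a : R) (w : sample M) : nat :=
  `[< 0 < sup [set T_stat M lam w -
        null_quantile M (T_stat M lam) (npts M w)
          (test2_u M Jbar a (npts M w) lam) | lam in [set` Lam Jbar]] >].
Arguments test2 {R L} M Jbar a w.

Definition log2 {R : realType} (x : R) : R := ln x / ln 2.

(* When 1 <= ln (ln L), the two logarithms below are at least 7 and 2, so that
   Num.truncn is the floor, and all quantiles used are taken at levels in
   ]0, 1/2]. *)
Definition JJ3 {R : realType} (L : R) : seq nat :=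
  iota 1 (Num.truncn (log2 (L ^+ 2 / ln (ln L) ^+ 3))).

Definition W3 {R : realType} (L : R) (J : nat) : R := ln (size (JJ3 L))%:R.

Definition Jbar3 {R : realType} (L : R) : nat := Num.truncn (log2 (L / ln L)).

Definition test3 {R : realType} {L : R} (M : poisson_experiment L)
    (alpha : R) (w : sample M) : nat :=
  maxn (test1 M (JJ3 L) (W3 L) (alpha / 2) w) (test2 M (Jbar3 L) (alpha / 2) w).
Arguments test3 {R L} M alpha w.

(* Uniform separation rate, with inf set0 = +oo and sup set0 = -oo. *)
Definition separation_rate {R : realType} {L : R} (M : poisson_experiment L)
    (Phi : sample M -> nat) (S1 : set (R -> R)) (beta : R) : \bar R :=
  ereal_inf [set rho%:E | rho in [set rho : R | 0 < rho /\
    (ereal_sup [set law M s [set w | Phi w = 0%N] |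
       s in [set s | S1 s /\ (rho%:E < L2dist s constants)%E]]
     <= beta%:E)%E]].
Arguments separation_rate {R L} M Phi S1 beta.

(* Main.v *)
(** Every statistic of scale less than [J] is a function of the counts of the
    points in the [2 ^ J] dyadic cells: [L ^ 2 * T'_J] is a centred U-statistic of
    the counts, and [T_(j,k)] involves the difference of the two counts below
    [(j,k)].  Given [N = n], the counts are multinomial, with uniform weights under
    the null hypothesis.  Throwing the points one at a time, exponential moments
    of these functions bound the null quantiles at level [exp (- x)] by
    [sqrt (x 2 ^ J) / L] and [x / L], up to constants, for [n] of order [L]; by the
    union bound the calibration of each test costs only [x] of order [ln ln L],
    respectively [ln L].  Under an alternative, Chebyshev's inequality for the same
    functions and Poisson tails for [N] bound the error of the second kind.

    The link with the distance is the dyadic energy [2 ^ J * \sum_i p_i ^ 2] of the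
    cell masses, which equals [p ^ 2] plus the sum of the squared Haar coefficients
    of scale less than [J] and tends to [\int s ^ 2] by Lebesgue differentiation.
    For [s] bounded by [r''] the squared distance is at most [r'' * p], so that a
    separated alternative has a large expected number of points; the distance is
    also less than [r''], so that small values of [L] are absorbed in the constant.

    For (i), the first test alone suffices, at the level [J] with [2 ^ J] of order
    [(L / sqrt (ln ln L)) ^ (2 / (4 delta + 1))].  For (ii), the second test alone
    suffices: either some squared coefficient of scale less than [Jbar] exceeds
    [C ln L / L] and is detected, or the weak Besov condition bounds the energy up
    to [Jbar] and the Besov condition bounds the rest. *)

Require Import Defs.
From mathcomp Require Import all_boot all_order all_algebra.
From mathcomp Require Import all_classical all_reals all_analysis.
From mathcomp Require Import measurable_realfun.
From mathcomp Require Import ring lra.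

Set Implicit Arguments.
Unset Strict Implicit.
Unset Printing Implicit Defensive.

Import Order.TTheory GRing.Theory Num.Theory.
Import numFieldNormedType.Exports.

Local Open Scope classical_set_scope.
Local Open Scope ring_scope.

(** * Multinomial counts *)

(** The recursions over the balls close thanks to an identity: a ball falling in cell [i] moves
    [ustat] by twice [D k_i - n], and the sum over the cells of the squares of these deviations is
    affine in [ustat] itself. Under uniform weights, one throw thus only turns the parameter [eta]
    of an exponential moment into [eta + 8 eta ^ 2], up to an explicit factor; the same identity
    closes the recursion for the variance under any profile with bounded density.

    The quadratic bound on the exponential needs increments bounded above, hence a cap on the cell
    counts, whose failure is paid for by a union bound over the cells.

    An experiment provides Poisson counts and their independence, but no conditional law of the
    points; the multinomial law given [N = n] is therefore derived from the counts alone.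

    The threshold in [L] found for (i) depends on [alpha], [beta] and [r''], which [L0] may not;
    this is why small values of [L] have to go into the constant. *)

Lemma expR_le_quad {R : realType} (y : R) : y <= 1 -> expR y <= 1 + y + 2 * y ^+ 2.
Proof.
(* The bound must hold for arbitrarily negative [y]. As [expR (- y)] is at least [(1 - y / 2) ^ 2],
   it is enough that the quadratic times this square is at least 1. *)
move=> y1; have e0 : 0 < 1 - y / 2 by lra.
have e1 : 1 - y / 2 <= expR (- (y / 2)) by exact: expR_ge1Dx.
have e2 : (1 - y / 2) ^+ 2 <= expR (- y).
  have -> : - y = - (y / 2) + - (y / 2) by field.
  by rewrite expRD -expr2 ler_pXn2r// ?nnegrE ?expR_ge0// ltW.
have q0 : 0 <= 1 + y + 2 * y ^+ 2 by nra.
have q1 : 1 <= (1 + y + 2 * y ^+ 2) * expR (- y).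
  apply: le_trans (ler_wpM2l q0 e2).
  have -> : (1 + y + 2 * y ^+ 2) * (1 - y / 2) ^+ 2 =
      1 + y ^+ 2 * ((1 - y) * (5 / 2 - y) / 2) by field.
  have : 0 <= (1 - y) * (5 / 2 - y) / 2 by nra.
  by have : 0 <= y ^+ 2 by [exact: sqr_ge0]; nra.
have := ler_wpM2l (expR_ge0 y) q1.
by rewrite mulr1 mulrCA expRN divff ?mulr1// gt_eqF// expR_gt0.
Qed.

Section multinomial.
Context {R : realType} {D : nat}.
Implicit Types (pi a : 'I_D -> R) (k : 'I_D -> nat) (phi psi : ('I_D -> nat) -> R).

Definition add1 k i : 'I_D -> nat := fun j => (k j + (j == i))%N.

Definition total k : nat := \sum_i k i.

Definition mstep pi phi k : R := \sum_i pi i * phi (add1 k i).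

(* For a probability vector [pi], the expectation of [phi] under the
   multinomial law with parameters [n] and [pi], the balls being thrown
   one at a time. *)
Definition mexp pi n phi : R := iter n (mstep pi) phi (fun=> 0%N).

Definition lin a k : R := \sum_i a i * (k i)%:R.

(* [L ^ 2 * T'_J] as a function of the counts in the [D = 2 ^ J] dyadic cells. *)
Definition ustat k : R :=
  D%:R * \sum_i ((k i)%:R ^+ 2 - (k i)%:R) - ((total k)%:R ^+ 2 - (total k)%:R).

Lemma total_add1 k i : total (add1 k i) = (total k).+1.
Proof.
by rewrite /total /add1 big_split/= -big_mkcond/= big_pred1_eq addn1.
Qed.

Lemma lin_add1 a k i : lin a (add1 k i) = lin a k + a i.
Proof.
rewrite /lin /add1.
under eq_bigr do rewrite natrD mulrDr.
rewrite big_split/=; congr (_ + _).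
rewrite (bigD1 i)//= eqxx mulr1 big1 ?addr0// => j /negbTE ->.
by rewrite mulr0.
Qed.

Lemma ustat_add1 k i :
  ustat (add1 k i) = ustat k + 2 * (D%:R * (k i)%:R - (total k)%:R).
Proof.
rewrite /ustat total_add1.
have -> : \sum_j ((add1 k i j)%:R ^+ 2 - (add1 k i j)%:R) =
    \sum_j ((k j)%:R ^+ 2 - (k j)%:R) + 2 * (k i)%:R :> R.
  rewrite [LHS](bigD1 i)//= [X in _ = X + _](bigD1 i)//= /add1 eqxx addn1 -natr1.
  under eq_bigr => j /negbTE -> do rewrite addn0.
  by ring.
by rewrite -natr1; ring.
Qed.

Lemma sum_dev_sqr k :
  \sum_i (D%:R * (k i)%:R - (total k)%:R) ^+ 2 =
  D%:R * (ustat k + (D%:R - 1) * (total k)%:R) :> R.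
Proof.
have kE : \sum_i (k i)%:R = (total k)%:R :> R by rewrite natr_sum.
rewrite /ustat sumrB kE.
transitivity (\sum_i (D%:R ^+ 2 * (k i)%:R ^+ 2
    + (- 2 * D%:R * (total k)%:R) * (k i)%:R + (total k)%:R ^+ 2) : R).
  by apply: eq_bigr => i _; ring.
rewrite !big_split/= -!mulr_sumr kE sumr_const card_ord -[_ *+ D]mulr_natl.
by ring.
Qed.

Lemma mexpS pi n phi : mexp pi n.+1 phi = mexp pi n (mstep pi phi).
Proof. by rewrite /mexp iterSr. Qed.

(** Only configurations of [n] balls have to be compared: the total starts at 0 and each throw adds
    one to it. *)
Lemma mexp_le pi n phi psi : (forall i, 0 <= pi i) ->
  (forall k, total k = n -> phi k <= psi k) -> mexp pi n phi <= mexp pi n psi.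
Proof.
move=> pi0; elim: n phi psi => [|n IH] phi psi le.
  by apply: le; rewrite /total big1.
rewrite !mexpS; apply: IH => k kn; apply: ler_sum => i _.
by rewrite ler_wpM2l// le// total_add1 kn.
Qed.

Lemma mexp_eq pi n phi psi : (forall k, total k = n -> phi k = psi k) ->
  mexp pi n phi = mexp pi n psi.
Proof.
elim: n phi psi => [|n IH] phi psi eq.
  by apply: eq; rewrite /total big1.
rewrite !mexpS; apply: IH => k kn; apply: eq_bigr => i _.
by rewrite eq// total_add1 kn.
Qed.

Lemma mexpD pi n phi psi :
  mexp pi n (fun k => phi k + psi k) = mexp pi n phi + mexp pi n psi.
Proof.
elim: n phi psi => [//|n IH] phi psi.
rewrite !mexpS -IH; apply: mexp_eq => k _.
by rewrite /mstep -big_split/=; apply: eq_bigr => i _; rewrite mulrDr.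
Qed.

Lemma mexpZ pi n (c : R) phi : mexp pi n (fun k => c * phi k) = c * mexp pi n phi.
Proof.
elim: n phi => [//|n IH] phi.
rewrite !mexpS -IH; apply: mexp_eq => k _.
by rewrite /mstep mulr_sumr; apply: eq_bigr => i _; rewrite mulrCA.
Qed.

Lemma mexp_cst pi n (c : R) : \sum_i pi i = 1 -> mexp pi n (fun=> c) = c.
Proof.
move=> pi1; elim: n => [//|n IH].
by rewrite mexpS -[RHS]IH; apply: mexp_eq => k _; rewrite /mstep -mulr_suml pi1 mul1r.
Qed.

Lemma mexp_sum pi n I (r : seq I) (F : I -> ('I_D -> nat) -> R) :
  \sum_i pi i = 1 ->
  mexp pi n (fun k => \sum_(j <- r) F j k) = \sum_(j <- r) mexp pi n (F j).
Proof.
move=> pi1; elim: r => [|j r IH].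
  by rewrite big_nil -[RHS](mexp_cst n 0 pi1); apply: mexp_eq => k _; rewrite big_nil.
rewrite big_cons -IH -mexpD; apply: mexp_eq => k _; exact: big_cons.
Qed.

(** Lets [mexp] be applied to unnormalised cell masses; [c ^+ n] then becomes the power in the
    Poisson probability of [n] points. *)
Lemma mexp_scale pi (c : R) n phi :
  mexp (fun i => c * pi i) n phi = c ^+ n * mexp pi n phi.
Proof.
elim: n phi => [|n IH] phi; first by rewrite /= mul1r.
rewrite !mexpS IH exprSr -mulrA; congr (_ * _).
rewrite -mexpZ; apply: mexp_eq => k _.
by rewrite /mstep mulr_sumr; apply: eq_bigr => i _; rewrite mulrA.
Qed.

Lemma mexp_expR_lin pi a n :
  mexp pi n (fun k => expR (lin a k)) = (\sum_i pi i * expR (a i)) ^+ n.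
Proof.
elim: n => [|n IH].
  by rewrite /mexp/= /lin big1 ?expR0// => i _; rewrite mulr0.
rewrite mexpS exprS -IH -mexpZ; apply: mexp_eq => k _.
rewrite /mstep mulr_suml; apply: eq_bigr => i _.
by rewrite lin_add1 expRD mulrA mulrAC.
Qed.

Lemma mexp_lin pi a n : \sum_i pi i = 1 ->
  mexp pi n (lin a) = n%:R * \sum_i pi i * a i.
Proof.
move=> pi1; elim: n => [|n IH].
  by rewrite /mexp/= /lin big1 ?mul0r// => i _; rewrite mulr0.
rewrite mexpS.
transitivity (mexp pi n (fun k => lin a k + \sum_i pi i * a i)); last first.
  by rewrite mexpD mexp_cst// IH -natr1 mulrDl mul1r.
apply: mexp_eq => k _.
rewrite /mstep; under eq_bigr do rewrite lin_add1 mulrDr.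
by rewrite big_split/= -mulr_suml pi1 mul1r.
Qed.

(** The deviation gains a centred increment, so the cross term averages out and each ball adds the
    variance of [a] under [pi], bounded here by its second moment. *)
Lemma mexp_lin_var pi a n : \sum_i pi i = 1 -> (forall i, 0 <= pi i) ->
  mexp pi n (fun k => (lin a k - n%:R * \sum_i pi i * a i) ^+ 2)
    <= n%:R * \sum_i pi i * a i ^+ 2.
Proof.
move=> pi1 pi0; set s := \sum_i pi i * a i; set v := \sum_i pi i * a i ^+ 2.
elim: n => [|n IH].
  rewrite /mexp/= /lin big1 ?mul0r ?subrr ?expr0n// => i _; by rewrite mulr0.
rewrite mexpS.
apply: (@le_trans _ _ (mexp pi n (fun k => (lin a k - n%:R * s) ^+ 2 + v))).
  apply: mexp_le => // k _; rewrite /mstep.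
  have -> : \sum_i pi i * (lin a (add1 k i) - n.+1%:R * s) ^+ 2 =
      \sum_i (pi i * ((lin a k - n%:R * s) ^+ 2 + s ^+ 2 - 2 * (lin a k - n%:R * s) * s)
        + (pi i * a i) * (2 * (lin a k - n%:R * s) - 2 * s) + pi i * a i ^+ 2).
    by apply: eq_bigr => i _; rewrite lin_add1 -natr1; ring.
  rewrite !big_split/= -!mulr_suml pi1 -/s -/v.
  have : 0 <= s ^+ 2 by apply: sqr_ge0.
  nra.
by rewrite mexpD mexp_cst// -natr1 mulrDl mul1r lerD2r.
Qed.

End multinomial.

Lemma ustat0 {R : realType} {D : nat} : ustat ((fun=> 0%N) : 'I_D -> nat) = 0 :> R.
Proof.
rewrite /ustat /total big1 => [|i _]; first by rewrite big1// mulr0 expr0n !subrr.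
by rewrite expr0n subrr.
Qed.

Section ustat_moments.
Context {R : realType} {D : nat}.
Variables (pi : 'I_D -> R) (kap : R).
Hypotheses (pi0 : forall i, 0 <= pi i) (pi1 : \sum_i pi i = 1).
Hypothesis pik : forall i, D%:R * pi i <= kap.

(** The chi-square distance of [pi] to the uniform law; [h] is the density of [pi] with respect to
    that law, minus one. *)
Let sig : R := D%:R * \sum_i pi i ^+ 2 - 1.
Let h i : R := D%:R * pi i - 1.

Lemma total_lin_dev (k : 'I_D -> nat) :
  \sum_i pi i * (D%:R * (k i)%:R - (total k)%:R) = lin h k.
Proof.
rewrite /lin /h /total.
transitivity (\sum_i (D%:R * pi i * (k i)%:R - pi i * (total k)%:R)).
  by apply: eq_bigr => i _; ring.
rewrite sumrB -mulr_suml pi1 mul1r /total natr_sum -sumrB.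
by apply: eq_bigr => i _; ring.
Qed.

Lemma sum_pi_h : \sum_i pi i * h i = sig.
Proof.
transitivity (\sum_i (D%:R * pi i ^+ 2 - pi i)).
  by apply: eq_bigr => i _; rewrite /h; ring.
by rewrite sumrB pi1 -mulr_sumr.
Qed.

Lemma sum_h_sqr : \sum_i h i ^+ 2 = D%:R * sig.
Proof.
rewrite /h /sig.
transitivity (\sum_i (D%:R ^+ 2 * pi i ^+ 2 + (- 2 * D%:R) * pi i + 1)).
  by apply: eq_bigr => i _; ring.
rewrite !big_split/= -!mulr_sumr pi1 sumr_const card_ord -[_ *+ D]mulr_natl.
by ring.
Qed.

Lemma dim_gt0 : 0 < D%:R :> R.
Proof.
rewrite ltr0n lt0n; apply/eqP => D0.
have : \sum_i pi i = 0 by rewrite big1// => i; have := ltn_ord i; rewrite [X in (_ < X)%N]D0.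
by rewrite pi1 => /eqP; rewrite oner_eq0.
Qed.

Lemma sig_ge0 : 0 <= sig.
Proof.
rewrite -(pmulr_rge0 _ dim_gt0) -sum_h_sqr.
by apply: sumr_ge0 => i _; exact: sqr_ge0.
Qed.

Lemma pi_weight (F : 'I_D -> R) : (forall i, 0 <= F i) ->
  \sum_i pi i * F i <= kap / D%:R * \sum_i F i.
Proof.
move=> F0; rewrite mulr_sumr; apply: ler_sum => i _.
by rewrite ler_wpM2r// ler_pdivlMr ?dim_gt0// mulrC.
Qed.

Lemma kap_ge0 : 0 <= kap.
Proof.
have := dim_gt0; rewrite ltr0n => D0.
by apply: le_trans (pik (Ordinal D0)); rewrite mulr_ge0.
Qed.

Lemma mexp_ustat n :
  mexp pi n ustat = n%:R * (n%:R - 1) * sig.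
Proof.
elim: n => [|n IH].
  by rewrite /mexp/= ustat0 !mul0r.
rewrite mexpS.
transitivity (mexp pi n (fun k => ustat k + 2 * lin h k)).
  apply: mexp_eq => k _; rewrite /mstep.
  under eq_bigr do rewrite ustat_add1 mulrDr.
  rewrite big_split/= -mulr_suml pi1 mul1r; congr (_ + _).
  by rewrite -total_lin_dev mulr_sumr; apply: eq_bigr => i _; ring.
by rewrite mexpD mexpZ mexp_lin// sum_pi_h IH -natr1; ring.
Qed.

(** The deviation of [ustat] is correlated with its next drift [lin h k - N * sig]. The cross term
    is split with weight [1 / N]; the resulting factor [1 + 1 / N] is absorbed by the growth of
    [N ^ 3] and [N ^ 2], which dictates the shape of the bound. *)
Lemma mexp_ustat_var n :
  mexp pi n (fun k => (ustat k - n%:R * (n%:R - 1) * sig) ^+ 2)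
    <= 4 * kap * sig * n%:R ^+ 3 + 4 * kap * D%:R * n%:R ^+ 2.
Proof.
have D0 := dim_gt0; have s0 := sig_ge0; have k0 := kap_ge0.
have ks0 : 0 <= kap * sig by exact: mulr_ge0.
have kD0 : 0 <= kap * D%:R by apply: mulr_ge0 => //; exact: ltW.
elim: n => [|n IH].
  by rewrite /mexp/= ustat0 !mul0r subrr !expr0n/= !mulr0 addr0.
(* The weight [1 / N] needs [N > 0]; with a single ball [ustat] is 0. *)
case: n => [_|n] in IH *.
  rewrite mexpS /mexp/=.
  set m := mstep _ _ _; suff -> : m = 0 by rewrite !expr1n; lra.
  rewrite /m /mstep big1// => i _; rewrite ustat_add1 ustat0 /total big1//.
  by rewrite !mulr0 !subrr !mulr0 mul0r addr0 subrr expr0n mulr0.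
set N := n.+1 in IH *.
have N0 : 0 < N%:R :> R by rewrite ltr0n.
rewrite mexpS; pose V (k : 'I_D -> nat) : R := (ustat k - N%:R * (N%:R - 1) * sig) ^+ 2.
pose H k : R := (lin h k - N%:R * sig) ^+ 2.
pose W k : R := (1 + N%:R^-1) * V k + (4 * N%:R * H k
    + (4 * kap * ustat k + (- 8 * N%:R * sig * lin h k +
        (4 * kap * (D%:R - 1) * N%:R + 4 * N%:R ^+ 2 * sig ^+ 2)))).
apply: (@le_trans _ _ (mexp pi N W)).
  apply: mexp_le => // k kN; rewrite /mstep /W.
  set t := \sum_i _.
  have -> : t = V k + 4 * (ustat k - N%:R * (N%:R - 1) * sig) * (lin h k - N%:R * sig)
     + 4 * (\sum_i pi i * (D%:R * (k i)%:R - N%:R) ^+ 2 - 2 * N%:R * sig * lin h k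
       + N%:R ^+ 2 * sig ^+ 2).
    rewrite -[in RHS](total_lin_dev k) kN /t /V.
    set v := ustat k - _.
    transitivity (\sum_i (pi i * (v ^+ 2 - 4 * v * N%:R * sig + 4 * N%:R ^+ 2 * sig ^+ 2)
       + (4 * v - 8 * N%:R * sig) * (pi i * (D%:R * (k i)%:R - N%:R))
       + 4 * (pi i * (D%:R * (k i)%:R - N%:R) ^+ 2))).
      by apply: eq_bigr => i _; rewrite ustat_add1 kN -natr1 /v; ring.
    by rewrite !big_split/= -mulr_suml -!mulr_sumr pi1; ring.
  (* [kap] replaces the weighted sum of squared deviations by the uniform one, which is affine in
     [ustat]. *)
  have Q : \sum_i pi i * (D%:R * (k i)%:R - N%:R) ^+ 2
      <= kap * (ustat k + (D%:R - 1) * N%:R).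
    apply: le_trans (pi_weight _) _ => [i|]; first exact: sqr_ge0.
    rewrite -[X in \sum_i (_ - X%:R) ^+ 2]kN sum_dev_sqr kN.
    by rewrite mulrA divfK// gt_eqF.
  set v := ustat k - _; set g := lin h k - _.
  have cross : 4 * v * g <= N%:R^-1 * V k + 4 * N%:R * H k.
    rewrite /V /H -/v -/g -subr_ge0.
    have -> : N%:R^-1 * v ^+ 2 + 4 * N%:R * g ^+ 2 - 4 * v * g =
        N%:R^-1 * (v - 2 * N%:R * g) ^+ 2 by field; rewrite pnatr_eq0.
    by rewrite mulr_ge0// ?sqr_ge0// invr_ge0 ltW.
  by move: (V k) (H k) cross Q => Vk Hk; nra.
rewrite /W !mexpD !mexpZ !mexp_cst// mexp_ustat mexp_lin// sum_pi_h.
have HV : mexp pi N H <= N%:R * (kap * sig).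
  have := mexp_lin_var h N pi1 pi0; rewrite sum_pi_h => /le_trans; apply.
  rewrite ler_wpM2l ?ler0n//; apply: le_trans (pi_weight _) _ => [i|]; first exact: sqr_ge0.
  by rewrite sum_h_sqr mulrA divfK// gt_eqF.
have IHN : (1 + N%:R^-1) * mexp pi N V <=
    (1 + N%:R^-1) * (4 * kap * sig * N%:R ^+ 3 + 4 * kap * D%:R * N%:R ^+ 2).
  by rewrite ler_wpM2l// addr_ge0// invr_ge0 ltW.
have E : (1 + N%:R^-1) * (4 * kap * sig * N%:R ^+ 3 + 4 * kap * D%:R * N%:R ^+ 2) =
   4 * (kap * sig) * (N%:R ^+ 3 + N%:R ^+ 2) + 4 * (kap * D%:R) * (N%:R ^+ 2 + N%:R).
  by field; rewrite pnatr_eq0.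
have HV2 := ler_wpM2l (ltW N0) HV.
rewrite -[N.+1%:R]natr1 E in IHN *.
move: (mexp pi N V) (mexp pi N H) IHN HV2 {HV IH} => v g vB gB.
have s20 : 0 <= N%:R ^+ 2 * sig ^+ 2 by rewrite mulr_ge0// sqr_ge0.
have kN0 : 0 <= kap * N%:R by rewrite mulr_ge0// ltW.
have ksN0 : 0 <= kap * sig * N%:R by rewrite mulr_ge0// ltW.
set B := (X in _ <= X).
have -> : B = 4 * (kap * sig) * (N%:R ^+ 3 + N%:R ^+ 2) + 4 * (kap * D%:R) * (N%:R ^+ 2 + N%:R)
    + 4 * N%:R * (N%:R * (kap * sig)) + 4 * kap * (N%:R * (N%:R - 1) * sig)
    + 16 * (kap * sig * N%:R) + 4 * kap * sig
    + 4 * kap * D%:R * N%:R + 4 * kap * D%:R by rewrite /B; ring.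
by lra.
Qed.

End ustat_moments.

(** * Tails under the uniform multinomial law *)

Section null_concentration.
Context {R : realType} {D : nat}.
Hypothesis D_gt0 : (0 < D)%N.

Definition unif : 'I_D -> R := fun=> D%:R^-1.

Lemma unif_ge0 i : 0 <= unif i.
Proof. by rewrite invr_ge0 ler0n. Qed.

Lemma sum_unif : \sum_i unif i = 1.
Proof.
by rewrite sumr_const card_ord -[_ *+ D]mulr_natl divff// pnatr_eq0 -lt0n.
Qed.

Let DR0 : 0 < D%:R :> R. Proof. by rewrite ltr0n. Qed.

(** Tested on the final counts, the cap also holds at all earlier throws, because counts only grow;
    the indicator can thus be carried backwards through the recursion. *)
Definition capped (K : R) (k : 'I_D -> nat) : bool := [forall i, (k i)%:R <= K].

(** The cap makes every increment [y i] at most 1, so the quadratic bound applies. Under uniform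
    weights the [y i] sum to 0 and the sum of their squares is affine in [ustat], which goes back
    into the exponent. *)
Lemma mstep_expR_ustat (eta K : R) k n : 0 <= eta -> 2 * eta * D%:R * K <= 1 ->
  total k = n ->
  mstep unif (fun k => expR (eta * ustat k) * (capped K k)%:R) k <=
  expR (8 * eta ^+ 2 * D%:R * n%:R) *
    (expR ((eta + 8 * eta ^+ 2) * ustat k) * (capped K k)%:R).
Proof.
move=> eta0 etaK kn; rewrite /mstep.
have [kK|kK] := boolP (capped K k); last first.
  rewrite !mulr0 big1// => i _.
  suff /negbTE -> : ~~ capped K (add1 k i) by rewrite !mulr0.
  apply: contra kK => /forallP kK; apply/forallP => j.
  by apply: le_trans (kK j); rewrite /add1 ler_nat leq_addr.
rewrite mulr1.
pose y i : R := 2 * eta * (D%:R * (k i)%:R - n%:R).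
apply: (@le_trans _ _ (\sum_i unif i * (expR (eta * ustat k) *
    (1 + y i + 2 * y i ^+ 2)))).
  apply: ler_sum => i _; rewrite ler_wpM2l ?unif_ge0//.
  apply: (@le_trans _ _ (expR (eta * ustat (add1 k i)))).
    by rewrite -[leRHS]mulr1 ler_wpM2l ?expR_ge0// lern1 leq_b1.
  have -> : eta * ustat (add1 k i) = eta * ustat k + y i.
    by rewrite ustat_add1 kn /y; ring.
  rewrite expRD ler_wpM2l ?expR_ge0//; apply: expR_le_quad.
  apply: le_trans etaK; rewrite /y -[leRHS]mulrA ler_wpM2l ?mulr_ge0//.
  rewrite lerBlDr (le_trans (ler_wpM2l (ltW DR0) (forallP kK i)))//.
  by rewrite lerDl.
have sy : \sum_i y i = 0.
  rewrite -mulr_sumr sumrB -mulr_sumr sumr_const card_ord -[n%:R *+ D]mulr_natl.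
  by rewrite -natr_sum -kn /total subrr mulr0.
have sy2 : \sum_i y i ^+ 2 = 4 * eta ^+ 2 * (D%:R * (ustat k + (D%:R - 1) * n%:R)).
  rewrite -kn -sum_dev_sqr mulr_sumr; apply: eq_bigr => i _; rewrite /y kn; ring.
move: y sy sy2 => y sy sy2.
rewrite /unif -mulr_sumr -mulr_sumr !big_split/= -mulr_sumr sy sy2.
rewrite sumr_const card_ord mulrCA -expRD.
have -> : D%:R^-1 * (1 *+ D + 0 + 2 * (4 * eta ^+ 2 * (D%:R * (ustat k +
    (D%:R - 1) * n%:R)))) = 1 + 8 * eta ^+ 2 * (ustat k + (D%:R - 1) * n%:R) :> R.
  by field; rewrite gt_eqF.
apply: le_trans (ler_wpM2l (expR_ge0 _) (expR_ge1Dx _)) _.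
rewrite -expRD ler_expR.
have : 0 <= eta ^+ 2 * n%:R by rewrite mulr_ge0 ?sqr_ge0// ler0n.
lra.
Qed.

(** Going back from the last ball, the parameter grows by at most [8 * eta ^+ 2 <= 32 * theta ^+ 2
    <= theta / m] per throw, so it stays below [2 * theta] during [n <= m] throws. *)
Lemma mexp_expR_ustat (theta K m : R) n : 0 < m -> n%:R <= m -> 0 <= theta ->
  32 * theta * m <= 1 -> 4 * theta * D%:R * K <= 1 -> 0 <= K ->
  mexp unif n (fun k => expR (theta * ustat k) * (capped K k)%:R)
    <= expR (32 * theta ^+ 2 * D%:R * m ^+ 2).
Proof.
move=> m0 nm th0 thm thK K0.
(* [j] balls are left; the bound on [eta] relaxes by [theta / m] with each ball peeled off, which is
   the growth allowed per throw. *)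
suff H j eta : j%:R <= m -> 0 <= eta -> eta <= theta * (2 - j%:R / m) ->
    mexp unif j (fun k => expR (eta * ustat k) * (capped K k)%:R) <=
    expR (32 * theta ^+ 2 * D%:R * m * j%:R).
  apply: le_trans (H _ _ nm th0 _) _.
    rewrite -[leLHS]mulr1 ler_wpM2l// lerBrDl -lerBrDr.
    by rewrite ler_pdivrMr// (le_trans nm)//; lra.
  by rewrite ler_expR [m ^+ 2]expr2 mulrA ler_wpM2l// !mulr_ge0 ?sqr_ge0// ltW.
elim: j eta => [|j IH] eta jm eta0 etath.
  rewrite /mexp/= ustat0 !mulr0 expR0 mul1r lern1 leq_b1//.
have jm' : j%:R <= m by apply: le_trans jm; rewrite ler_nat.
have eta2 : eta <= 2 * theta.
  apply: le_trans etath _; rewrite mulrC ler_wpM2r// gerBl.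
  by rewrite divr_ge0 ?ler0n// ltW.
rewrite mexpS.
apply: (@le_trans _ _ (mexp unif j (fun k => expR (8 * eta ^+ 2 * D%:R * j%:R) *
    (expR ((eta + 8 * eta ^+ 2) * ustat k) * (capped K k)%:R)))).
  apply: mexp_le => [i|k kj]; first exact: unif_ge0.
  apply: mstep_expR_ustat => //; apply: le_trans thK.
  by rewrite !ler_wpM2r ?ler0n//; lra.
rewrite mexpZ.
have eta22 : eta ^+ 2 <= 4 * theta ^+ 2 by nra.
apply: (@le_trans _ _ (expR (8 * eta ^+ 2 * D%:R * j%:R) *
    expR (32 * theta ^+ 2 * D%:R * m * j%:R))).
  rewrite ler_wpM2l ?expR_ge0//; apply: IH => //.
    by rewrite addr_ge0// mulr_ge0// sqr_ge0.
  have e : theta * (2 - j.+1%:R / m) + theta / m = theta * (2 - j%:R / m).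
    by rewrite -natr1; field; rewrite gt_eqF.
  rewrite -e lerD//.
  apply: (@le_trans _ _ (theta * (32 * theta))); first by nra.
  by rewrite ler_wpM2l// -[leRHS]mul1r ler_pdivlMr.
rewrite -expRD ler_expR -[j.+1%:R]natr1 mulrDr mulr1 addrC lerD2l.
have Dj : 0 <= D%:R * j%:R :> R by rewrite mulr_ge0 ?ler0n.
apply: (@le_trans _ _ (32 * theta ^+ 2 * D%:R * j%:R)).
  by rewrite !ler_wpM2r ?ler0n//; lra.
by rewrite ler_wpM2l// ?mulr_ge0 ?sqr_ge0// ltW.
Qed.

Lemma mexp_expR_cell (m : R) n i : n%:R <= m ->
  mexp unif n (fun k => expR (k i)%:R) <= expR (3 * m / D%:R).
Proof.
move=> nm.
rewrite (_ : mexp _ _ _ = mexp unif n (fun k => expR (lin (fun j => (j == i)%:R) k))).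
  rewrite mexp_expR_lin (bigD1 i)//= eqxx.
  rewrite (_ : \sum_(_ < D | _) _ = 1 - D%:R^-1); last first.
    rewrite (eq_bigr unif) => [|j /negbTE ->]; last by rewrite expR0 mulr1.
    by have := sum_unif; rewrite (bigD1 i)//= {1}/unif; lra.
  have e4 : expR 1 <= 4 :> R by apply: le_trans (expR_le_quad _) _; lra.
  have le1 : unif i * expR 1 + (1 - D%:R^-1) <= expR (3 / D%:R).
    apply: le_trans (expR_ge1Dx _); rewrite /unif.
    have : 0 <= D%:R^-1 :> R by rewrite invr_ge0 ltW.
    nra.
  have ge0 : 0 <= unif i * expR 1 + (1 - D%:R^-1).
    have := expR_ge1Dx (1 : R); rewrite /unif.
    have : 0 <= D%:R^-1 :> R by rewrite invr_ge0 ltW.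
    nra.
  apply: (@le_trans _ _ (expR (3 / D%:R) ^+ n)).
    by case: (n) => [|q]; rewrite ?expr0// ler_pXn2r// nnegrE expR_ge0.
  rewrite -expRM_natl ler_expR (_ : 3 * m / D%:R = m * (3 / D%:R)); last by ring.
  by rewrite ler_wpM2r// divr_ge0// ltW.
apply: mexp_eq => k _; rewrite /lin (bigD1 i)//= eqxx mul1r big1 ?addr0//.
by move=> j /negbTE ->; rewrite mul0r.
Qed.

(** Chernoff's bound where no count exceeds [K = 3 * m / D + ln D + x], and a union bound over the
    [D] cells where one does; each contributes [expR (- x)]. The two conditions on [x] make the
    chosen [theta] admissible. *)
Lemma ustat_null_tail (m x : R) n : 0 < m -> n%:R <= m -> 0 <= x ->
  16 * x <= D%:R ->
  Num.sqrt (x * D%:R) * (3 * m / D%:R + ln D%:R + x) <= 2 * m ->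
  mexp unif n (fun k => (12 * m * Num.sqrt (x * D%:R) < ustat k)%R%:R) <= 2 * expR (- x).
Proof.
move=> m0 nm x0 xD xK; set K := _ + x in xK.
set q := Num.sqrt _ in xK *.
have q0 : 0 <= q by exact: sqrtr_ge0.
have q2 : q ^+ 2 = x * D%:R by rewrite sqr_sqrtr// mulr_ge0// ltW.
have K0 : 0 <= K.
  have D1 : 1 <= D%:R :> R by rewrite (ler_nat _ 1).
  by rewrite /K !addr_ge0// ?ln_ge0// divr_ge0 ?ler0n// mulr_ge0// ltW.
(* The log-moment bound is then [x / 2], while [theta] times the threshold [12 * m * q] is
   [3 / 2 * x]: the difference is [- x]. *)
pose theta := q / (8 * m * D%:R).
have th0 : 0 <= theta by rewrite divr_ge0// !mulr_ge0// ltW.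
have thE : theta * (8 * m * D%:R) = q by rewrite divfK// gt_eqF// !mulr_gt0.
have q4 : 4 * q <= D%:R.
  rewrite -(ler_pXn2r (n:=2))// ?nnegrE ?mulr_ge0//.
  by rewrite exprMn q2; nra.
have c1 : 32 * theta * m <= 1.
  rewrite -(ler_pM2r DR0) mul1r; apply: le_trans q4; rewrite -thE; lra.
have c2 : 4 * theta * D%:R * K <= 1.
  rewrite -(ler_pM2r m0) mul1r; suff : theta * (8 * m * D%:R) * K <= 2 * m by lra.
  by rewrite thE.
have H1 := mexp_expR_ustat m0 nm th0 c1 c2 K0.
have e1 : 32 * theta ^+ 2 * D%:R * m ^+ 2 = x / 2.
  apply: (@mulIf _ D%:R); first by rewrite gt_eqF.
  rewrite [RHS]mulrAC -q2 -thE; by field.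
have e2 : theta * (12 * m * q) = 3 / 2 * x.
  apply: (@mulIf _ D%:R); first by rewrite gt_eqF.
  rewrite -[RHS]mulrA -q2 expr2 -[X in _ = _ * (X * _)]thE; by field.
rewrite e1 in H1.
apply: (@le_trans _ _ (mexp unif n (fun k => expR (- (3 / 2 * x)) *
    (expR (theta * ustat k) * (capped K k)%:R) +
    expR (- K) * \sum_i expR (k i)%:R))).
  apply: mexp_le => [i|k _]; first exact: unif_ge0.
  have s0 : 0 <= expR (- K) * \sum_i expR (k i)%:R.
    by rewrite mulr_ge0 ?expR_ge0// sumr_ge0// => i _; exact: expR_ge0.
  have t0 : 0 <= expR (- (3 / 2 * x)) * (expR (theta * ustat k) * (capped K k)%:R).
    by rewrite !mulr_ge0 ?expR_ge0.
  have [yU|_] := ltP; last by rewrite addr_ge0.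
  have [kK|/forallPn[i]] := boolP (capped K k).
    apply: ler_wpDr => //.
    rewrite -[leLHS]expR0 mulr1 -expRD ler_expR -e2.
    by rewrite addrC subr_ge0 ler_wpM2l// ltW.
  rewrite -ltNge => kK.
  apply: ler_wpDl => //.
  rewrite (bigD1 i)//= mulrDr -[leLHS]addr0 lerD//.
    by rewrite -expRD -[leLHS]expR0 ler_expR addrC subr_ge0 ltW.
  by rewrite mulr_ge0 ?expR_ge0// sumr_ge0// => j _; exact: expR_ge0.
rewrite mexpD !mexpZ mexp_sum ?sum_unif//.
have H2 : expR (- K) * \sum_i mexp unif n (fun k => expR (k i)%:R) <= expR (- x).
  apply: (@le_trans _ _ (expR (- K) * \sum_(i < D) expR (3 * m / D%:R))).
    rewrite ler_wpM2l ?expR_ge0//; apply: ler_sum => i _; exact: mexp_expR_cell.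
  rewrite sumr_const card_ord -[_ *+ D]mulr_natl -[X in X * expR _]lnK ?posrE//.
  by rewrite -!expRD ler_expR /K; lra.
have H3 := ler_wpM2l (expR_ge0 (- (3 / 2 * x))) H1.
rewrite -expRD (_ : - (3 / 2 * x) + x / 2 = - x) in H3; last by field.
lra.
Qed.

(** Chernoff's bound for each sign. The linear terms of cells [a] and [b] cancel, so the moment is
    at most [(1 + 4 * theta ^+ 2 / D) ^+ n <= expR x], while beyond the threshold [theta] times the
    absolute difference is at least [2 * x]. The condition [x * D <= 4 * m] is [theta <= 1]. *)
Lemma diff_null_tail (m x : R) n (a b : 'I_D) : 0 < m -> n%:R <= m -> 0 < x ->
  x * D%:R <= 4 * m -> a != b ->
  mexp unif n (fun k => (16 * m * x / D%:R < ((k a)%:R - (k b)%:R) ^+ 2)%R%:R)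
    <= 2 * expR (- x).
Proof.
move=> m0 nm x0 xD ab.
pose theta := Num.sqrt (x * D%:R / (4 * m)).
have th0 : 0 < theta by rewrite sqrtr_gt0 divr_gt0 ?mulr_gt0.
have th2 : theta ^+ 2 = x * D%:R / (4 * m) by rewrite sqr_sqrtr// ltW// divr_gt0 ?mulr_gt0.
have th1 : theta <= 1.
  rewrite -(ler_pXn2r (n:=2))// ?nnegrE ?(ltW th0)//.
  by rewrite th2 expr1n ler_pdivrMr ?mulr_gt0// mul1r.
have H e : e ^+ 2 = 1 -> mexp unif n (fun k => expR (e * theta * ((k a)%:R - (k b)%:R)))
    <= expR x.
  move=> e2.
  have [el er] : -1 <= e * theta /\ e * theta <= 1.
    by split; move/eqP: e2; rewrite sqrf_eq1 => /orP[] /eqP ->; lra.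
  pose c j : R := e * theta * ((j == a)%:R - (j == b)%:R).
  rewrite (_ : mexp _ _ _ = mexp unif n (fun k => expR (lin c k))); last first.
    apply: mexp_eq => k _; congr expR; rewrite /lin (bigD1 a)//= (bigD1 b)/=; last by rewrite eq_sym.
    rewrite big1 => [|j /andP[/negbTE ja /negbTE jb]]; last by rewrite /c ja jb subrr mulr0 mul0r.
    by rewrite /c !eqxx [b == a]eq_sym (negbTE ab) /=; ring.
  rewrite mexp_expR_lin.
  set s := \sum_i _.
  have sE : s = 1 + D%:R^-1 * (expR (e * theta) - 1) + D%:R^-1 * (expR (- (e * theta)) - 1).
    transitivity (\sum_i (unif i + unif i * (expR (c i) - 1))).
      by apply: eq_bigr => i _; ring.
    rewrite big_split/= sum_unif -[RHS]addrA; congr (_ + _).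
    rewrite (bigD1 a)//= (bigD1 b)/=; last by rewrite eq_sym.
    rewrite big1 ?addr0 => [|j /andP[/negbTE ja /negbTE jb]].
      by rewrite /c /unif !eqxx [b == a]eq_sym (negbTE ab) subr0 mulr1 sub0r mulrN1.
    by rewrite /c ja jb subrr mulr0 expR0 subrr mulr0.
  have Di : 0 < D%:R^-1 :> R by rewrite invr_gt0.
  have e1 := expR_le_quad er.
  have e3 : expR (- (e * theta)) <= 1 + - (e * theta) + 2 * (- (e * theta)) ^+ 2.
    by apply: expR_le_quad; lra.
  have s1 : s <= 1 + 4 * theta ^+ 2 / D%:R.
    rewrite sE.
    rewrite sqrrN exprMn e2 mul1r in e1 e3.
    move: (expR (e * theta)) (expR (- (e * theta))) (theta ^+ 2) e1 e3 => u v w e1 e3.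
    by nra.
  have s0 : 0 <= s by apply: sumr_ge0 => i _; rewrite mulr_ge0 ?unif_ge0// expR_ge0.
  apply: (@le_trans _ _ (expR (4 * theta ^+ 2 / D%:R) ^+ n)).
    case: (n) => [|p]; first by rewrite !expr0.
    by rewrite ler_pXn2r ?nnegrE ?expR_ge0// (le_trans s1)// expR_ge1Dx.
  rewrite -expRM_natl ler_expR th2.
  have -> : n%:R * (4 * (x * D%:R / (4 * m)) / D%:R) = x * (n%:R / m).
    by field; rewrite !gt_eqF.
  by rewrite ger_pMr// ler_pdivrMr// mul1r.
have H1 : mexp unif n (fun k => expR (1 * theta * ((k a)%:R - (k b)%:R))) <= expR x.
  by apply: H; rewrite expr1n.
have H2 : mexp unif n (fun k => expR (-1 * theta * ((k a)%:R - (k b)%:R))) <= expR x.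
  by apply: H; rewrite sqrrN expr1n.
apply: (@le_trans _ _ (mexp unif n (fun k =>
    expR (- (2 * x)) * expR (1 * theta * ((k a)%:R - (k b)%:R)) +
    expR (- (2 * x)) * expR (-1 * theta * ((k a)%:R - (k b)%:R))))).
  apply: mexp_le => [i|k _]; first exact: unif_ge0.
  set d := (k a)%:R - (k b)%:R.
  have p1 : 0 <= expR (- (2 * x)) * expR (1 * theta * d) by rewrite mulr_ge0 ?expR_ge0.
  have p2 : 0 <= expR (- (2 * x)) * expR (-1 * theta * d) by rewrite mulr_ge0 ?expR_ge0.
  have [yd|_] := ltP; last by rewrite addr_ge0.
  have xd : 2 * x <= theta * `|d|.
    rewrite -(ler_pXn2r (n:=2))// ?nnegrE ?mulr_ge0 ?(ltW th0) ?(ltW x0)//.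
    rewrite !exprMn th2 real_normK ?num_real//.
    have -> : 2 ^+ 2 * x ^+ 2 = (x * D%:R / (4 * m)) * (16 * m * x / D%:R).
      by field; rewrite !gt_eqF.
    by rewrite ler_wpM2l ?(ltW yd)// ltW// divr_gt0 ?mulr_gt0.
  rewrite -!expRD in p1 p2 *.
  have [d0|d0] := leP 0 d.
    have : 1 <= expR (- (2 * x) + 1 * theta * d).
      rewrite -[leLHS]expR0 ler_expR mul1r addrC subr_ge0.
      by rewrite ger0_norm in xd.
    by rewrite /=; lra.
  have : 1 <= expR (- (2 * x) + -1 * theta * d).
    rewrite -[leLHS]expR0 ler_expR mulN1r addrC subr_ge0 mulNr -mulrN.
    by rewrite ltr0_norm in xd.
  by rewrite /=; lra.
rewrite mexpD !mexpZ.
have -> : - x = - (2 * x) + x by ring.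
rewrite expRD.
have := ler_wpM2l (expR_ge0 (- (2 * x))) H1.
have := ler_wpM2l (expR_ge0 (- (2 * x))) H2.
lra.
Qed.

End null_concentration.

(** * Poisson processes and their counts *)

(** Writing [n + 1] as the sum of the [f i] and cancelling [f i] in its factorial removes a ball
    from cell [i]. The counts range below a fixed [K > n], so that the sum is over a finite type
    that does not change in the induction. *)
Lemma multinomial_sum {R : realType} {D : nat} (mu : 'I_D -> R) K n
    (phi : ('I_D -> nat) -> R) : (n < K)%N ->
  n`!%:R * \sum_(f : {ffun 'I_D -> 'I_K} | (\sum_i f i == n)%N)
    (\prod_i (mu i ^+ f i / (f i)`!%:R)) * phi (fun i => f i) = mexp mu n phi.
Proof.
case: K => // K; elim: n phi => [|n IH] phi nK.
  rewrite fact0 mul1r (big_pred1 [ffun=> ord0]) => [|f /=].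
    rewrite big1 ?mul1r => [|i _]; last by rewrite ffunE expr0 fact0 invr1 mulr1.
    by congr phi; apply/funext => i; rewrite ffunE.
  apply/idP/eqP => [|->]; last by rewrite big1// => i _; rewrite ffunE.
  rewrite sum_nat_eq0 => /forallP f0; apply/ffunP => i.
  by rewrite ffunE; apply/val_inj => /=; apply/eqP; have := f0 i; rewrite implyTb.
rewrite mexpS factS natrM mulrAC mulrC -IH; last exact: ltn_trans nK.
congr (_ * _); rewrite mulr_sumr.
pose q (f : {ffun 'I_D -> 'I_K.+1}) := \prod_i (mu i ^+ f i / (f i)`!%:R).
transitivity (\sum_(f : {ffun 'I_D -> 'I_K.+1} | (\sum_i f i == n.+1)%N)
    \sum_i (f i)%:R * (q f * phi (fun i => f i))).
  apply: eq_bigr => f /eqP fn.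
  by rewrite -mulr_suml -natr_sum fn mulrC.
rewrite exchange_big/=.
under [RHS]eq_bigr do rewrite /mstep mulr_sumr.
rewrite [RHS]exchange_big/=; apply: eq_bigr => i _.
rewrite (bigID (fun f : {ffun 'I_D -> 'I_K.+1} => (0 < f i)%N))/= [X in _ + X]big1 ?addr0; last first.
  by move=> f /andP[_]; rewrite -eqn0Ngt => /eqP ->; rewrite mul0r.
(* [h] adds a ball to cell [i] and [h'] removes one. If [g i] already has the largest value, [inord]
   overflows to 0; such [g] are excluded by the condition [0 < h g i]. *)
pose h (g : {ffun 'I_D -> 'I_K.+1}) : {ffun 'I_D -> 'I_K.+1} :=
  [ffun j => inord (g j + (j == i))].
pose h' (f : {ffun 'I_D -> 'I_K.+1}) : {ffun 'I_D -> 'I_K.+1} :=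
  [ffun j => inord (f j - (j == i))].
have hE (g : {ffun 'I_D -> 'I_K.+1}) (j : 'I_D) : (g i < K)%N -> h g j = (g j + (j == i))%N :> nat.
  move=> gK; rewrite ffunE inordK//; case: eqP => [->|_].
    by rewrite addn1.
  by rewrite addn0.
rewrite (reindex_onto h h') /=; last first.
  move=> f /andP[_ fi0]; apply/ffunP => j; apply/val_inj.
  have h'K j' : h' f j' = (f j' - (j' == i))%N :> nat.
    by rewrite ffunE inordK// (leq_ltn_trans (leq_subr _ _)).
  rewrite /= hE h'K.
    by case: eqP => [->|_]; rewrite ?subn0 ?addn0// subn1 addn1 prednK.
  by rewrite eqxx subn1 -ltnS prednK.
apply: eq_big => [g|g].
  apply/idP/idP => [/andP[/andP[/eqP hg hi] /eqP hh]|/eqP gn].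
    have gK : (g i < K)%N.
      rewrite ltnNge; apply/negP => Kg; move: hi; rewrite ffunE eqxx addn1.
      have gE : g i = K :> nat by apply/eqP; rewrite eqn_leq Kg andbT -ltnS ltn_ord.
      by rewrite /inord /insubd insubF// gE ltnn.
    move: hg; under eq_bigr do rewrite hE//.
    by rewrite big_split/= -big_mkcond/= big_pred1_eq addn1 => -[->].
  have gK : (g i < K)%N.
    by apply: leq_ltn_trans (nK : (n < K)%N); rewrite -gn (bigD1 i)//= leq_addr.
  apply/andP; split; [apply/andP; split|].
  - under eq_bigr do rewrite hE//.
    by rewrite big_split/= -big_mkcond/= big_pred1_eq addn1 gn.
  - by rewrite hE// eqxx addn1.
  apply/eqP/ffunP => j; apply/val_inj; rewrite ffunE /= inordK hE//.
    by rewrite addnK.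
  by rewrite addnK.
move=> /andP[/andP[/eqP hg hi] /eqP hh].
have gK : (g i < K)%N.
  rewrite ltnNge; apply/negP => Kg; move: hi; rewrite ffunE eqxx addn1.
  have gE : g i = K :> nat by apply/eqP; rewrite eqn_leq Kg andbT -ltnS ltn_ord.
  by rewrite /inord /insubd insubF// gE ltnn.
have -> : phi (fun i0 => h g i0) = phi (add1 (fun j => g j) i).
  by congr phi; apply/funext => j; rewrite (hE g j gK).
rewrite mulrA [RHS]mulrCA [RHS]mulrA; congr (_ * _).
rewrite /q (bigD1 i)//= [in RHS](bigD1 i)//= (hE g i gK) eqxx addn1.
have -> : \prod_(j < D | j != i) (mu j ^+ h g j / (h g j)`!%:R) =
    \prod_(j < D | j != i) (mu j ^+ g j / (g j)`!%:R).
  by apply: eq_bigr => j /negbTE ji; rewrite (hE g j gK) ji addn0.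
rewrite !mulrA; congr (_ * _).
rewrite exprS factS natrM; field.
by rewrite nat1r !pnatr_eq0 -lt0n fact_gt0.
Qed.

(** Rate 0 obeys the same formula, as [0 ^+ 0 = 1], so cells without mass need no separate treatment
    later. *)
Lemma poisson_prob_set1 {R : realType} (rate : R) (k : nat) : 0 <= rate ->
  poisson_prob rate 0 [set k] = (rate ^+ k / k`!%:R * expR (- rate))%:E.
Proof.
rewrite le_eqVlt /poisson_prob => /predU1P[<-|r0].
  rewrite ltxx oppr0 expR0 mulr1 diracE; case: k => [|k].
    by rewrite mem_set// expr0 fact0 divr1.
  by rewrite memNset// expr0n mul0r.
rewrite r0 esum_set1 ?lee_fin ?poisson_pmf_ge0//.
by rewrite /poisson_pmf r0.
Qed.

Section counts.
Context {R : realType} d (Omega : measurableType d).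
Variables (N : {mfun Omega >-> nat}) (X : nat -> {mfun Omega >-> R}).

Lemma measurable_point_count (A : set R) (k : nat) : measurable A ->
  measurable [set w | point_count N X A w = k].
Proof.
move=> mA.
have mN n : measurable [set w | N w = n].
  exact: (measurable_funPTI N (Y := [set n])).
have mX n : measurable (X n @^-1` A).
  exact: measurable_funPTI.
have mS n : measurable [set w | (\sum_(l < n) (X l w \in A))%N = k].
  elim: n k => [|n IH] k.
    have [->|k0] := eqVneq k 0%N.
      by rewrite (_ : [set _ | _] = setT)//; apply/seteqP; split => // w _ /=; rewrite big_ord0.
    rewrite (_ : [set _ | _] = set0)//; apply/seteqP; split => // w /=.
    by rewrite big_ord0 => k0'; rewrite -k0' eqxx in k0.
  rewrite (_ : [set _ | _] =
      (X n @^-1` A `&` (if k is k'.+1 then [set w | (\sum_(l < n) (X l w \in A))%N = k'] else set0))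
      `|` (~` (X n @^-1` A) `&` [set w | (\sum_(l < n) (X l w \in A))%N = k])).
    apply: measurableU; apply: measurableI => //; last exact: measurableC.
    by case: (k).
  apply/seteqP; split => w /=; rewrite big_ord_recr/=.
    have [XA|XA] := boolP (X n w \in A).
      by rewrite addn1 => <-; left; split => //; exact/set_mem.
    by rewrite addn0 => <-; right; split => // /mem_set; exact/negP.
  move=> [[XA]|[XA]].
    by rewrite mem_set//; case: k => // k' <-; rewrite addn1.
  by rewrite memNset// addn0.
rewrite (_ : [set _ | _] = \bigcup_n ([set w | N w = n] `&`
    [set w | (\sum_(l < n) (X l w \in A))%N = k])).
  by apply: bigcupT_measurable => n; exact: measurableI.
apply/seteqP; split => w /=; first by move=> Nk; exists (N w).
by move=> [n _ [/= <-]].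
Qed.

Lemma measurable_counts D (A : 'I_D -> set R) (Q : ('I_D -> nat) -> Prop) :
  (forall i, measurable (A i)) ->
  measurable [set w | Q (fun i => point_count N X (A i) w)].
Proof.
move=> mA.
rewrite (_ : [set _ | _] = \bigcup_(f : {ffun 'I_D -> nat})
    (if `[< Q f >] then \bigcap_(i : 'I_D) [set w | point_count N X (A i) w = f i] else set0)).
  apply: countable_bigcupT_measurable => // f; case: ifP => // _.
  by apply: fin_bigcap_measurable => // i _; exact: measurable_point_count.
apply/seteqP; split => w /=.
  move=> Qw; exists [ffun i => point_count N X (A i) w] => //.
  have -> : ([ffun i => point_count N X (A i) w] : 'I_D -> nat) = fun i => point_count N X (A i) w.
    by apply/funext => i; rewrite ffunE.
  by case: asboolP => // _ i _ /=.
move=> [f _]; case: asboolP => // Qf fw.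
suff -> : (fun i => point_count N X (A i) w) = f by [].
by apply/funext => i; exact: fw.
Qed.

End counts.

Section law_counts.
Context {R : realType} {L : R} (M : poisson_experiment L).
Variables (s : R -> R) (D : nat) (A : 'I_D -> set R) (B : set R).
Hypotheses (L0 : 0 <= L) (ints : intensity s).
Hypotheses (mA : forall i, measurable (A i)) (sA : forall i, A i `<=` I01).
Hypothesis dA : forall i j, i != j -> A i `&` A j = set0.
(** [B] contains the points of [0, 1] that no cell covers; it will be the endpoint 1, the dyadic
    cells being half-open. *)
Hypotheses (mB : measurable B) (sB : B `<=` I01).
Hypothesis cover : forall x, I01 x -> ~ B x -> exists i, A i x.
Hypothesis B0 : (\int[@lebesgue_measure R]_(x in B) (L * s x) = 0)%R.

Let P := law M s.
Let nu i : R := (\int[@lebesgue_measure R]_(x in A i) (L * s x))%R.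

Definition counts (w : sample M) : 'I_D -> nat :=
  fun i => point_count (npts M) (pts M) (A i) w.

Lemma nu_ge0 i : 0 <= nu i.
Proof.
by apply: Rintegral_ge0 => x /sA Ax; rewrite mulr_ge0//; exact: ints.1.
Qed.

Lemma measurable_npts n : measurable [set w | npts M w = n].
Proof. exact: (measurable_funPTI (npts M) (Y := [set n])). Qed.

Lemma total_counts w : point_count (npts M) (pts M) B w = 0%N ->
  total (counts w) = npts M w.
Proof.
move=> wB; rewrite /total /counts /point_count exchange_big/=.
rewrite -[RHS]card_ord -sum1_card; apply: eq_bigr => l _.
have lI := pts_I01 (ltn_ord l).
have lB : ~ B (pts M l w).
  move/eqP: wB; rewrite sum_nat_eq0 => /forallP/(_ l); rewrite implyTb eqb0.
  by move=> /negP lB Bl; apply: lB; exact: mem_set.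
have [i Ai] := cover lI lB.
rewrite (bigD1 i)//= mem_set// big1 ?addn0// => j ji.
rewrite memNset// => Aj.
by have /seteqP[/(_ (pts M l w))+ _] := dA ji; apply.
Qed.

Lemma law_B_eq0 : P [set w | point_count (npts M) (pts M) B w = 0%N] = 1%E.
Proof.
have := (lawP M ints).1 B [set 0%N] mB sB; rewrite B0 poisson_prob_set1//.
by rewrite expr0 fact0 divr1 mul1r oppr0 expR0.
Qed.

Lemma law_point f : P [set w | forall i, counts w i = f i] =
  (\prod_i (nu i ^+ f i / (f i)`!%:R * expR (- nu i)))%:E.
Proof.
rewrite /P (lawP M ints).2// -prodEFin; apply: eq_bigr => i _.
rewrite -poisson_prob_set1 ?nu_ge0//; exact: ((lawP M ints).1 (A i) [set f i]).
Qed.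

(** Almost surely no point falls in [B], so [N = n] means that the counts add up to [n]. The event
    is then a finite disjoint union of configurations, whose probabilities are products of Poisson
    probabilities, summed by [multinomial_sum]. *)
Lemma law_counts (Q : ('I_D -> nat) -> Prop) n :
  P ([set w | Q (counts w)] `&` [set w | npts M w = n]) =
  (expR (- \sum_i nu i) / n`!%:R * mexp nu n (fun k => `[< Q k >]%:R))%:E.
Proof.
pose Z := [set w | point_count (npts M) (pts M) B w = 0%N].
have mZ : measurable Z by exact: measurable_point_count.
have mQ (Q' : ('I_D -> nat) -> Prop) : measurable [set w | Q' (counts w)].
  exact: measurable_counts.
have Z0 : P (~` Z) = 0%E by rewrite probability_setC// law_B_eq0 subee.
have PZ (E : set (sample M)) : measurable E -> P E = P (E `&` Z).
  move=> mE; apply/eqP; rewrite eq_le; apply/andP; split; last first.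
    by apply: le_measure; rewrite ?inE; [exact: measurableI|exact: mE|exact: subIsetl].
  rewrite [leLHS](measureDI _ mE mZ) -[leRHS]add0e leeD2r//.
  rewrite -[leRHS]Z0; apply: le_measure; rewrite ?inE; last by move=> w [].
  - exact: measurableD.
  - exact: measurableC.
rewrite PZ; last by apply: measurableI => //; exact: measurable_npts.
pose T := {ffun 'I_D -> 'I_n.+1}.
pose C (f : T) : Prop := (\sum_i f i)%N = n /\ Q (fun i => f i).
pose F (f : T) := [set w | forall i, counts w i = f i].
have -> : [set w | Q (counts w)] `&` [set w | npts M w = n] `&` Z =
   (\bigcup_(f in [set f : T | `[< C f >]]) F f) `&` Z.
  apply/seteqP; split => w /= [].
    move=> [Qw wn] Zw; split => //.
    have tn : total (counts w) = n by rewrite total_counts.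
    have cn i : (counts w i < n.+1)%N by rewrite ltnS -tn /total (bigD1 i)//= leq_addr.
    exists [ffun i => Ordinal (cn i)]; last by move=> i; rewrite ffunE.
    apply/asboolP; split.
      by rewrite -[RHS]tn /total; apply: eq_bigr => i _; rewrite ffunE.
    by rewrite (_ : (fun i => _) = counts w)//; apply/funext => i; rewrite ffunE.
  move=> [f /= /asboolP[fn Qf] Ff] Zw; split => //.
  have -> : counts w = (fun i => f i) by apply/funext => i; exact: Ff.
  split=> //; rewrite -total_counts// -[RHS]fn /total.
  by apply: eq_bigr => i _; rewrite Ff.
have fC : finite_set [set f : T | `[< C f >]].
  exact: finite_finset.
have mF f : measurable (F f) by exact: (mQ (fun k => forall i, k i = f i)).
rewrite -PZ; last by apply: fin_bigcup_measurable => // f _; exact: mF.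
rewrite measure_fin_bigcup//; last first.
  move=> f g _ _ [w [/= Ff Fg]]; apply/ffunP => i; apply/val_inj => /=.
  by rewrite -Ff -Fg.
rewrite -(bigfs _ (index_enum_uniq T) (P := fun f => `[< C f >])); last first.
  by move=> f _; rewrite mem_index_enum.
rewrite (eq_bigr (fun f : T => (\prod_i (nu i ^+ f i / (f i)`!%:R * expR (- nu i)))%:E));
  last by move=> f _; exact: (law_point (fun i => f i)).
rewrite sumEFin; congr EFin.
rewrite -(multinomial_sum _ _ (ltnSn n)) mulrA divfK ?pnatr_eq0 -?lt0n ?fact_gt0//.
rewrite mulr_sumr big_mkcond/= [RHS]big_mkcond/=; apply: eq_bigr => f _.
rewrite (_ : `[< C f >] = ((\sum_i f i)%N == n) && `[< Q (fun i => f i) >]); last first.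
  by rewrite asbool_and; congr (_ && _); apply/idP/idP => [/asboolP/eqP|/eqP/asboolP].
case: eqP => //= _; case: asboolP => _; last by rewrite !mulr0.
rewrite mulr1 big_split/= mulrC; congr (_ * _).
by rewrite -sumrN expR_sum.
Qed.

End law_counts.
Arguments counts {R L} M {D} A w.

(** * Conditional quantiles and calibrated tests *)

Section cond_law.
Context {R : realType} {L : R} (M : poisson_experiment L) (n : nat).
Implicit Types (s : R -> R) (E F : set (sample M)).

Let measurable_Nn : measurable [set w | npts M w = n].
Proof. exact: (measurable_funPTI (npts M) (Y := [set n])). Qed.

Let PN_gt0 s : null_given M n s -> 0 < fine (law M s [set w | npts M w = n]).
Proof.
move=> [_ /= h]; rewrite fine_gt0// ltey_eq fin_num_measure// andbT.
by rewrite lt0e h/=.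
Qed.

Lemma cond_law_le s E F : null_given M n s -> measurable E -> measurable F ->
  (forall w, npts M w = n -> E w -> F w) -> cond_law M s E n <= cond_law M s F n.
Proof.
move=> sn mE mF EF; rewrite ler_wpM2r ?invr_ge0 ?fine_ge0//.
have mEn : measurable (E `&` [set w | npts M w = n]) by exact: measurableI.
have mFn : measurable (F `&` [set w | npts M w = n]) by exact: measurableI.
rewrite fine_le ?fin_num_measure//; apply: le_measure; rewrite ?inE//.
by move=> w [Ew wn]; split => //; exact: EF.
Qed.

Lemma cond_lawT s : null_given M n s -> cond_law M s setT n = 1.
Proof. by move=> sn; rewrite /cond_law setTI divff// gt_eqF// PN_gt0. Qed.

Lemma cond_law0 s : cond_law M s set0 n = 0.
Proof. by rewrite /cond_law set0I measure0 mul0r. Qed.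

Lemma cond_lawC s E : null_given M n s -> measurable E ->
  cond_law M s (~` E) n = 1 - cond_law M s E n.
Proof.
move=> sn mE; rewrite -(cond_lawT sn) /cond_law -mulrBl setTI; congr (_ / _).
have mEn : measurable (E `&` [set w | npts M w = n]) by exact: measurableI.
rewrite setIC -setDE -fineB ?fin_num_measure//; congr fine.
rewrite measureD ?fin_num_measure// ?ltey_eq ?fin_num_measure//.
  by rewrite setIC.
Qed.

Lemma cond_lawU s E F : null_given M n s -> measurable E -> measurable F ->
  cond_law M s (E `|` F) n <= cond_law M s E n + cond_law M s F n.
Proof.
move=> sn mE mF; rewrite -mulrDl ler_wpM2r ?invr_ge0 ?fine_ge0//.
have mEn : measurable (E `&` [set w | npts M w = n]) by exact: measurableI.
have mFn : measurable (F `&` [set w | npts M w = n]) by exact: measurableI.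
rewrite setIUl -fineD ?fin_num_measure// fine_le ?fin_num_measure//.
- exact: measurableU.
- by rewrite fin_numD !fin_num_measure.
exact: measureU2.
Qed.

Lemma cond_law_bigU s (I : eqType) (r : seq I) (E : I -> set (sample M)) :
  null_given M n s -> (forall i, measurable (E i)) ->
  cond_law M s (\big[setU/set0]_(i <- r) E i) n <= \sum_(i <- r) cond_law M s (E i) n.
Proof.
move=> sn mE; elim: r => [|i r IH]; first by rewrite !big_nil cond_law0.
rewrite !big_cons; apply: le_trans (cond_lawU sn (mE i) _) _.
  by apply: bigsetU_measurable.
by rewrite lerD2l.
Qed.

End cond_law.

Section null_quantile.
Context {R : realType} {L : R} (M : poisson_experiment L) (n : nat).
Hypothesis null_ex : exists s, null_given M n s.
Variables (S : sample M -> R) (b : R).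
Hypothesis mS : forall x, measurable [set w | S w <= x].
(** With [null_ex], this makes the set defining the quantile nonempty and bounded below, so that its
    [inf] is a genuine infimum. *)
Hypothesis bS : forall w, npts M w = n -> `|S w| <= b.

Let qset u := [set x | forall s, null_given M n s ->
  1 - u <= cond_law M s [set w | S w <= x] n].

Let qset_lb u : u < 1 -> lbound (qset u) (- b).
Proof.
move=> u1 x /= H; have [s sn] := null_ex.
rewrite leNgt; apply/negP => xb.
have := H s sn; apply/negP; rewrite -ltNge.
apply: le_lt_trans (_ : 0 < _); last by rewrite subr_gt0.
rewrite -(cond_law0 M n s); apply: cond_law_le => // w wn /= Sx.
have := bS wn; rewrite ler_norml => /andP[+ _].
by move/le_lt_trans => /(_ _ (le_lt_trans Sx xb)); rewrite ltxx.
Qed.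

Let qset_b u : 0 <= u -> qset u b.
Proof.
move=> u0 s sn; apply: (@le_trans _ _ 1); first by rewrite gerBl.
rewrite -(cond_lawT sn); apply: cond_law_le => // w wn _ /=.
by apply: le_trans (bS wn); rewrite ler_norm.
Qed.

Lemma null_quantile_le u t : u < 1 ->
  (forall s, null_given M n s -> cond_law M s [set w | t < S w] n <= u) ->
  null_quantile M S n u <= t.
Proof.
move=> u1 H; apply: ge_inf; first by exists (- b); exact: qset_lb.
move=> s sn; rewrite (_ : [set w | S w <= t] = ~` [set w | t < S w]); last first.
  by apply/seteqP; split => w /=; rewrite leNgt => /negP.
have mt : measurable [set w | t < S w].
  rewrite (_ : [set w | t < S w] = ~` [set w | S w <= t]); first exact: measurableC.
  by apply/seteqP; split => w /=; rewrite ltNge => /negP.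
by rewrite cond_lawC// lerD2l lerN2 H.
Qed.

(** The infimum itself has the required level: the bound holds for exceeding [q + 1 / (k + 1)], and
    these events increase to exceeding [q]. *)
Lemma null_quantileP u s : 0 < u < 1 -> null_given M n s ->
  cond_law M s [set w | null_quantile M S n u < S w] n <= u.
Proof.
move=> /andP[u0 u1] sn; set q := null_quantile _ _ _ _.
have mgt x : measurable [set w | x < S w].
  rewrite (_ : [set w | x < S w] = ~` [set w | S w <= x]); first exact: measurableC.
  by apply/seteqP; split => w /=; rewrite ltNge => /negP.
have step k : cond_law M s [set w | q + k.+1%:R^-1 < S w] n <= u.
  have [x qx xk] : exists2 x, qset u x & x < q + k.+1%:R^-1.
    apply: inf_adherent; first by rewrite invr_gt0.
    by split; [exists b; apply: qset_b; exact: ltW|exists (- b); exact: qset_lb].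
  apply: (@le_trans _ _ (cond_law M s (~` [set w | S w <= x]) n)).
    apply: cond_law_le => //; first exact: measurableC.
    move=> w _ /= qS; apply/negP; rewrite -ltNge; exact: lt_trans qS.
  by rewrite cond_lawC// lerBlDr -lerBlDl qx.
have c : (fun k => cond_law M s [set w | q + k.+1%:R^-1 < S w] n) @ \oo -->
    cond_law M s [set w | q < S w] n.
  apply: cvgM; last exact: cvg_cst.
  have -> : [set w | q < S w] `&` [set w | npts M w = n] =
     \bigcup_k ([set w | q + k.+1%:R^-1 < S w] `&` [set w | npts M w = n]).
    rewrite -setI_bigcupl; congr (_ `&` _); apply/seteqP; split => w /=.
      move=> qS; have d0 : 0 < S w - q by rewrite subr_gt0.
      have [k _ /(_ k (leqnn k)) kd] := near_infty_natSinv_lt (PosNum d0).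
      by exists k => //=; rewrite -ltrBrDl.
    by move=> [k _] /=; apply: lt_trans; rewrite ltrDl invr_gt0.
  have mk k : measurable ([set w | q + k.+1%:R^-1 < S w] `&` [set w | npts M w = n]).
    by apply: measurableI => //; exact: (measurable_funPTI (npts M) (Y := [set n])).
  apply: fine_cvg; rewrite fineK ?fin_num_measure//; last exact: bigcup_measurable.
  apply: nondecreasing_cvg_mu => //; first exact: bigcup_measurable.
  move=> i j ij; apply/subsetPset => w [/= qS wn]; split => //=.
  apply: le_lt_trans qS; rewrite lerD2l lef_pV2 ?posrE// ler_nat//.
apply: (cvgr_to_le c); near=> k; exact: step.
Unshelve. all: by end_near. Qed.

End null_quantile.

Lemma le_sup_seq {R : realType} (I : eqType) (r : seq I) (f : I -> R) i :
  i \in r -> f i <= sup [set f j | j in [set` r]].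
Proof.
move=> ir; apply: ub_le_sup; last by exists i.
exists (\sum_(j <- r) `|f j|) => _ [j /= jr <-].
rewrite (big_rem j)//= (le_trans (ler_norm _))// lerDl.
exact: sumr_ge0.
Qed.

Lemma sup_seq_gt0 {R : realType} (I : eqType) (r : seq I) (f : I -> R) :
  0 < sup [set f j | j in [set` r]] -> exists2 i, i \in r & 0 < f i.
Proof.
move=> f0; apply/not_exists2P => H.
suff : sup [set f j | j in [set` r]] <= 0 by rewrite leNgt f0.
case: r => [|i r] in f0 H *.
  by rewrite (_ : [set f j | j in _] = set0) ?sup0//; apply/seteqP; split => // x [].
apply: ge_sup; first by exists (f i), i => //; rewrite /= mem_head.
move=> _ [j /= jr <-]; rewrite leNgt; apply/negP => fj.
by have [/(_ jr)|/(_ fj)] := H j.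
Qed.

(** Common scheme of the two tests: the weight [v i] is [expR (- W J)] for the first and the inverse
    of [2 ^ j * Jbar] for the second. *)
Section test_u.
Context {R : realType} {L : R} (M : poisson_experiment L) (n : nat).
Hypothesis null_ex : exists s, null_given M n s.
Variables (I : choiceType) (r : seq I) (S : I -> sample M -> R) (v : I -> R) (b : I -> R).
Hypothesis mS : forall i x, measurable [set w | S i w <= x].
Hypothesis bS : forall i w, npts M w = n -> `|S i w| <= b i.
Hypothesis v01 : forall i, 0 < v i <= 1.
Hypothesis v1 : \sum_(i <- r) v i <= 1.

Let rej (u : R) := [set w | 0 < sup [set S i w - null_quantile M (S i) n (u * v i) | i in [set` r]]].

Let adm (a : R) := [set u | 0 < u < 1 /\ sup [set cond_law M s (rej u) n | s in null_given M n] <= a].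

Let adm_lt1 a : ubound (adm a) 1.
Proof. by move=> u [/andP[_ /ltW]]. Qed.

Lemma test_u_le1 a : test_u M rej a n <= 1.
Proof.
change (sup (adm a) <= 1).
have [->|/set0P ne] := eqVneq (adm a) set0; first by rewrite sup0.
exact: ge_sup (@adm_lt1 a).
Qed.

(** By the union bound, [a] itself is an admissible [u]: the calibrated test is at least as powerful
    as its Bonferroni version. *)
Lemma test_u_ge a : 0 < a < 1 -> a <= test_u M rej a n.
Proof.
move=> a01; apply: ub_le_sup; first by exists 1; exact: adm_lt1.
split => //; apply: ge_sup; first by have [s sn] := null_ex; exists (cond_law M s (rej a) n), s.
move=> _ [s sn <-].
pose E i := [set w | null_quantile M (S i) n (a * v i) < S i w].
have mE i : measurable (E i).
  rewrite (_ : E i = ~` [set w | S i w <= null_quantile M (S i) n (a * v i)]).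
    exact: measurableC.
  by apply/seteqP; split => w /=; rewrite /E/= ltNge => /negP.
have rejE : rej a = \big[setU/set0]_(i <- r) E i.
  rewrite -bigcup_seq; apply/seteqP; split => w /=.
    by move=> /sup_seq_gt0[i ir]; rewrite subr_gt0 => qS; exists i.
  move=> [i /= ir qS]; rewrite /rej/=.
  have := @le_sup_seq _ _ _ (fun i => S i w - null_quantile M (S i) n (a * v i)) _ ir.
  by apply: lt_le_trans; rewrite subr_gt0.
rewrite rejE; apply: le_trans (cond_law_bigU _ sn mE) _.
have [a0 a1] := andP a01.
apply: (@le_trans _ _ (\sum_(i <- r) a * v i)).
  apply: ler_sum => i _; have /andP[vi0 vi1] := v01 i.
  apply: (null_quantileP null_ex (mS i) (bS i) (u := a * v i) _ sn).
  by rewrite mulr_gt0//= (le_lt_trans _ a1)// ger_pMr.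
by rewrite -mulr_sumr ger_pMr.
Qed.

(** Turns a null tail bound at level [a * v i] into a bound on the observed statistic, the quantile
    used being taken at a level at least as large. As [test_u] is at most 1, [v i < 1] keeps that
    level below 1. *)
Lemma not_reject_le a t i w : 0 < a < 1 -> i \in r -> npts M w = n -> v i < 1 ->
  ~ (0 < sup [set S i w - null_quantile M (S i) n (test_u M rej a n * v i) | i in [set` r]]) ->
  (forall s, null_given M n s -> cond_law M s [set w | t < S i w] n <= a * v i) ->
  S i w <= t.
Proof.
move=> a01 ir wn vi1 nr H.
have /andP[vi0 _] := v01 i.
apply: (@le_trans _ _ (null_quantile M (S i) n (test_u M rej a n * v i))).
  rewrite -subr_le0 leNgt; apply/negP => qS; apply: nr; apply: lt_le_trans qS _.
  exact: (@le_sup_seq _ _ _ (fun i => S i w - null_quantile M (S i) n (test_u M rej a n * v i))).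
apply: (null_quantile_le null_ex (mS i) (bS i)).
  by apply: le_lt_trans vi1; rewrite ler_piMl// ?test_u_le1// ltW.
move=> s sn; apply: le_trans (H s sn) _.
by rewrite ler_wpM2r ?test_u_ge// ltW.
Qed.

End test_u.

(** * Dyadic cells and Haar statistics *)

Definition cell {R : realType} (J i : nat) : set R :=
  `[i%:R / 2 ^+ J, i.+1%:R / 2 ^+ J[%classic.

Lemma big_ord_double {R : realType} n (f : nat -> R) :
  \sum_(i < n.*2) f i = \sum_(k < n) (f k.*2 + f k.*2.+1).
Proof.
by elim: n => [|n IH]; rewrite ?big_ord0// doubleS !big_ord_recr/= IH addrA.
Qed.

Section dyadic_tree.
Context {R : realType} (a : nat -> nat -> R).
Hypothesis aS : forall j k, a j k = a j.+1 k.*2 + a j.+1 k.*2.+1.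

Lemma dyadic_sum J : \sum_(i < 2 ^ J) a J i = a 0%N 0%N.
Proof.
elim: J => [|J IH]; first by rewrite expn0 big_ord1.
by rewrite -IH expnS mul2n (big_ord_double _ (a J.+1)); apply: eq_bigr => k _; rewrite (aS J).
Qed.

(** The parallelogram identity on each pair of children. It is applied both to the counts of a
    configuration and to the masses of an intensity. *)
Lemma dyadic_sum_sqr J :
  2 ^+ J.+1 * \sum_(i < 2 ^ J.+1) a J.+1 i ^+ 2 =
  2 ^+ J * \sum_(i < 2 ^ J) a J i ^+ 2 +
  \sum_(k < 2 ^ J) 2 ^+ J * (a J.+1 k.*2 - a J.+1 k.*2.+1) ^+ 2.
Proof.
rewrite expnS mul2n (big_ord_double _ (fun i => a J.+1 i ^+ 2)).
rewrite -[X in _ = _ + X]mulr_sumr -mulrDr exprS -mulrA [LHS]mulrCA; congr (_ * _).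
rewrite mulr_sumr -big_split/=; apply: eq_bigr => k _.
by rewrite (aS J); ring.
Qed.

Lemma dyadic_sum_sqr_telescope J :
  2 ^+ J * \sum_(i < 2 ^ J) a J i ^+ 2 = a 0%N 0%N ^+ 2 +
  \sum_(j < J) \sum_(k < 2 ^ j) 2 ^+ j * (a j.+1 k.*2 - a j.+1 k.*2.+1) ^+ 2.
Proof.
elim: J => [|J IH]; first by rewrite big_ord0 addr0 expr0 mul1r expn0 big_ord1.
by rewrite dyadic_sum_sqr IH big_ord_recr/= addrA.
Qed.

End dyadic_tree.

Lemma sum_Lam {R : realType} J (F : nat * nat -> R) :
  \sum_(lam <- Lam J) F lam = \sum_(j < J) \sum_(k < 2 ^ j) F (j : nat, k : nat).
Proof.
have iotaE n : iota 0 n = index_iota 0 n by rewrite /index_iota subn0.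
rewrite /Lam big_allpairs_dep iotaE big_mkord.
by apply: eq_bigr => j _; rewrite iotaE big_mkord.
Qed.

Section cells.
Context {R : realType}.
Implicit Types (x : R).

Lemma two_expr_gt0 n : 0 < 2 ^+ n :> R. Proof. exact: exprn_gt0. Qed.

Lemma mem_set_itv (i : interval R) x : (x \in [set` i]) = (x \in i).
Proof. by apply/idP/idP => [/set_mem|/mem_set]. Qed.

Lemma mem_cell J i x : (x \in cell J i) = (i%:R <= 2 ^+ J * x < i.+1%:R).
Proof.
rewrite mem_set_itv in_itv/= ler_pdivrMr ?two_expr_gt0//.
by rewrite ltr_pdivlMr ?two_expr_gt0// mulrC.
Qed.

Lemma cell_child J k x :
  (x \in cell J k) = (x \in cell J.+1 k.*2) || (x \in cell J.+1 k.*2.+1).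
Proof.
rewrite !mem_cell exprS -mulrA.
have -> : k.*2.+1%:R = 2 * k%:R + 1 :> R by rewrite -natr1 -mul2n natrM.
have -> : k.*2.+2%:R = 2 * k%:R + 2 :> R by rewrite -natr1 -natr1 -mul2n natrM -addrA.
rewrite -natr1 -mul2n natrM.
set y := 2 ^+ J * x.
apply/idP/idP => [/andP[h1 h2]|].
  have [h|h] := ltP (2 * y) (2 * k%:R + 1); apply/orP; [left|right]; apply/andP; split; lra.
by move=> /orP[/andP[h1 h2]|/andP[h1 h2]]; apply/andP; split; lra.
Qed.

Lemma cell_children_disj J k x :
  x \in cell J.+1 k.*2 -> x \in cell J.+1 k.*2.+1 -> False.
Proof.
by rewrite !mem_cell => /andP[_ h1] /andP[h2 _]; lra.
Qed.

Lemma haarE j k x : haar (j, k) x = 2 `^ (j%:R / 2) *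
  ((x \in cell j.+1 k.*2)%:R - (x \in cell j.+1 k.*2.+1)%:R).
Proof.
rewrite /haar/= /haar_mother !indicE; congr (_ * (_%:R - _%:R)); congr nat_of_bool.
  rewrite mem_cell mem_set_itv in_itv/= exprS -mulrA.
  have -> : k.*2.+1%:R = 2 * k%:R + 1 :> R by rewrite -natr1 -mul2n natrM.
  have -> : k.*2%:R = 2 * k%:R :> R by rewrite -mul2n natrM.
  set y := 2 ^+ j * x; have : 2 * 2^-1 = 1 :> R by rewrite divff.
  by move=> i2; apply/andP/andP => -[h1 h2]; split; lra.
rewrite mem_cell mem_set_itv in_itv/= exprS -mulrA.
have -> : k.*2.+1%:R = 2 * k%:R + 1 :> R by rewrite -natr1 -mul2n natrM.
have -> : k.*2.+2%:R = 2 * k%:R + 2 :> R by rewrite -natr1 -natr1 -mul2n natrM -addrA.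
set y := 2 ^+ j * x; have i2 : 2 * 2^-1 = 1 :> R by rewrite divff.
by apply/andP/andP => -[h1 h2]; split; lra.
Qed.

Lemma powR_half_sqr j : (2 `^ (j%:R / 2)) ^+ 2 = 2 ^+ j :> R.
Proof. by rewrite -powR_mulrn ?powR_ge0// -powRrM divfK// powR_mulrn. Qed.

End cells.

Section statistics.
Context {R : realType} {L : R} (M : poisson_experiment L).

Definition cnt (J i : nat) (w : sample M) : R :=
  (point_count (npts M) (pts M) (cell J i) w)%:R.

Lemma cntS w j k : cnt j k w = cnt j.+1 k.*2 w + cnt j.+1 k.*2.+1 w.
Proof.
rewrite /cnt -natrD; congr (_%:R); rewrite /point_count -big_split/=.
apply: eq_bigr => l _; rewrite cell_child.
have [h1|h1] := boolP (_ \in cell _ k.*2) => //=.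
by have [/(cell_children_disj h1)|] := boolP (_ \in cell _ k.*2.+1).
Qed.

Lemma sum_neq_mul n (f : 'I_n -> R) :
  \sum_(l < n) \sum_(l' < n | l != l') f l * f l' =
  (\sum_l f l) ^+ 2 - \sum_l f l ^+ 2.
Proof.
rewrite expr2 big_distrlr/= -sumrB; apply: eq_bigr => l _.
rewrite [in RHS](bigD1 l)//= expr2 addrAC subrr add0r.
by apply: eq_bigl => l'; rewrite eq_sym.
Qed.

Lemma T_statE j k w : T_stat M (j, k) w = (L ^+ 2)^-1 * (2 ^+ j *
  ((cnt j.+1 k.*2 w - cnt j.+1 k.*2.+1 w) ^+ 2 - (cnt j.+1 k.*2 w + cnt j.+1 k.*2.+1 w))).
Proof.
rewrite /T_stat sum_neq_mul; congr (_ * _).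
under eq_bigr do rewrite haarE.
under [X in _ - X]eq_bigr do rewrite haarE exprMn powR_half_sqr.
rewrite -!mulr_sumr exprMn powR_half_sqr -mulrBr sumrB -!natr_sum.
congr (_ * (_ - _)); rewrite /cnt -natrD /point_count -big_split/= natr_sum.
apply: eq_bigr => l _.
have [h1|h1] := boolP (_ \in cell _ k.*2); have [h2|h2] := boolP (_ \in cell _ k.*2.+1).
- by have := cell_children_disj h1 h2.
- by rewrite subr0 expr1n.
- by rewrite sub0r sqrrN expr1n.
- by rewrite subr0 expr0n.
Qed.

(** The squared count differences telescope over the scales; the diagonal terms contribute [2 ^ j]
    times the total at scale [j], hence [2 ^ J - 1] times in all. A point at 1 lies in none of these
    cells and is not seen by these Haar functions, so the identity holds for every [w]. *)
Lemma T'_statE J w : T'_stat M J w =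
  (L ^+ 2)^-1 * ustat (counts M (fun i : 'I_(2 ^ J) => cell J i) w).
Proof.
rewrite /T'_stat sum_Lam.
under eq_bigr do under eq_bigr do rewrite T_statE.
under eq_bigr do rewrite -mulr_sumr.
rewrite -mulr_sumr; congr (_ * _).
have E := dyadic_sum_sqr_telescope (a := fun j k => cnt j k w) (cntS w).
have S1 j : \sum_(i < 2 ^ j) cnt j i w = cnt 0 0 w.
  exact: (dyadic_sum (a := fun j k => cnt j k w) (cntS w)).
rewrite /ustat sumrB [(total _)%:R](_ : _ = cnt 0 0 w); last first.
  by rewrite -(S1 J) natr_sum.
rewrite [X in _ * (_ - X)](S1 J).
rewrite mulrBr natrX [X in X - _ - _](E J).
under eq_bigr do under eq_bigr do rewrite mulrBr -cntS.
under eq_bigr do rewrite sumrB -[X in _ - X]mulr_sumr S1.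
rewrite sumrB -mulr_suml.
have -> : \sum_(j < J) 2 ^+ j = 2 ^+ J - 1 :> R.
  elim: J {E} => [|J IH]; first by rewrite big_ord0 expr0 subrr.
  by rewrite big_ord_recr/= IH exprS; ring.
by ring.
Qed.

End statistics.

(** * Dyadic energy of an intensity *)

Lemma lebesgue_cell {R : realType} J i :
  @lebesgue_measure R (cell J i) = (2 ^- J)%:E.
Proof.
rewrite /cell lebesgue_measure_itv/= lte_fin ltr_pM2r ?invr_gt0 ?two_expr_gt0//.
rewrite ltr_nat ltnSn -EFinD; congr EFin.
by rewrite -mulrBl -natr1 addrAC subrr add0r mul1r.
Qed.

Lemma measurable_cell {R : realType} J i : measurable (@cell R J i).
Proof. exact: measurable_itv. Qed.

Lemma cell_I01 {R : realType} J i : (i < 2 ^ J)%N -> @cell R J i `<=` `[0, 1[%classic.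
Proof.
move=> iJ x; rewrite /cell/= !in_itv/= => /andP[h1 h2]; apply/andP; split.
  by apply: (le_trans _ h1); rewrite divr_ge0// ltW// two_expr_gt0.
apply: lt_le_trans h2 _; rewrite ler_pdivrMr ?two_expr_gt0// mul1r -natrX ler_nat//.
Qed.

Lemma bounded_integrable {R : realType} (A : set R) (f : R -> R) (c : R) :
  measurable A -> (@lebesgue_measure R A < +oo)%E -> measurable_fun setT f ->
  (forall x, `|f x| <= c) -> (@lebesgue_measure R).-integrable A (EFin \o f).
Proof.
move=> mA Aoo mf fc; apply: measurable_bounded_integrable => //.
  exact: measurable_funS mf.
by exists c; split=> [|K cK x _]; [exact: num_real|rewrite /= (le_trans (fc x))// ltW].
Qed.

Section patch_I01.
Context {R : realType} (s : R -> R) (r : R).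
Hypotheses (ints : intensity s) (bs : bounded_by r s).

Lemma measurable_patch_I01 : measurable_fun setT (s \_ I01).
Proof. by have /sub_Lfun_mfun := ints.2; rewrite inE. Qed.

Lemma bounded_by_ge0 : 0 <= r.
Proof.
have I0 : I01 (0 : R) by rewrite /I01/= in_itv/= lexx ler01.
exact: le_trans (normr_ge0 _) (bs I0).
Qed.

Lemma patch_I01_le x : `|(s \_ I01) x| <= r.
Proof.
by rewrite patchE; case: ifPn => [/set_mem /bs//|_]; rewrite normr0 bounded_by_ge0.
Qed.

Lemma patch_I01_ge0 x : 0 <= (s \_ I01) x.
Proof. by rewrite patchE; case: ifPn => // /set_mem; exact: ints.1. Qed.

Lemma integrable_patch_I01 A : measurable A -> (lebesgue_measure A < +oo)%E ->
  (@lebesgue_measure R).-integrable A (EFin \o (s \_ I01)).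
Proof.
move=> mA Aoo; exact: bounded_integrable measurable_patch_I01 patch_I01_le.
Qed.

End patch_I01.

Section intensity.
Context {R : realType} (s : R -> R) (r : R).
Hypotheses (ints : intensity s) (bs : bounded_by r s).

Local Notation mu := (@lebesgue_measure R).
Let g := s \_ I01.

Definition mass (J i : nat) : R := \int[mu]_(x in cell J i) (s \_ I01) x.

Let mg : measurable_fun setT g := measurable_patch_I01 ints.

Let gr x : `|g x| <= r := patch_I01_le bs x.

Let g0 x : 0 <= g x := patch_I01_ge0 ints x.

Let intgc J i : mu.-integrable (cell J i) (EFin \o g).
Proof. by apply: (integrable_patch_I01 ints bs); rewrite ?lebesgue_cell ?ltry//; exact: measurable_cell. Qed.

Lemma mass_ge0 J i : 0 <= mass J i.
Proof. by apply: Rintegral_ge0 => x _; exact: g0. Qed.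

Lemma mass_le J i : 2 ^+ J * mass J i <= r.
Proof.
rewrite mulrC -ler_pdivlMr ?two_expr_gt0//.
apply: (@le_trans _ _ (\int[mu]_(x in cell J i) r)); last first.
  rewrite Rintegral_cst; last exact: measurable_cell.
  by rewrite [X in fine X](_ : _ = (2 ^- J)%:E)//; exact: lebesgue_cell.
apply: le_Rintegral; [exact: measurable_cell|exact: intgc| |].
  apply: (@bounded_integrable _ _ _ `|r|) => //; first exact: measurable_cell.
  by rewrite lebesgue_cell ltry.
by move=> x _; rewrite (le_trans (ler_norm _))// gr.
Qed.

Lemma cell_setU J k : @cell R J k = cell J.+1 k.*2 `|` cell J.+1 k.*2.+1.
Proof.
apply/seteqP; split => x.
  move=> /mem_set; rewrite cell_child => /orP[|] /set_mem; by [left|right].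
by move=> [] /mem_set h; apply/set_mem; rewrite cell_child h ?orbT.
Qed.

Lemma massS j k : mass j k = mass j.+1 k.*2 + mass j.+1 k.*2.+1.
Proof.
rewrite /mass cell_setU Rintegral_setU//; try exact: measurable_cell.
  by rewrite -cell_setU; exact: intgc.
apply/disj_setPLR => x /mem_set h1 /mem_set h2; exact: cell_children_disj h1 h2.
Qed.

Lemma massL (L : R) J i : (i < 2 ^ J)%N -> \int[mu]_(x in cell J i) (L * s x) = L * mass J i.
Proof.
move=> iJ; rewrite /mass -(@RintegralZl _ _ _ mu (cell J i) g L (measurable_cell J i) (intgc J i)).
apply: eq_Rintegral => x /set_mem /(cell_I01 iJ) xI; rewrite /g patchE mem_set//.
move: xI; rewrite /I01/= !in_itv/= => /andP[-> /ltW ->//].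
Qed.

Lemma haar_coefE j k : (k < 2 ^ j)%N ->
  haar_coef s (j, k) = 2 `^ (j%:R / 2) * (mass j.+1 k.*2 - mass j.+1 k.*2.+1).
Proof.
move=> kj; rewrite /haar_coef /L2scal.
have -> : \int[mu]_(x in I01) (s x * haar (j, k) x) =
    \int[mu]_x (2 `^ (j%:R / 2) * ((g \_ (cell j.+1 k.*2)) x - (g \_ (cell j.+1 k.*2.+1)) x)).
  rewrite Rintegral_mkcond; apply: eq_Rintegral => x _.
  rewrite !patchE; case: ifPn => [xI|xI].
    rewrite haarE mulrCA; congr (_ * _).
    have -> : g x = s x by rewrite /g patchE xI.
    by case: ifPn => _; case: ifPn => _; rewrite ?subr0 ?subrr ?sub0r ?mulr0 ?mulr1 ?mulrN1.
  have -> : g x = 0 by rewrite /g patchE (negbTE xI).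
  by rewrite !if_same subrr mulr0.
have h A : measurable A -> (mu A < +oo)%E -> mu.-integrable setT (EFin \o (g \_ A)).
  by move=> mA Aoo; rewrite -restrict_EFin; apply/integrable_restrict => //; rewrite setTI; exact: (integrable_patch_I01 ints bs).
have h1 : mu.-integrable setT (EFin \o (g \_ (cell j.+1 k.*2))).
  by apply: h; rewrite ?lebesgue_cell ?ltry//; exact: measurable_cell.
have h2 : mu.-integrable setT (EFin \o (g \_ (cell j.+1 k.*2.+1))).
  by apply: h; rewrite ?lebesgue_cell ?ltry//; exact: measurable_cell.
rewrite RintegralZl//; last exact: (integrableB measurableT h1 h2).
by rewrite RintegralB// -!Rintegral_mkcond.
Qed.

(** The squared norm of the orthogonal projection of [s] onto the functions constant on the cells of
    scale [J]. *)
Definition energy J : R := 2 ^+ J * \sum_(i < 2 ^ J) mass J i ^+ 2.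

Lemma energyE J : energy J = mass 0 0 ^+ 2 +
  \sum_(j < J) \sum_(k < 2 ^ j) haar_coef s (j : nat, k : nat) ^+ 2.
Proof.
rewrite /energy dyadic_sum_sqr_telescope; last exact: massS.
congr (_ + _); apply: eq_bigr => j _; apply: eq_bigr => k _.
by rewrite haar_coefE// exprMn powR_half_sqr.
Qed.

End intensity.

Section dyadic_differentiation.
Context {R : realType}.
Local Notation mu := (@lebesgue_measure R).

Lemma mem_cell_truncn n i (y : R) : y \in cell n i -> Num.truncn (2 ^+ n * y) = i.
Proof. by rewrite mem_cell => /truncn_def. Qed.

Lemma exists_cell n (y : R) : 0 <= y < 1 -> exists2 i, (i < 2 ^ n)%N & y \in cell n i.
Proof.
move=> /andP[y0 y1]; have py : 0 <= 2 ^+ n * y by rewrite mulr_ge0// ltW// two_expr_gt0.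
exists (Num.truncn (2 ^+ n * y)); last by rewrite mem_cell truncn_itv.
have /andP[+ _] := truncn_itv py; rewrite -(ltr_nat R) natrX => /le_lt_trans; apply.
by rewrite gtr_pMr// two_expr_gt0.
Qed.

(** The differentiation theorem asks for a family around every real [y], negative ones included,
    hence the integer-valued [floor]; for [y] in [0, 1[ this is the [cell] containing it. *)
Let E (y : R) (n : nat) : set R :=
  `[(Num.floor (2 ^+ n * y))%:~R / 2 ^+ n, (Num.floor (2 ^+ n * y) + 1)%:~R / 2 ^+ n[%classic.

Let E_cell y n i : y \in cell n i -> E y n = cell n i.
Proof.
rewrite mem_cell => yi; rewrite /E /cell (@floor_def _ _ (i%:Z)).
  by rewrite intrD -!pmulrn natr1.
by rewrite intrD -!pmulrn natr1.
Qed.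

Let muE y n : mu (E y n) = (2 ^- n)%:E.
Proof.
rewrite /E lebesgue_measure_itv/= lte_fin ltr_pM2r ?invr_gt0 ?two_expr_gt0//.
rewrite ltr_int ltrDl ltr01 -EFinD; congr EFin.
by rewrite -mulrBl -intrB addrAC subrr add0r mul1r.
Qed.

Let nice_E y : nicely_shrinking y (E y).
Proof.
have p0 n : 0 < 2 ^- n :> R by rewrite invr_gt0 two_expr_gt0.
split=> [n|]; first exact: measurable_itv.
exists (2, fun n => PosNum (p0 n)); split => //=.
- have -> : (fun n => 2 ^- n) = (fun n => (2^-1 : R) ^+ n) by apply/funext => n; rewrite exprVn.
  by apply: cvg_expr; rewrite ger0_norm// invf_lt1// ltr1n.
- move=> n z; rewrite /E/= in_itv/= => /andP[h1 h2].
  have /andP[h3 h4] := floor_itv (2 ^+ n * y).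
  have q0 := two_expr_gt0 (R := R) n.
  move: h1 h2; rewrite ler_pdivrMr// ltr_pdivlMr// => h1 h2.
  rewrite /ball/= ltr_norml -(ltr_pM2r q0) -[X in _ && X](ltr_pM2r q0) mulNr mulVf ?gt_eqF//.
  rewrite intrD in h2 h4; apply/andP; split; nra.
- move=> n; rewrite (lebesgue_measure_ball _ (ltW (p0 n))) -/mu muE -EFinM lee_fin.
  by rewrite mulr_natl.
Qed.

Variables (s : R -> R) (r : R).
Hypotheses (ints : intensity s) (bs : bounded_by r s).
Let g := s \_ I01.

Let mg : measurable_fun setT g := measurable_patch_I01 ints.

Let gr x : `|g x| <= r := patch_I01_le bs x.

Let g0 x : 0 <= g x := patch_I01_ge0 ints x.

Let D : set R := `[0, 1[%classic.

Let mD : measurable D.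
Proof. exact: measurable_itv. Qed.

Let muD : mu D = 1%:E.
Proof. by rewrite /D lebesgue_measure_itv/= lte_fin ltr01 oppr0 adde0. Qed.

(** The cell average of [g] multiplied by [g] itself rather than squared: the integral is still the
    energy, and the limit is still the square of [g]. *)
Let step n y : R := \sum_(i < 2 ^ n) 2 ^+ n * mass s n i * (g \_ (cell n i)) y.

Let stepE n i y : (i < 2 ^ n)%N -> y \in cell n i -> step n y = 2 ^+ n * mass s n i * g y.
Proof.
move=> iJ yi; rewrite /step (bigD1 (Ordinal iJ))//= patchE yi big1 ?addr0// => j ji.
rewrite patchE; case: ifPn => [yj|]; last by rewrite mulr0.
move: ji; rewrite -val_eqE/= -(mem_cell_truncn yi) -(mem_cell_truncn yj).
by rewrite eqxx.
Qed.

Let mstep n : measurable_fun setT (step n).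
Proof.
apply: measurable_sum => i; apply: measurable_funM => //.
by apply/(measurable_restrictT _ (measurable_cell _ _)); exact: measurable_funS mg.
Qed.

Let step_le n y : D y -> `|step n y| <= r * r.
Proof.
rewrite /D/= in_itv/= => /(exists_cell n)[i iJ yi].
rewrite (stepE iJ yi) normrM ler_pM//.
rewrite ger0_norm ?mass_le//.
by rewrite mulr_ge0 ?(mass_ge0 ints)// ltW// two_expr_gt0.
Qed.

Let integral_step n : \int[mu]_(y in D) step n y = energy s n.
Proof.
have ig i : (i < 2 ^ n)%N -> mu.-integrable D (EFin \o (g \_ (cell n i))).
  move=> iJ; rewrite -restrict_EFin; apply/integrable_restrict => //.
    exact: measurable_cell.
  apply: (integrable_patch_I01 ints bs); first by apply: measurableI; [exact: measurable_itv|exact: measurable_cell].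
  by rewrite (setIidr (cell_I01 iJ)) lebesgue_cell ltry.
rewrite /step /Rintegral.
under eq_integral do rewrite -sumEFin.
rewrite integral_sum//; last first.
  by move=> i; under eq_fun do rewrite EFinM; apply: integrableZl => //; exact: ig.
rewrite (eq_bigr (fun i : 'I_(2 ^ n) => (2 ^+ n * mass s n i ^+ 2)%:E)); last first.
  move=> i _; under eq_integral do rewrite EFinM.
  rewrite integralZl//; last exact: ig.
  rewrite -[X in (_ * X)%E]fineK; last exact/integrable_fin_num/ig.
  rewrite -[fine _]/(\int[mu]_(y in D) (g \_ (cell n i)) y) -Rintegral_mkcondr.
  rewrite (setIidr (cell_I01 (ltn_ord i))) -EFinM; congr EFin.
  by rewrite -/(mass s n i); ring.
by rewrite sumEFin/= /energy mulr_sumr.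
Qed.

Lemma energy_cvg : energy s n @[n --> \oo] --> \int[mu]_(x in D) (g x ^+ 2).
Proof.
have locg : locally_integrable setT g.
  apply: open_integrable_locally; first exact: openT.
  rewrite [EFin \o g](_ : _ = EFin \o (g \_ I01)); last first.
    by apply/funext => x; rewrite /g /= !patchE; case: ifPn.
  rewrite -restrict_EFin; apply/integrable_restrict => //; first exact: measurable_itv.
  rewrite setTI; apply: (integrable_patch_I01 ints bs); first exact: measurable_itv.
  by rewrite /I01 lebesgue_measure_itv/= lte_fin ltr01 oppr0 adde0 ltry.
have cvgD : {ae mu, forall x, D x -> (EFin \o step n) x @[n --> \oo] --> (EFin \o (fun x => g x ^+ 2)) x}.
  have := lebesgue_differentiation locg; apply: negligibleS => x /= nx lx; apply: nx => Dx.
  have h := nice_lebesgue_differentiation nice_E locg lx.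
  have -> : (fun n => (EFin \o step n) x) = (fun n => (g x)%:E *
      ((mu (E x n))^-1 * \int[mu]_(y in E x n) (g y)%:E))%E.
    apply/funext => n; have [i iJ xi] := exists_cell n Dx.
    rewrite /= (stepE iJ xi) muE (E_cell xi) inver gt_eqF ?invr_gt0 ?two_expr_gt0// invrK.
    rewrite -[X in (_ * (_ * X))%E]fineK -?EFinM; last first.
      by apply/integrable_fin_num/(integrable_patch_I01 ints bs); rewrite ?lebesgue_cell ?ltry//; exact: measurable_cell.
    by congr EFin; rewrite mulrC.
  rewrite expr2 EFinM.
  by apply: cvgeZl.
have [|||||ig _ cv] := @dominated_convergence _ _ _ mu D mD
  (fun n => EFin \o step n) (EFin \o (fun x => g x ^+ 2)) (EFin \o cst (r * r)).
- by move=> n; apply/measurable_EFinP; exact: measurable_funS (mstep n).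
- by apply/measurable_EFinP; apply: measurable_funX; exact: measurable_funS mg.
- exact: cvgD.
- by apply: (@bounded_integrable _ _ _ `|r * r|) => //; rewrite muD ltry.
- by apply: aeW => x n Dx; rewrite lee_fin; exact: step_le.
have -> : (fun n => energy s n) = (fun n => fine (\int[mu]_(x in D) (EFin \o step n) x)%E).
  by apply/funext => n; rewrite -integral_step.
apply: fine_cvg; rewrite fineK; first exact: cv.
exact: integrable_fin_num.
Qed.

End dyadic_differentiation.

Section distance.
Context {R : realType}.
Local Notation mu := (@lebesgue_measure R).
Variables (s : R -> R) (r : R).
Hypotheses (ints : intensity s) (bs : bounded_by r s).
Let g := s \_ I01.
Let D : set R := `[0, 1[%classic.

Let mg : measurable_fun setT g := measurable_patch_I01 ints.

Let gr x : `|g x| <= r := patch_I01_le bs x.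

Let mD : measurable D.
Proof. exact: measurable_itv. Qed.

Let muD : mu D = 1%:E.
Proof. by rewrite /D lebesgue_measure_itv/= lte_fin ltr01 oppr0 adde0. Qed.

Let Dcell : D = cell 0 0.
Proof. by rewrite /D /cell expr0 !divr1. Qed.

Let p := mass s 0 0.

Let int_dev_sqr : (\int[mu]_x (((s \- cst p) \_ I01) x ^+ 2)%:E =
  (\int[mu]_(x in D) (g x ^+ 2) - p ^+ 2)%:E)%E.
Proof.
have bi (f : R -> R) (c : R) : measurable_fun setT f -> (forall x, `|f x| <= c) -> mu.-integrable D (EFin \o f).
  by move=> mf fc; apply: (@bounded_integrable _ _ _ c) => //; rewrite muD ltry.
have i2 : mu.-integrable D (EFin \o (fun x => g x ^+ 2)).
  apply: (bi _ (r ^+ 2)); first exact: measurable_funX.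
  by move=> x; rewrite normrX lerXn2r// nnegrE (bounded_by_ge0 bs).
have i1 : mu.-integrable D (EFin \o (fun x => 2 * p * g x)).
  apply: (bi _ (`|2 * p| * r)); first by apply: measurable_funM => //.
  by move=> x; rewrite normrM ler_wpM2l.
have i0 : mu.-integrable D (EFin \o (fun=> p ^+ 2)).
  exact: (bi _ `|p ^+ 2|).
have i3 : mu.-integrable D (EFin \o (fun x => g x ^+ 2 - 2 * p * g x)).
  by apply: (integrableB _ i2 i1).
have i4 : mu.-integrable D (EFin \o (fun x => g x ^+ 2 - 2 * p * g x + p ^+ 2)).
  by apply: (integrableD _ i3 i0).
transitivity (\int[mu]_(x in D) (g x ^+ 2 - 2 * p * g x + p ^+ 2)%:E)%E.
  transitivity (\int[mu]_(x in I01) ((g x - p) ^+ 2)%:E)%E.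
    rewrite [RHS]integral_mkcond; apply: eq_integral => x _.
    rewrite !patchE; case: ifPn => xI; last by rewrite expr0n.
    by rewrite /g patchE xI.
  rewrite /I01 -integral_itv_bndo_bndc; last first.
    apply/measurable_EFinP; apply: measurable_funX; apply: measurable_funB => //.
    exact: measurable_funS mg.
  by apply: eq_integral => x _; congr EFin; ring.
rewrite -[LHS]fineK; last exact: (integrable_fin_num _ i4).
congr EFin; rewrite -[LHS]/(\int[mu]_(x in D) (g x ^+ 2 - 2 * p * g x + p ^+ 2)).
rewrite RintegralD// RintegralB// Rintegral_cst// RintegralZl//; last first.
  exact: bi mg gr.
have -> : \int[mu]_(x in D) g x = p by rewrite {1}Dcell.
by rewrite [fine (mu D)](_ : _ = 1); [ring|exact: (congr1 fine muD)].
Qed.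

Let int_dev_ge0 : 0 <= \int[mu]_(x in D) (g x ^+ 2) - p ^+ 2.
Proof. by rewrite -lee_fin -int_dev_sqr integral_ge0// => x _; rewrite lee_fin sqr_ge0. Qed.

(** The distance is at most the norm of [s - p], whose square is the limit of [energy s J - p ^+ 2],
    hence at most [c]. The strict inequality is inherited from the separation. *)
Lemma dist_constants_lt rho c : 0 <= rho -> (rho%:E < L2dist s constants)%E ->
  (forall J, energy s J - p ^+ 2 <= c) -> rho ^+ 2 < c.
Proof.
move=> rho0 rd Jc.
have h1 : (rho%:E < L2norm (s \- cst p)%R)%E.
  by apply: lt_le_trans rd _; apply: ereal_inf_lbound; exists (cst p) => //; exists p.
have Vc : \int[mu]_(x in D) (g x ^+ 2) - p ^+ 2 <= c.
  have cv := energy_cvg ints bs.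
  have : (fun n => energy s n - p ^+ 2) n @[n --> \oo] -->
      \int[mu]_(x in D) (g x ^+ 2) - p ^+ 2 by apply: cvgB cv (cvg_cst _).
  by move=> h; apply: (cvgr_to_le h); apply: nearW => n; exact: Jc.
apply: lt_le_trans Vc; move: h1; rewrite /L2norm unlock /Lnorm.
under eq_integral.
  move=> x _.
  rewrite /comp abse_EFin poweR_EFin powR_mulrn// -normrX ger0_norm ?sqr_ge0//.
  over.
rewrite int_dev_sqr poweR_EFin lte_fin powR12_sqrt.
  by move=> h; rewrite -(sqr_sqrtr int_dev_ge0) ltrXn2r// ?nnegrE ?sqrtr_ge0.
exact: int_dev_ge0.
Qed.
End distance.

(** * Laws of the dyadic counts *)

Section cell_partition.
Context {R : realType} (J : nat).

Lemma cell_subI01 i : (i < 2 ^ J)%N -> @cell R J i `<=` I01.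
Proof.
move=> iJ x /(cell_I01 iJ); rewrite /I01/= !in_itv/= => /andP[-> /ltW ->//].
Qed.

Lemma cell_disj i j : i != j -> @cell R J i `&` cell J j = set0.
Proof.
move=> ij; apply/seteqP; split => // x [/mem_set xi /mem_set xj].
by move: ij; rewrite -(mem_cell_truncn xi) -(mem_cell_truncn xj) eqxx.
Qed.

Lemma set1_subI01 : [set 1 : R] `<=` I01.
Proof. by move=> _ ->; rewrite /I01/= in_itv/= ler01 lexx. Qed.

Lemma cell_cover (x : R) : I01 x -> ~ [set 1 : R] x ->
  exists i : 'I_(2 ^ J), cell J i x.
Proof.
rewrite /I01/= in_itv/= => /andP[x0 x1] xn1.
have x01 : 0 <= x < 1 by rewrite x0/= lt_neqAle x1 andbT; apply/eqP.
by have [i iJ /set_mem xi] := exists_cell J x01; exists (Ordinal iJ).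
Qed.

End cell_partition.

Section laws.
Context {R : realType} {L : R} (M : poisson_experiment L).
Hypothesis L0 : 0 < L.
Local Notation mu := (@lebesgue_measure R).
Variable J : nat.

Local Notation cts := (counts M (fun i : 'I_(2 ^ J) => cell J i)).

Lemma law_dyadic_counts s (Q : ('I_(2 ^ J) -> nat) -> Prop) n : intensity s ->
  let nu := fun i : 'I_(2 ^ J) => \int[mu]_(x in cell J i) (L * s x) in
  law M s ([set w | Q (cts w)] `&` [set w | npts M w = n]) =
  (expR (- \sum_i nu i) / n`!%:R * mexp nu n (fun k => `[< Q k >]%:R))%:E.
Proof.
move=> ints nu; apply: (law_counts M (A := fun i : 'I_(2 ^ J) => cell J i) (B := [set 1])).
- exact: ltW.
- exact: ints.
- by move=> i; exact: measurable_cell.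
- by move=> i; exact: cell_subI01.
- by move=> i j ij; exact: cell_disj.
- exact: measurable_set1.
- exact: set1_subI01.
- exact: cell_cover.
- exact: Rintegral_set1.
Qed.

Lemma law_npts_mexp s n (q : R) (pi : 'I_(2 ^ J) -> R) :
  intensity s -> \sum_i pi i = 1 ->
  (forall i : 'I_(2 ^ J), \int[mu]_(x in cell J i) (L * s x) = q * pi i) ->
  (forall Q : ('I_(2 ^ J) -> nat) -> Prop,
    law M s ([set w | Q (cts w)] `&` [set w | npts M w = n]) =
    (expR (- q) * q ^+ n / n`!%:R * mexp pi n (fun k => `[< Q k >]%:R))%:E) /\
  law M s [set w | npts M w = n] = (expR (- q) * q ^+ n / n`!%:R)%:E.
Proof.
move=> ints pi1 nuE.
have H Q : law M s ([set w | Q (cts w)] `&` [set w | npts M w = n]) =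
    (expR (- q) * q ^+ n / n`!%:R * mexp pi n (fun k => `[< Q k >]%:R))%:E.
  rewrite law_dyadic_counts//=.
  under eq_bigr do rewrite nuE.
  under [X in mexp X]eq_fun do rewrite nuE.
  by rewrite -mulr_sumr pi1 mulr1 mexp_scale; congr EFin; ring.
split => //; have := H (fun=> True).
rewrite (_ : [set w | True] `&` _ = [set w | npts M w = n]); last first.
  by apply/seteqP; split => [w []|].
move=> ->; congr EFin; rewrite -[RHS]mulr1; congr (_ * _).
by rewrite -[RHS](mexp_cst n 1 pi1); apply: mexp_eq => k _; rewrite asboolT.
Qed.

Lemma null_cond_law s n (Q : ('I_(2 ^ J) -> nat) -> Prop) : null_given M n s ->
  cond_law M s [set w | Q (cts w)] n = mexp unif n (fun k => `[< Q k >]%:R).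
Proof.
move=> [[[c sc] ints] /=].
have nuE (i : 'I_(2 ^ J)) : \int[mu]_(x in cell J i) (L * s x) = L * c * unif i.
  rewrite (@eq_Rintegral _ _ _ mu _ (fun=> L * c)) => [|x /set_mem xi].
    rewrite Rintegral_cst; last exact: measurable_cell.
    congr (_ * _); rewrite [X in fine X](_ : _ = (2 ^- J)%:E)/=; last exact: lebesgue_cell.
    by rewrite /unif natrX.
  by rewrite sc//; exact: cell_subI01 xi.
have u1 : \sum_(i < 2 ^ J) unif i = 1 :> R by apply: sum_unif; rewrite expn_gt0.
have [H HN] := law_npts_mexp n ints u1 nuE.
rewrite /cond_law H HN/= eqe => h.
by rewrite mulrAC divff// mul1r.
Qed.

End laws.

(** The constant intensity 1 charges every value of [N]; the suprema and infima that calibrate the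
    tests thus range over nonempty families of null laws. *)
Lemma null_given_ex {R : realType} {L : R} (M : poisson_experiment L) n :
  0 < L -> exists s, null_given M n s.
Proof.
move=> L0; pose J := 0%N.
have ints : intensity (cst 1 : R -> R).
  split => //; rewrite /in_L2 inE; apply/andP; split; rewrite inE.
    by apply/(measurable_restrictT _ (measurable_itv _)); exact: measurable_cst.
  rewrite /= /finite_norm unlock /Lnorm; apply: poweR_lty.
  under eq_integral.
    move=> x _; rewrite /comp abse_EFin poweR_EFin.
    rewrite (_ : _ `^ 2 = \1_(I01 : set R) x); last first.
      by rewrite indicE patchE; case: ifPn => _; rewrite ?normr1 ?powR1// normr0 powR0.
    over.
  rewrite integral_indic//; last exact: measurable_itv.
  have m1 : @lebesgue_measure R (I01 : set R) = 1%:E.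
    by rewrite /I01 lebesgue_measure_itv/= lte_fin ltr01 oppr0 adde0.
  by rewrite setIT [X in (X < _)%E](_ : _ = 1%:E) ?ltry.
exists (cst 1); split; first by split => //; exists 1.
have u1 : \sum_(i < 2 ^ J) unif i = 1 :> R by apply: sum_unif; rewrite expn_gt0.
have nuE (i : 'I_(2 ^ J)) : \int[@lebesgue_measure R]_(x in cell J i) (L * cst 1 x) = L * unif i.
  rewrite (@eq_Rintegral _ _ _ (@lebesgue_measure R) _ (fun=> L)) => [|x _]; last by rewrite /= mulr1.
  rewrite Rintegral_cst; last exact: measurable_cell.
  congr (_ * _); rewrite [X in fine X](_ : _ = (2 ^- J)%:E)/=; last exact: lebesgue_cell.
  by rewrite /unif natrX.
have [_ /= ->] := law_npts_mexp M L0 n ints u1 nuE.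
rewrite eqe gt_eqF// divr_gt0 ?ltr0n ?fact_gt0// mulr_gt0 ?expR_gt0//.
exact: exprn_gt0.
Qed.

(** * Tails of the Poisson number of points *)

Lemma sum_exp_coeff_le {R : realType} (x : R) K : 0 <= x ->
  \sum_(k < K) x ^+ k / k`!%:R <= expR x.
Proof.
move=> x0.
have -> : \sum_(k < K) x ^+ k / k`!%:R = series (exp_coeff x) K.
  by rewrite /series/= big_mkord.
apply: nondecreasing_cvgn_le; last exact: is_cvg_series_exp_coeff.
apply/nondecreasing_seqP => n; rewrite /series/= big_nat_recr//= lerDl.
by rewrite /exp_coeff divr_ge0// exprn_ge0.
Qed.

Section poisson_tails.
Context {R : realType} {L : R} (M : poisson_experiment L) (s : R -> R) (q : R).
Hypothesis q0 : 0 < q.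
Hypothesis lawN : forall n,
  law M s [set w | npts M w = n] = (expR (- q) * q ^+ n / n`!%:R)%:E.

Let pmf n : R := expR (- q) * q ^+ n / n`!%:R.

Let pmf_ge0 n : 0 <= pmf n.
Proof. by rewrite divr_ge0// mulr_ge0 ?expR_ge0// exprn_ge0// ltW. Qed.

Lemma sum_pmf_le K (P : pred 'I_K) : \sum_(n < K | P n) pmf n <= 1.
Proof.
apply: (@le_trans _ _ (\sum_(n < K) pmf n)).
  by rewrite [leRHS](bigID P)/= lerDl sumr_ge0.
have := ler_wpM2l (expR_ge0 (- q)) (sum_exp_coeff_le K (ltW q0)).
rewrite -expRD addrC subrr expR0 mulr_sumr.
by under eq_bigr do rewrite mulrA.
Qed.

Lemma law_npts_slices (G : set (sample M)) (S : pred nat) K : measurable G ->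
  law M s (G `&` [set w | S (npts M w) /\ (npts M w < K)%N]) =
  (\sum_(n < K | S n) law M s (G `&` [set w | npts M w = n]))%E.
Proof.
move=> mG; rewrite -measure_bigsetU_ord_cond.
- congr (law M s _); rewrite -(bigcup_pred [pred n : 'I_K | S n] (fun n : 'I_K => G `&` [set w | npts M w = n])).
  apply/seteqP; split => w /=; first by move=> [Gw [Sw wK]]; exists (Ordinal wK).
  by move=> [[n nK] /= Sn [Gw wn]]; rewrite wn.
- by move=> n _; apply: measurableI => //; exact: measurable_npts.
- by move=> i j _ _ [w [[_ /= wi] [_ /= wj]]]; apply/val_inj; rewrite /= -wi -wj.
Qed.

Let law_npts_slicesT (S : pred nat) K :
  law M s [set w | S (npts M w) /\ (npts M w < K)%N] = (\sum_(n < K | S n) pmf n)%:E.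
Proof.
have := law_npts_slices S K (@measurableT _ (sample M)).
rewrite setTI => ->; rewrite -sumEFin; apply: eq_bigr => n _.
by rewrite setTI lawN.
Qed.

Lemma npts_lower_tail :
  (law M s [set w | ((npts M w)%:R <= q / 2)%R] <= (expR (- (q / 12)))%:E)%E.
Proof.
pose K := (Num.truncn (q / 2)).+1.
have -> : [set w | (npts M w)%:R <= q / 2] =
    [set w | ((npts M w)%:R <= q / 2) /\ (npts M w < K)%N].
  apply/seteqP; split => w /=; last by case.
  move=> h; split => //; rewrite -(ltr_nat R); apply: le_lt_trans h _.
  by have /andP[] := truncn_itv (ltW (divr_gt0 q0 (ltr0n R 2))).
rewrite (law_npts_slicesT (fun n => n%:R <= q / 2)) lee_fin.
(* Tilting by this factor: since [t <= 2 / 3], the exponent is at most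
   [- q + q / 4 + 2 / 3 * q = - q / 12]. *)
pose t : R := expR (- 2^-1).
have t23 : t <= 2 / 3.
  rewrite /t expRN; have : 3 / 2 <= expR (2^-1) :> R.
    by apply: le_trans (expR_ge1Dx _); lra.
  move=> h; rewrite -[leRHS]invf_div lef_pV2// posrE ?expR_gt0//.
apply: (@le_trans _ _ (\sum_(n < K) expR (- q + q / 4) * ((q * t) ^+ n / n`!%:R))).
  rewrite big_mkcond/=; apply: ler_sum => n _.
  have h0 : 0 <= expR (- q + q / 4) * ((q * t) ^+ n / n`!%:R).
    by rewrite mulr_ge0 ?expR_ge0// divr_ge0// exprn_ge0// mulr_ge0 ?expR_ge0// ltW.
  case: ifPn => //= nq.
  have -> : expR (- q + q / 4) * ((q * t) ^+ n / n`!%:R) = pmf n * (expR (q / 4) * t ^+ n).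
    by rewrite /pmf expRD exprMn; ring.
  rewrite ler_peMr// /t -expRM_natl -expRD -[leLHS]expR0 ler_expR mulrN subr_ge0.
  by rewrite (_ : q / 4 = q / 2 / 2) ?ler_pM2r ?invr_gt0//; field.
rewrite -mulr_sumr.
have qt0 : 0 <= q * t by rewrite mulr_ge0 ?expR_ge0// ltW.
apply: le_trans (ler_wpM2l (expR_ge0 _) (sum_exp_coeff_le K qt0)) _.
rewrite -expRD ler_expR; have := ler_wpM2l (ltW q0) t23; move: (q * t) => u h.
lra.
Qed.

(** Markov's inequality, in the form [(n + 1) * pmf (n + 1) = q * pmf n], for the number of points
    truncated at [K], then [K] tends to infinity. *)
Lemma npts_upper_tail m : 0 < m ->
  (law M s [set w | (m < (npts M w)%:R)%R] <= (q / m)%:E)%E.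
Proof.
move=> m0.
have mS (S : pred nat) K : measurable [set w | S (npts M w) /\ (npts M w < K)%N].
  by have := measurable_funPTI (npts M) (Y := [set n | S n /\ (n < K)%N]); apply.
have step K : (law M s [set w | (m < (npts M w)%:R)%R /\ (npts M w < K)%N] <= (q / m)%:E)%E.
  rewrite (law_npts_slicesT (fun n => m < n%:R)) lee_fin.
  pose F (n : nat) : R := if n is n'.+1 then pmf n' else 0.
  apply: (@le_trans _ _ (\sum_(n < K) q / m * F n)).
    rewrite big_mkcond/=; apply: ler_sum => -[[|n] nK] _; rewrite /F/=.
      by rewrite mulr0; case: ifPn => // h; have := lt_trans m0 h; rewrite ltxx.
    have qm0 : 0 <= q / m by rewrite divr_ge0// ltW.
    case: ifPn => [mn|_]; last by rewrite mulr_ge0.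
    have -> : pmf n.+1 = q / n.+1%:R * pmf n.
      rewrite /pmf exprS factS natrM; field.
      by rewrite nat1r !pnatr_eq0 -lt0n fact_gt0.
    rewrite ler_wpM2r// ler_wpM2l ?(ltW q0)// lef_pV2 ?posrE//; last exact: ltW.
  rewrite -mulr_sumr -[leRHS]mulr1 ler_wpM2l//; first by rewrite divr_ge0// ltW.
  case: K => [|K]; first by rewrite big_ord0.
  by rewrite big_ord_recl/= add0r; exact: (sum_pmf_le (K := K) xpredT).
have c : law M s \o (fun K => [set w | (m < (npts M w)%:R)%R /\ (npts M w < K)%N]) @ \oo -->
    law M s (\bigcup_K [set w | (m < (npts M w)%:R)%R /\ (npts M w < K)%N]).
  apply: nondecreasing_cvg_mu.
  - by move=> K; exact: (mS (fun n => m < n%:R)).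
  - by apply: bigcup_measurable => K _; exact: (mS (fun n => m < n%:R)).
  - move=> i j ij; apply/subsetPset => w [/= h wi]; split => //; exact: leq_trans ij.
have -> : [set w | m < (npts M w)%:R] =
    \bigcup_K [set w | (m < (npts M w)%:R)%R /\ (npts M w < K)%N].
  apply/seteqP; split => w /=; first by move=> h; exists (npts M w).+1.
  by move=> [K _ []].
by apply: (cvge_to_le c); apply: nearW => K; exact: step.
Qed.

End poisson_tails.

(** * Probability of missing an alternative *)

Section alternative.
Context {R : realType} {L : R} (M : poisson_experiment L).
Hypothesis L0 : 0 < L.
Variables (s : R -> R) (r : R).
Hypotheses (ints : intensity s) (bs : bounded_by r s).
Let p := mass s 0 0.
Hypothesis p0 : 0 < p.
Variable J : nat.

Definition profile (i : 'I_(2 ^ J)) : R := mass s J i / p.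

Lemma profile_ge0 i : 0 <= profile i.
Proof. by rewrite divr_ge0 ?(mass_ge0 ints)// ltW. Qed.

Lemma sum_profile : \sum_i profile i = 1.
Proof.
rewrite -mulr_suml (dyadic_sum (a := mass s)) ?divff ?gt_eqF//.
exact: massS bs.
Qed.

Lemma profile_le i : (2 ^ J)%:R * profile i <= r / p.
Proof. by rewrite mulrA ler_pM2r ?invr_gt0// natrX (mass_le ints bs). Qed.

(** Reduces to multinomial laws on the range [L * p / 2 < n <= m]: above half the mean the signal is
    strong enough, and up to [m] the null quantiles are controlled. The last two terms pay for
    leaving the range. *)
Lemma alt_prob_le (E : set (sample M)) (Q : ('I_(2 ^ J) -> nat) -> Prop) (dlt m : R) :
  measurable E -> 0 < m -> 0 <= dlt ->
  (forall w, E w -> (npts M w)%:R <= m ->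
     Q (counts M (fun i : 'I_(2 ^ J) => cell J i) w)) ->
  (forall n : nat, L * p / 2 < n%:R -> n%:R <= m ->
     mexp profile n (fun k => `[< Q k >]%:R) <= dlt) ->
  (law M s E <= (dlt + expR (- (L * p / 12)) + L * p / m)%:E)%E.
Proof.
move=> mE m0 dlt0 EQ H.
have q0 : 0 < L * p by rewrite mulr_gt0.
have nuE (i : 'I_(2 ^ J)) : \int[@lebesgue_measure R]_(x in cell J i) (L * s x) = L * p * profile i.
  by rewrite (massL ints bs)// -mulrA [p * _]mulrC divfK// gt_eqF.
have hQ n := (law_npts_mexp M L0 n ints sum_profile nuE).1.
have hN n := (law_npts_mexp M L0 n ints sum_profile nuE).2.
pose G := [set w | Q (counts M (fun i : 'I_(2 ^ J) => cell J i) w)].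
have mG : measurable G by apply: measurable_counts => i; exact: measurable_cell.
pose S (n : nat) := (L * p / 2 < n%:R) && (n%:R <= m).
pose K := (Num.truncn m).+1.
pose F := G `&` [set w | S (npts M w) /\ (npts M w < K)%N].
pose A := [set w | ((npts M w)%:R <= L * p / 2)%R].
pose B := [set w | (m < (npts M w)%:R)%R].
have mSN (P : pred nat) : measurable [set w | P (npts M w)].
  by have := measurable_funPTI (npts M) (Y := [set n | P n]); apply.
have mA : measurable A by exact: (mSN (fun n => n%:R <= L * p / 2)).
have mB : measurable B by exact: (mSN (fun n => m < n%:R)).
have mF : measurable F.
  by apply: measurableI => //; have := mSN (fun n => S n && (n < K)%N);
    congr measurable; apply/seteqP; split => w /= => [/andP[]|[-> ->]].
have EAB : E `<=` (F `|` A) `|` B.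
  move=> w Ew; have [Nm|mN] := leP ((npts M w)%:R : R) m; last by right.
  left; have [NA|AN] := leP ((npts M w)%:R : R) (L * p / 2); [by right|left].
  split; first exact: EQ.
  split; first by rewrite /S AN.
  rewrite -(ltr_nat R); apply: le_lt_trans Nm _.
  by have /andP[] := truncn_itv (ltW m0).
apply: (@le_trans _ _ (law M s (F `|` A `|` B))).
  by apply: le_measure; rewrite ?inE//; apply: measurableU => //; exact: measurableU.
apply: le_trans (measureU2 _ _ _) _ => //; first exact: measurableU.
rewrite EFinD; apply: leeD; last exact: (npts_upper_tail q0 hN m0).
apply: le_trans (measureU2 _ _ _) _ => //.
rewrite EFinD; apply: leeD; last exact: (npts_lower_tail q0 hN).
apply: (@le_trans _ _ (law M s F)) => //.
have -> : law M s F = _ := law_npts_slices s S K mG.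
apply: (@le_trans _ _ (\sum_(n < K | S n) (dlt * (expR (- (L * p)) * (L * p) ^+ n / n`!%:R))%:E)%E).
  apply: lee_sum => n /andP[n1 n2]; rewrite hQ lee_fin mulrC ler_wpM2r ?H//.
  by rewrite divr_ge0// mulr_ge0 ?expR_ge0// exprn_ge0// ltW.
rewrite sumEFin lee_fin -mulr_sumr ler_piMr//.
exact: (sum_pmf_le q0).
Qed.

End alternative.

(** * Measurability of the tests, and what their acceptance says about the counts *)

Section test_measurability.
Context {R : realType} {L : R} (M : poisson_experiment L).

Lemma measurable_cnt j k : measurable_fun setT (@cnt R L M j k).
Proof.
move=> _ Y mY; rewrite setTI.
rewrite (_ : _ @^-1` _ = \bigcup_(n in [set n : nat | Y n%:R])
    [set w | point_count (npts M) (pts M) (cell j k) w = n]).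
  apply: bigcup_measurable => n _; apply: measurable_point_count; exact: measurable_cell.
apply/seteqP; split => w /=; first by move=> Yw; eexists; [exact: Yw|].
by move=> [n /= Yn wn]; rewrite /cnt wn.
Qed.

Lemma measurable_T_stat lam : measurable_fun setT (T_stat M lam).
Proof.
case: lam => j k; rewrite (_ : T_stat M (j, k) = (fun w => (L ^+ 2)^-1 * (2 ^+ j *
  ((cnt j.+1 k.*2 w - cnt j.+1 k.*2.+1 w) ^+ 2 - (cnt j.+1 k.*2 w + cnt j.+1 k.*2.+1 w))))).
  apply: measurable_funM => //; apply: measurable_funM => //.
  have m1 := measurable_cnt j.+1 k.*2; have m2 := measurable_cnt j.+1 k.*2.+1.
  apply: measurable_funB; last exact: measurable_funD.
  by apply: measurable_funX; exact: measurable_funB.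
by apply/funext => w; rewrite T_statE.
Qed.

Lemma measurable_T'_stat J : measurable_fun setT (T'_stat M J).
Proof. by apply: measurable_sum => lam; exact: measurable_T_stat. Qed.

Lemma measurable_le_stat (S : sample M -> R) x : measurable_fun setT S ->
  measurable [set w | S w <= x].
Proof.
move=> mS; rewrite (_ : [set w | _] = S @^-1` `]-oo, x]).
  by rewrite -[X in measurable X]setTI; apply: mS => //; exact: measurable_itv.
by apply/seteqP; split => w /=; rewrite in_itv.
Qed.

(** The quantiles depend on the sample only through the number of points, so they are constants on
    each slice [N = n]. *)
Lemma measurable_reject (I : choiceType) (rr : seq I) (S : I -> sample M -> R)
    (q : nat -> I -> R) : (forall i, measurable_fun setT (S i)) ->
  measurable [set w | 0 < sup [set S i w - q (npts M w) i | i in [set` rr]]].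
Proof.
move=> mS.
rewrite (_ : [set w | _] = \bigcup_n ([set w | npts M w = n] `&`
    \big[setU/set0]_(i <- rr) (~` [set w | S i w <= q n i]))).
  apply: bigcupT_measurable => n; apply: measurableI; first exact: measurable_npts.
  by apply: bigsetU_measurable => i _; apply: measurableC; exact: measurable_le_stat.
apply/seteqP; split => w /=.
  move=> /sup_seq_gt0[i ir]; rewrite subr_gt0 => qS; exists (npts M w) => //; split => //.
  by rewrite -bigcup_seq; exists i => //=; apply/negP; rewrite -ltNge.
move=> [n _ [/= <-]]; rewrite -bigcup_seq => -[i /= ir /negP]; rewrite -ltNge => qS.
have := @le_sup_seq _ _ _ (fun i => S i w - q (npts M w) i) _ ir.
by apply: lt_le_trans; rewrite subr_gt0.
Qed.

Lemma measurable_test3_eq0 alpha : measurable [set w | test3 M alpha w = 0%N].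
Proof.
pose E1 := [set w | 0 < sup [set T'_stat M J w - null_quantile M (T'_stat M J) (npts M w)
  (test1_u M (JJ3 L) (W3 L) (alpha / 2) (npts M w) J) | J in [set` JJ3 L]]].
pose E2 := [set w | 0 < sup [set T_stat M lam w - null_quantile M (T_stat M lam) (npts M w)
  (test2_u M (Jbar3 L) (alpha / 2) (npts M w) lam) | lam in [set` Lam (Jbar3 L)]]].
have m1 : measurable E1.
  exact: (measurable_reject _ (fun n J => null_quantile M (T'_stat M J) n
    (test1_u M (JJ3 L) (W3 L) (alpha / 2) n J)) measurable_T'_stat).
have m2 : measurable E2.
  exact: (measurable_reject _ (fun n lam => null_quantile M (T_stat M lam) n
    (test2_u M (Jbar3 L) (alpha / 2) n lam)) measurable_T_stat).
rewrite (_ : [set w | _] = ~` E1 `&` ~` E2); first by apply: measurableI; exact: measurableC.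
apply/seteqP; split => w /=.
  rewrite /test3 => /eqP; rewrite -leqn0 geq_max !leqn0 !eqb0 => /andP[].
  by rewrite /test1 /test2 => /asboolPn h1 /asboolPn h2.
move=> [h1 h2]; rewrite /test3 /test1 /test2 (asboolF h1) (asboolF h2); exact: maxn0.
Qed.

End test_measurability.

Section test_misses.
Context {R : realType} {L : R} (M : poisson_experiment L).
Hypothesis L0 : 0 < L.

Lemma cnt_le j k (w : sample M) : 0 <= cnt j k w <= (npts M w)%:R.
Proof.
rewrite /cnt ler0n ler_nat /point_count -[leqRHS]card_ord -sum1_card leq_sum//.
by move=> l _; exact: leq_b1.
Qed.

Lemma T_stat_bound n lam w : npts M w = n ->
  `|T_stat M lam w| <= (L ^+ 2)^-1 * (2 ^+ lam.1 * (n%:R ^+ 2 + 2 * n%:R)).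
Proof.
case: lam => j k wn; rewrite T_statE normrM ger0_norm ?invr_ge0 ?sqr_ge0//.
rewrite ler_wpM2l ?invr_ge0 ?sqr_ge0// normrM.
have p2 := ltW (two_expr_gt0 (R := R) j).
rewrite (ger0_norm p2) ler_wpM2l//.
have := cnt_le j.+1 k.*2 w; have := cnt_le j.+1 k.*2.+1 w; rewrite wn.
move: (cnt _ _ _) (cnt _ _ _) => x y /andP[x0 xn] /andP[y0 yn].
rewrite ler_norml; apply/andP; split; nra.
Qed.

Lemma T'_stat_bound n J w : npts M w = n ->
  `|T'_stat M J w| <= \sum_(lam <- Lam J) (L ^+ 2)^-1 * (2 ^+ lam.1 * (n%:R ^+ 2 + 2 * n%:R)).
Proof.
move=> wn; apply: le_trans (ler_norm_sum _ _ _) _.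
by apply: ler_sum => lam _; exact: T_stat_bound.
Qed.

Lemma test1_miss JJ (W : nat -> R) (a y : R) J w :
  0 < a < 1 -> (forall J, 0 <= W J) -> \sum_(J <- JJ) expR (- W J) <= 1 ->
  J \in JJ -> 0 < W J ->
  mexp unif (npts M w) (fun k : 'I_(2 ^ J) -> nat => (y < ustat k)%R%:R) <= a * expR (- W J) ->
  test1 M JJ W a w = 0%N ->
  ustat (counts M (fun i : 'I_(2 ^ J) => cell J i) w) <= y.
Proof.
move=> a01 W0 W1 JJJ WJ tail /eqP; rewrite eqb0 => /asboolPn nr.
have L2 : 0 < (L ^+ 2)^-1 by rewrite invr_gt0 exprn_gt0.
rewrite -(ler_pM2l L2) -T'_statE.
pose b J : R := \sum_(lam <- Lam J) (L ^+ 2)^-1 * (2 ^+ lam.1 *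
  ((npts M w)%:R ^+ 2 + 2 * (npts M w)%:R)).
apply: (@not_reject_le _ _ M (npts M w) (null_given_ex M _ L0) nat JJ (T'_stat M)
  (fun J => expR (- W J)) b _ _ _ W1 a _ J w a01 JJJ erefl).
- by move=> i x; apply: measurable_le_stat; exact: measurable_T'_stat.
- by move=> i w' w'n; exact: T'_stat_bound.
- by move=> i; rewrite expR_gt0/= -[leRHS]expR0 ler_expR oppr_le0.
- by rewrite -[ltRHS]expR0 ltr_expR oppr_lt0.
- rewrite [X in sup X](_ : _ = [set T'_stat M J w - null_quantile M (T'_stat M J)
    (npts M w) (test1_u M JJ W a (npts M w) J) | J in [set` JJ]])//.
  by apply: eq_imagel => i _; rewrite /test1_u mulrC.
move=> s sn.
pose Q (k : 'I_(2 ^ J) -> nat) := is_true (y < ustat k).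
rewrite [X in cond_law M s X](_ : _ =
    [set w | Q (counts M (fun i : 'I_(2 ^ J) => cell J i) w)]).
  rewrite (null_cond_law L0 Q sn); apply: le_trans tail.
  by rewrite le_eqVlt; apply/orP; left; apply/eqP; apply: mexp_eq => k _; rewrite asboolb.
by apply/seteqP; split => w' /=; rewrite T'_statE ltr_pM2l.
Qed.

(** [T_stat] contains minus the diagonal term, the sum of the two counts. Under the null this
    nonpositive term is dropped to bound the tail, whereas the conclusion retains it. *)
Lemma test2_miss Jbar (a y : R) j k w (i1 i2 : 'I_(2 ^ j.+1)) :
  0 < a < 1 -> (1 < Jbar)%N -> (j < Jbar)%N -> (k < 2 ^ j)%N ->
  i1 = k.*2 :> nat -> i2 = k.*2.+1 :> nat ->
  mexp unif (npts M w) (fun c : 'I_(2 ^ j.+1) -> nat =>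
    (y < ((c i1)%:R - (c i2)%:R) ^+ 2)%R%:R) <= a / (2 ^+ j * Jbar%:R) ->
  test2 M Jbar a w = 0%N ->
  (cnt j.+1 k.*2 w - cnt j.+1 k.*2.+1 w) ^+ 2 -
    (cnt j.+1 k.*2 w + cnt j.+1 k.*2.+1 w) <= y.
Proof.
move=> a01 Jb jJ kj i1k i2k tail /eqP; rewrite eqb0 => /asboolPn nr.
have L2 : 0 < (L ^+ 2)^-1 * 2 ^+ j by rewrite mulr_gt0 ?two_expr_gt0// invr_gt0 exprn_gt0.
rewrite -(ler_pM2l L2) -mulrA -T_statE.
pose b (lam : nat * nat) : R := (L ^+ 2)^-1 * (2 ^+ lam.1 *
  ((npts M w)%:R ^+ 2 + 2 * (npts M w)%:R)).
pose v (lam : nat * nat) : R := (2 ^+ lam.1 * Jbar%:R)^-1.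
have Jb0 : 0 < Jbar%:R :> R by rewrite ltr0n (ltn_trans _ Jb).
have v0 lam : 0 < 2 ^+ lam.1 * Jbar%:R :> R by rewrite mulr_gt0// two_expr_gt0.
have e1 n : 1 <= 2 ^+ n :> R by rewrite -natrX ler1n expn_gt0.
have v1 : \sum_(lam <- Lam Jbar) v lam <= 1.
  rewrite sum_Lam /v/=.
  rewrite (eq_bigr (fun=> Jbar%:R^-1)) => [|i _].
    by rewrite sumr_const card_ord -[_ *+ Jbar]mulr_natl divff// gt_eqF.
  rewrite sumr_const card_ord -[_ *+ (2 ^ i)]mulr_natl natrX invfM mulrA divff ?mul1r//.
apply: (@not_reject_le _ _ M (npts M w) (null_given_ex M _ L0) _ (Lam Jbar) (T_stat M)
  v b _ _ _ v1 a _ (j, k) w a01 _ erefl).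
- by move=> i x; apply: measurable_le_stat; exact: measurable_T_stat.
- by move=> i w' w'n; exact: T_stat_bound.
- move=> i; rewrite invr_gt0 v0/= invf_le1//.
  by rewrite -[leLHS]mulr1 ler_pM// ?ler1n ?(ltnW Jb).
- apply/allpairsPdep; exists j, k; split; by rewrite ?mem_iota.
- by rewrite invf_lt1// (lt_le_trans (_ : 1 < Jbar%:R)) ?ltr1n// ler_peMl ?e1// ltW.
- exact: nr.
move=> s sn; apply: le_trans tail.
pose Q (c : 'I_(2 ^ j.+1) -> nat) := is_true (y < ((c i1)%:R - (c i2)%:R) ^+ 2).
apply: (@le_trans _ _ (cond_law M s [set w' |
    Q (counts M (fun i : 'I_(2 ^ j.+1) => cell j.+1 i) w')] (npts M w))).
  apply: cond_law_le => //.
  - rewrite (_ : [set w' | _] = ~` [set w' | T_stat M (j, k) w' <= (L ^+ 2)^-1 * 2 ^+ j * y]).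
      by apply: measurableC; apply: measurable_le_stat; exact: measurable_T_stat.
    by apply/seteqP; split => w' /=; rewrite ltNge => /negP.
  - by apply: measurable_counts => i; exact: measurable_cell.
  move=> w' _ /=; rewrite T_statE mulrA ltr_pM2l// /Q /counts i1k i2k => h.
  by apply: (lt_le_trans h); rewrite gerBl addr_ge0.
rewrite (null_cond_law L0 Q sn).
by rewrite le_eqVlt; apply/orP; left; apply/eqP; apply: mexp_eq => c _; rewrite asboolb.
Qed.

End test_misses.

(** * Error of the second kind of the first test *)

Section power.
Context {R : realType} {L : R} (M : poisson_experiment L).
Hypothesis L0 : 0 < L.
Variables (s : R -> R) (r : R).
Hypotheses (ints : intensity s) (bs : bounded_by r s).
Let p := mass s 0 0.
Hypothesis p0 : 0 < p.

Let pr : p <= r.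
Proof. by have := mass_le ints bs 0 0; rewrite expr0 mul1r. Qed.

Let r0 : 0 < r. Proof. exact: lt_le_trans pr. Qed.

(** Chebyshev's inequality around the mean [n * (n - 1) * sg], where [sg = th / p ^+ 2]. Since
    [n >= 2] and [n > L * p / 2], the mean is at least [n ^+ 2 * sg / 2] and [y] at most half of
    this, which leaves a deviation of [n ^+ 2 * sg / 4]. *)
Lemma ustat_power J n (y : R) :
  let th := energy s J - p ^+ 2 in
  0 < th -> 4 <= L * p -> L * p / 2 < n%:R -> y <= L ^+ 2 * th / 16 ->
  mexp (profile s (J := J)) n (fun k => (ustat k <= y)%R%:R) <=
    128 * r / (L * th) + 256 * r ^+ 2 * 2 ^+ J / (L ^+ 2 * th ^+ 2).
Proof.
move=> th th0 Lp4 nLp yth.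
have pi0 := profile_ge0 ints (J := J).
have pi1 := sum_profile ints bs p0 J.
have pik := profile_le ints bs p0 (J := J).
set pi := profile s (J := J) in pi0 pi1 pik *.
pose sg : R := (2 ^ J)%:R * \sum_i pi i ^+ 2 - 1.
have sgE : sg = th / p ^+ 2.
  rewrite /sg /pi /profile /th /energy natrX mulrBl divff ?sqrf_eq0 ?gt_eqF//.
  under eq_bigr do rewrite exprMn.
  by rewrite -mulr_suml exprVn mulrA.
have sg0 : 0 < sg by rewrite sgE divr_gt0// exprn_gt0.
have n2 : 2 <= n%:R :> R by apply: le_trans (ltW nLp); lra.
have n0 : 0 < n%:R :> R by lra.
pose mean : R := n%:R * (n%:R - 1) * sg.
have thE : th = p ^+ 2 * sg by rewrite sgE mulrCA divff ?mulr1 // sqrf_eq0 gt_eqF.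
have Lpn : (L * p) ^+ 2 <= 4 * n%:R ^+ 2.
  have : 0 <= L * p by lra.
  by move: (L * p) nLp => q qn q0; nra.
have h1 : n%:R ^+ 2 * sg / 4 <= mean - y.
  have : y <= n%:R ^+ 2 * sg / 4.
    apply: le_trans yth _; rewrite thE.
    have := ler_wpM2r (ltW sg0) Lpn; rewrite exprMn; lra.
  have : n%:R ^+ 2 * sg / 2 <= mean.
    have : 0 <= (n%:R * (n%:R - 2)) * sg by rewrite !mulr_ge0 ?(ltW sg0) ?(ltW n0)// subr_ge0.
    by rewrite /mean; lra.
  lra.
have d0 : 0 < n%:R ^+ 2 * sg / 4 by rewrite divr_gt0// mulr_gt0// exprn_gt0.
pose V : R := 4 * (r / p) * sg * n%:R ^+ 3 + 4 * (r / p) * (2 ^ J)%:R * n%:R ^+ 2.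
apply: (@le_trans _ _ ((n%:R ^+ 2 * sg / 4) ^- 2 * V)).
  apply: (@le_trans _ _ (mexp pi n (fun k => (n%:R ^+ 2 * sg / 4) ^- 2 * (ustat k - mean) ^+ 2))).
    apply: mexp_le => // k _.
    have [Uy|_] := leP (ustat k) y; last by rewrite mulr_ge0 ?sqr_ge0// invr_ge0 sqr_ge0.
    rewrite mulrC ler_pdivlMr ?exprn_gt0// mul1r -[leRHS]sqrrN opprB lerXn2r ?nnegrE ?(ltW d0)//; lra.
  rewrite mexpZ ler_wpM2l ?invr_ge0 ?sqr_ge0//.
  exact: (mexp_ustat_var pi0 pi1 pik).
have -> : (n%:R ^+ 2 * sg / 4) ^- 2 * V =
    64 * (r / p) / (n%:R * sg) + 64 * (r / p) * (2 ^ J)%:R / (n%:R ^+ 2 * sg ^+ 2).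
  by rewrite /V; field; rewrite !gt_eqF.
have q0 : 0 < L * p by rewrite mulr_gt0.
rewrite natrX; apply: lerD.
  rewrite (_ : 128 * r / (L * th) = 64 * (r / p) / (L * p / 2 * sg)); last first.
    by rewrite thE; field; rewrite !gt_eqF.
  rewrite ler_wpM2l ?mulr_ge0 ?invr_ge0 ?(ltW r0) ?(ltW p0)//.
  by rewrite lef_pV2 ?posrE ?mulr_gt0 ?invr_gt0// ler_wpM2r ?(ltW sg0)// ltW.
apply: (@le_trans _ _ (64 * (r / p) * 2 ^+ J / ((L * p) ^+ 2 / 4 * sg ^+ 2))).
  rewrite ler_wpM2l ?mulr_ge0 ?invr_ge0 ?(ltW r0) ?(ltW p0) ?(ltW (two_expr_gt0 _))//.
  rewrite lef_pV2 ?posrE ?mulr_gt0 ?invr_gt0 ?exprn_gt0// ler_wpM2r ?sqr_ge0//; lra.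
rewrite (_ : _ / _ = 256 * r * p * 2 ^+ J / (L ^+ 2 * th ^+ 2)); last first.
  by rewrite thE; field; rewrite !gt_eqF.
rewrite ler_wpM2r ?invr_ge0 ?(mulr_ge0 (sqr_ge0 _) (sqr_ge0 _))// ler_wpM2r ?(ltW (two_expr_gt0 _))//.
rewrite expr2 mulrA; apply: ler_wpM2l pr.
exact: mulr_ge0 (ler0n _ _) (ltW r0).
Qed.

Lemma test1_power alpha J (m x : R) :
  let th := energy s J - p ^+ 2 in
  0 < alpha < 1 -> 0 < m -> 0 <= x -> 16 * x <= 2 ^+ J ->
  Num.sqrt (x * 2 ^+ J) * (3 * m / 2 ^+ J + ln (2 ^+ J) + x) <= 2 * m ->
  J \in JJ3 L -> (1 < size (JJ3 L))%N -> 2 * expR (- x) <= alpha / 2 / (size (JJ3 L))%:R ->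
  12 * m * Num.sqrt (x * 2 ^+ J) <= L ^+ 2 * th / 16 -> 0 < th -> 4 <= L * p ->
  (law M s [set w | test3 M alpha w = 0%N] <=
   (128 * r / (L * th) + 256 * r ^+ 2 * 2 ^+ J / (L ^+ 2 * th ^+ 2) +
    expR (- (L * p / 12)) + L * p / m)%:E)%E.
Proof.
move=> th /andP[al0 al1] m0 x0 xJ xK JJJ N1 xN yth th0 Lp4.
set y := 12 * _ * _ in yth.
have D0 : (0 < 2 ^ J)%N by rewrite expn_gt0.
pose N : R := (size (JJ3 L))%:R.
have N0 : 0 < N by rewrite ltr0n (ltn_trans _ N1).
have WE J' : expR (- W3 L J') = N^-1 by rewrite /W3 expRN lnK// posrE.
apply: (alt_prob_le L0 ints bs p0 (J := J) (Q := fun k => is_true (ustat k <= y))).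
- exact: measurable_test3_eq0.
- exact: m0.
- apply: addr_ge0.
    exact: divr_ge0 (mulr_ge0 (ler0n _ _) (ltW r0)) (mulr_ge0 (ltW L0) (ltW th0)).
  apply: divr_ge0; last exact: mulr_ge0 (sqr_ge0 _) (sqr_ge0 _).
  by apply: mulr_ge0 (mulr_ge0 _ (sqr_ge0 _)) (ltW (two_expr_gt0 _)); exact: ler0n.
- move=> w /eqP; rewrite /test3 -leqn0 geq_max !leqn0 => /andP[/eqP t1 _] wm.
  apply: (test1_miss L0 (W := W3 L) (JJ := JJ3 L) (a := alpha / 2)) t1 => //.
  + by apply/andP; split; lra.
  + by move=> J'; rewrite ln_ge0// ler1n (ltn_trans _ N1).
  + under eq_bigr do rewrite WE.
    by rewrite big_const_seq count_predT iter_addr_0 -mulr_natl divff// gt_eqF.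
  + by rewrite ln_gt0// ltr1n.
  rewrite WE; apply: le_trans xN.
  by have := ustat_null_tail D0 m0 wm x0; rewrite natrX; apply.
move=> n n1 n2.
have := ustat_power th0 Lp4 n1 yth; apply: le_trans.
by rewrite le_eqVlt; apply/orP; left; apply/eqP; apply: mexp_eq => k _; rewrite asboolb.
Qed.

End power.

(** * Error of the second kind of the second test *)

Section power2.
Context {R : realType} {L : R} (M : poisson_experiment L).
Hypothesis L0 : 0 < L.
Variables (s : R -> R) (r : R).
Hypotheses (ints : intensity s) (bs : bounded_by r s).
Let p := mass s 0 0.
Hypothesis p0 : 0 < p.

Let r0 : 0 < r.
Proof. by apply: lt_le_trans p0 _; have := mass_le ints bs 0 0; rewrite expr0 mul1r. Qed.

Lemma lin_pair D (i1 i2 : 'I_D) (e1 e2 : R) (k : 'I_D -> nat) : i1 != i2 ->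
  lin (fun i => e1 * (i == i1)%:R + e2 * (i == i2)%:R) k = e1 * (k i1)%:R + e2 * (k i2)%:R.
Proof.
move=> i12; rewrite /lin (bigD1 i1)//= (bigD1 i2)/=; last by rewrite eq_sym.
rewrite big1 => [|i /andP[/negbTE -> /negbTE ->]]; last by rewrite !mulr0 addr0 mul0r.
by rewrite !eqxx (negbTE i12) [i2 == i1]eq_sym (negbTE i12)/=; ring.
Qed.

Lemma sum_pair D (i1 i2 : 'I_D) (e1 e2 : R) (pi : 'I_D -> R) : i1 != i2 ->
  \sum_i pi i * (e1 * (i == i1)%:R + e2 * (i == i2)%:R) = e1 * pi i1 + e2 * pi i2.
Proof.
move=> i12; rewrite (bigD1 i1)//= (bigD1 i2)/=; last by rewrite eq_sym.
rewrite big1 => [|i /andP[/negbTE -> /negbTE ->]]; last by rewrite !mulr0 addr0 mulr0.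
by rewrite !eqxx (negbTE i12) [i2 == i1]eq_sym (negbTE i12)/=; ring.
Qed.

(** Let [a] and [b] be the two counts and [e] the mean of [a - b]. Acceptance forces [e ^ 2 <= 4 *
    (a - b - e) ^ 2 + 8 * (a + b)]: either the difference is far from its mean, or the diagonal term
    is large. The expectation of the right-hand side is bounded by a variance and a mean. *)
Lemma diff_power j n (i1 i2 : 'I_(2 ^ j.+1)) (y : R) :
  let al2 := 2 ^+ j * (mass s j.+1 i1 - mass s j.+1 i2) ^+ 2 in
  i1 != i2 -> 0 < al2 -> L * p / 2 < n%:R -> 2 ^+ j.+1 * y <= L ^+ 2 * al2 / 16 ->
  mexp (profile s (J := j.+1)) n (fun k =>
    (((k i1)%:R - (k i2)%:R) ^+ 2 - ((k i1)%:R + (k i2)%:R) <= y)%R%:R) <=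
    24 * r / (L * al2).
Proof.
move=> al2 i12 al0 nLp yal.
have pi0 := profile_ge0 ints (J := j.+1).
have pi1 := sum_profile ints bs p0 j.+1.
have pik := profile_le ints bs p0 (J := j.+1).
set pi := profile s (J := j.+1) in pi0 pi1 pik *.
have q0 : 0 < L * p by rewrite mulr_gt0.
have n0 : 0 < n%:R :> R by apply: lt_trans nLp; rewrite divr_gt0.
have t0 := two_expr_gt0 (R := R) j.
pose d := pi i1 - pi i2.
have dE : 2 ^+ j * d ^+ 2 = al2 / p ^+ 2.
  by rewrite /d /pi /profile /al2 -/p; field; rewrite gt_eqF.
have d20 : 0 < d ^+ 2.
  by rewrite -(pmulr_rgt0 _ t0) dE divr_gt0// exprn_gt0.
pose w := pi i1 + pi i2.
have wle : 2 ^+ j * w <= r / p.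
  have := pik i1; have := pik i2; rewrite natrX exprS /w; lra.
have Lpn : (L * p) ^+ 2 <= 4 * n%:R ^+ 2.
  by move: (L * p) nLp q0 => q qn q0; nra.
have yd : y <= n%:R ^+ 2 * d ^+ 2 / 8.
  rewrite -(ler_pM2l (two_expr_gt0 j.+1)); apply: le_trans yal _.
  have -> : al2 = 2 ^+ j * d ^+ 2 * p ^+ 2 by rewrite dE divfK// sqrf_eq0 gt_eqF.
  have := ler_wpM2r (ltW (mulr_gt0 t0 d20)) Lpn; rewrite exprMn [2 ^+ j.+1]exprS; lra.
have e0 : 0 < n%:R ^+ 2 * d ^+ 2 by rewrite mulr_gt0// exprn_gt0.
pose c1 := fun i : 'I_(2 ^ j.+1) => 1 * (i == i1)%:R + -1 * (i == i2)%:R : R.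
pose c2 := fun i : 'I_(2 ^ j.+1) => 1 * (i == i1)%:R + 1 * (i == i2)%:R : R.
apply: (@le_trans _ _ (mexp pi n (fun k => (n%:R ^+ 2 * d ^+ 2)^-1 *
    (4 * (lin c1 k - n%:R * d) ^+ 2 + 8 * lin c2 k)))).
  apply: mexp_le => // k _; rewrite /c1 /c2 !lin_pair// !mul1r mulN1r.
  move: ((k i1)%:R : R) ((k i2)%:R : R) (ler0n R (k i1)) (ler0n R (k i2)) => a b a0 b0.
  have [h|_] := leP ((a - b) ^+ 2 - (a + b)) y; last first.
    apply: mulr_ge0; first by rewrite invr_ge0 ltW.
    apply: addr_ge0; first by apply: mulr_ge0 => //; exact: sqr_ge0.
    by apply: mulr_ge0 => //; exact: addr_ge0.
  rewrite mulrC ler_pdivlMr// mul1r -exprMn.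
  have := yd; rewrite -exprMn; move: (n%:R * d) => e ye.
  (* Once [a + b] is eliminated by means of [h], the remaining quadratic in [a - b] is minimal at
     [e / 3]. *)
  have : 0 <= (a - b - e / 3) ^+ 2 by exact: sqr_ge0.
  have : 0 <= e ^+ 2 by exact: sqr_ge0.
  nra.
rewrite mexpZ mexpD !mexpZ mexp_lin// /c2 sum_pair// !mul1r -/w.
have H1 : mexp pi n (fun k => (lin c1 k - n%:R * d) ^+ 2) <= n%:R * w.
  have := mexp_lin_var c1 n pi1 pi0.
  rewrite {2}/c1 sum_pair// mul1r mulN1r -/d; move/le_trans; apply.
  rewrite ler_wpM2l//.
  have -> : \sum_i pi i * c1 i ^+ 2 = \sum_i pi i * c2 i.
    apply: eq_bigr => i _; congr (_ * _); rewrite /c1 /c2.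
    have [->|_] := eqVneq i i1; first by rewrite (negbTE i12)/=; ring.
    by case: (i == i2) => /=; ring.
  by rewrite /c2 sum_pair// !mul1r.
apply: (@le_trans _ _ ((n%:R ^+ 2 * d ^+ 2)^-1 * (12 * (n%:R * w)))).
  by rewrite ler_wpM2l ?invr_ge0 ?(ltW e0)//; lra.
have -> : (n%:R ^+ 2 * d ^+ 2)^-1 * (12 * (n%:R * w)) =
    12 * (2 ^+ j * w) / (n%:R * (2 ^+ j * d ^+ 2)).
  by field; rewrite -sqrf_eq0 !gt_eqF.
rewrite dE; apply: (@le_trans _ _ (12 * (r / p) / (n%:R * (al2 / p ^+ 2)))).
  rewrite ler_wpM2r ?ler_wpM2l// invr_ge0 mulr_ge0// divr_ge0 ?sqr_ge0// ltW//.
have -> : 24 * r / (L * al2) = 12 * (r / p) / (L * p / 2 * (al2 / p ^+ 2)).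
  by field; rewrite !gt_eqF.
rewrite ler_wpM2l ?mulr_ge0 ?invr_ge0 ?(ltW r0) ?(ltW p0)//.
have a0 : 0 < al2 / p ^+ 2 by rewrite divr_gt0 ?exprn_gt0.
by rewrite lef_pV2 ?posrE ?(mulr_gt0 _ a0) ?divr_gt0// ler_wpM2r ?(ltW a0) ?(ltW nLp).
Qed.

Lemma test2_power alpha j k (m x : R) :
  let al2 := haar_coef s (j, k) ^+ 2 in
  0 < alpha < 1 -> 0 < m -> 0 < x -> x * 2 ^+ j.+1 <= 4 * m ->
  (1 < Jbar3 L)%N -> (j < Jbar3 L)%N -> (k < 2 ^ j)%N ->
  2 * expR (- x) <= alpha / 2 / (2 ^+ j * (Jbar3 L)%:R) ->
  16 * m * x <= L ^+ 2 * al2 / 16 -> 0 < al2 ->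
  (law M s [set w | test3 M alpha w = 0%N] <=
   (24 * r / (L * al2) + expR (- (L * p / 12)) + L * p / m)%:E)%E.
Proof.
move=> al2 /andP[al0 al1] m0 x0 xj Jb jJ kj xN yal al20.
have i1P : (k.*2 < 2 ^ j.+1)%N by rewrite expnS mul2n ltn_double.
have i2P : (k.*2.+1 < 2 ^ j.+1)%N by rewrite expnS mul2n ltn_Sdouble.
pose i1 := Ordinal i1P; pose i2 := Ordinal i2P.
have i12 : i1 != i2 by rewrite -val_eqE/= neq_ltn ltnSn.
have alE : al2 = 2 ^+ j * (mass s j.+1 i1 - mass s j.+1 i2) ^+ 2.
  by rewrite /al2 (haar_coefE ints bs)// exprMn powR_half_sqr.
pose y := 16 * m * x / 2 ^+ j.+1.
have D0 : (0 < 2 ^ j.+1)%N by rewrite expn_gt0.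
apply: (alt_prob_le L0 ints bs p0 (J := j.+1) (Q := fun c => is_true
    (((c i1)%:R - (c i2)%:R) ^+ 2 - ((c i1)%:R + (c i2)%:R) <= y))) => //.
- exact: measurable_test3_eq0.
- by apply: divr_ge0; apply: mulr_ge0 => //; apply: ltW.
- move=> w /eqP; rewrite /test3 -leqn0 geq_max !leqn0 => /andP[_ /eqP t2] wm.
  apply: (test2_miss L0 (i1 := i1) (i2 := i2) (a := alpha / 2)) t2 => //.
    by apply/andP; split; lra.
  apply: le_trans xN.
  by have := diff_null_tail D0 m0 wm x0 _ i12; rewrite natrX; apply.
move=> n n1 n2.
rewrite alE; apply: le_trans (diff_power (y := y) i12 _ n1 _); last 2 first.
- by rewrite -alE.
- by rewrite -alE /y mulrC divfK// gt_eqF// two_expr_gt0.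
by rewrite le_eqVlt; apply/orP; left; apply/eqP; apply: mexp_eq => c _; rewrite asboolb.
Qed.

End power2.

(** * Besov and weak Besov balls *)

Section smoothness.
Context {R : realType}.
Variables (s : R -> R) (r : R).
Hypotheses (ints : intensity s) (bs : bounded_by r s).
Let p := mass s 0 0.

Let block j : R := \sum_(k < 2 ^ j) haar_coef s (j : nat, k : nat) ^+ 2.

Let block_ge0 j : 0 <= block j.
Proof. by apply: sumr_ge0 => k _; exact: sqr_ge0. Qed.

Let energy_block J : energy s J - p ^+ 2 = \sum_(j < J) block j.
Proof. by rewrite (energyE ints bs) addrC addKr. Qed.

Lemma energy_le J : energy s J <= r * p.
Proof.
rewrite /energy /p -(dyadic_sum (a := mass s) (massS ints bs) J) !mulr_sumr.
apply: ler_sum => i _; rewrite expr2 mulrA ler_wpM2r ?(mass_ge0 ints)//.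
exact: (mass_le ints bs).
Qed.

Lemma dist_lt_mass rho : 0 <= rho -> (rho%:E < L2dist s constants)%E -> rho ^+ 2 < r * p.
Proof.
move=> rho0 h; apply: (dist_constants_lt ints bs rho0 h) => J.
by rewrite (le_trans _ (energy_le J))// gerBl sqr_ge0.
Qed.

Lemma dist_lt_bound rho : 0 <= rho -> (rho%:E < L2dist s constants)%E -> rho < r.
Proof.
move=> rho0 /(dist_lt_mass rho0) h.
have pr : p <= r by have := mass_le ints bs 0 0; rewrite expr0 mul1r.
have p0 : 0 <= p by exact: mass_ge0.
by nra.
Qed.

(** Beyond scale [J] the blocks of coefficients are bounded by a geometric series of ratio [q],
    uniformly in the scale [J'] at which the energy is taken. *)
Lemma besov_dist (dlt R1 rho : R) J : 0 < dlt -> besov dlt R1 s ->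
  0 <= rho -> (rho%:E < L2dist s constants)%E ->
  rho ^+ 2 < energy s J - p ^+ 2 + R1 ^+ 2 * (2 `^ (- 2 * dlt)) ^+ J / (1 - 2 `^ (- 2 * dlt)).
Proof.
move=> d0 [_ bes] rho0 h; apply: (dist_constants_lt ints bs rho0 h) => J'.
set q := 2 `^ (- 2 * dlt).
have q0 : 0 < q by exact: powR_gt0.
have q1 : q < 1.
  rewrite /q /powR gt_eqF// -[ltRHS]expR0 ltr_expR.
  by have : 0 < ln 2 :> R by [rewrite ln_gt0// ltr1n]; nra.
have blockq j : block j <= R1 ^+ 2 * q ^+ j.
  apply: le_trans (bes j) _; rewrite ler_wpM2l ?sqr_ge0//.
  rewrite -powR_mulrn ?powR_ge0// /q -powRrM le_eqVlt; apply/orP; left; apply/eqP; congr (_ `^ _).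
  by ring.
rewrite -/p !energy_block.
have q1' : 0 < 1 - q by rewrite subr_gt0.
have tail0 : 0 <= R1 ^+ 2 * q ^+ J / (1 - q).
  by rewrite divr_ge0 ?(ltW q1')// mulr_ge0 ?sqr_ge0// exprn_ge0// ltW.
have [JJ'|J'J] := leqP J J'; last first.
  apply: ler_wpDr => //.
  rewrite -(subnKC (ltnW J'J)) big_split_ord/= lerDl sumr_ge0// => j _; exact: block_ge0.
rewrite -(subnKC JJ'); set i := (J' - J)%N.
suff H : \sum_(j < J + i) block j <=
    \sum_(j < J) block j + R1 ^+ 2 * q ^+ J * (1 - q ^+ i) / (1 - q).
  apply: le_trans H _; rewrite lerD2l ler_wpM2r ?invr_ge0 ?(ltW q1')//.
  have X0 : 0 <= R1 ^+ 2 * q ^+ J by rewrite mulr_ge0 ?sqr_ge0// exprn_ge0// ltW.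
  by rewrite ler_piMr// gerBl exprn_ge0// ltW.
elim: i => [|i IH]; first by rewrite addn0 expr0 subrr mulr0 mul0r addr0.
rewrite addnS big_ord_recr/=; apply: le_trans (lerD IH (blockq (J + i)%N)) _.
rewrite -addrA lerD2l le_eqVlt; apply/orP; left; apply/eqP.
by rewrite exprD [q ^+ i.+1]exprS; field; rewrite gt_eqF.
Qed.

(** When all the squared coefficients of scale less than [J] are at most [t], the truncated sum in
    the weak Besov condition contains these blocks entirely. *)
Lemma weak_besov_energy (gam R2 t : R) J : 0 < t -> weak_besov gam R2 s ->
  (forall j k : nat, (j < J)%N -> (k < 2 ^ j)%N -> haar_coef s (j, k) ^+ 2 <= t) ->
  energy s J - p ^+ 2 <= R2 ^+ 2 * t `^ (2 * gam / (1 + 2 * gam)).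
Proof.
move=> t0 [_ wb] H; rewrite energy_block -lee_fin; apply: le_trans (wb t t0).
rewrite -sumEFin -(big_mkord xpredT (fun j => (block j)%:E)).
apply: le_trans (nneseries_lim_ge J _); last first.
  by move=> j _ _; rewrite lee_fin sumr_ge0// => k _; exact: sqr_ge0.
rewrite !big_mkord; apply: lee_sum => j _; rewrite lee_fin le_eqVlt; apply/orP; left; apply/eqP.
by rewrite /block; apply: eq_bigl => k; rewrite H.
Qed.

End smoothness.

(** * Choice of the levels *)

Section growth.
Context {R : realType}.

Lemma ln_expr_le_powR n (K b : R) : 0 < b ->
  exists2 L1 : R, 1 <= L1 & forall L, L1 <= L -> K * ln L ^+ n <= L `^ b.
Proof.
move=> b0; pose c := b / n.+1%:R.
have c0 : 0 < c by rewrite divr_gt0.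
pose k := `|K| / c ^+ n.
have k0 : 0 <= k by rewrite divr_ge0// exprn_ge0// ltW.
exists (1 + k `^ c^-1); first by rewrite lerDl powR_ge0.
move=> L L1L; have kL : k `^ c^-1 <= L by apply: le_trans L1L; rewrite lerDr.
have L1 : 1 <= L by apply: le_trans L1L; rewrite lerDl powR_ge0.
have L0 : 0 < L by lra.
have lnL : c * ln L <= L `^ c.
  rewrite /powR gt_eqF//; apply: le_trans (expR_ge1Dx _); lra.
have kc : k <= L `^ c.
  rewrite -[leLHS](powRr1 k0) -(mulVf (lt0r_neq0 c0)) powRrM.
  by rewrite ge0_ler_powR ?nnegrE ?powR_ge0 ?(ltW c0)// ltW.
have -> : L `^ b = L `^ c * (L `^ c) ^+ n.
  by rewrite -exprS -powR_mulrn ?powR_ge0// -powRrM /c divfK.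
apply: (@le_trans _ _ (k * (c * ln L) ^+ n)).
  rewrite exprMn mulrA /k divfK ?expf_neq0 ?gt_eqF//.
  by rewrite ler_wpM2r ?exprn_ge0 ?ln_ge0// ler_norm.
have u0 : 0 <= c * ln L by rewrite mulr_ge0 ?ln_ge0// ltW.
by rewrite ler_pM// ?exprn_ge0// lerXn2r// nnegrE ?powR_ge0.
Qed.

Lemma powR_exprAC (a b : R) n : 0 <= a -> (a `^ b) ^+ n = (a ^+ n) `^ b.
Proof.
by move=> a0; rewrite -powR_mulrn ?powR_ge0// -powRrM mulrC powRrM powR_mulrn.
Qed.

Lemma lnln_ge1 (L : R) : 1 <= ln (ln L) ->
  [/\ 1 < L, 1 <= ln L, ln (ln L) <= ln L & ln L <= L].
Proof.
move=> h; have y1 : 1 < ln L.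
  by rewrite ltNge; apply/negP => /ln_le0 h'; have := le_trans h h'; rewrite ler10.
have L1 : 1 < L.
  by rewrite ltNge; apply/negP => /ln_le0 h'; have := lt_le_trans y1 h'; rewrite ltr10.
have ln_le (x : R) : 1 < x -> ln x <= x.
  move=> x1; rewrite -[leRHS]lnK ?posrE ?(lt_trans ltr01)//.
  by apply: le_trans (expR_ge1Dx _); rewrite lerDr.
by split => //; [exact: ltW|exact: ln_le|exact: ln_le].
Qed.

Let ln2 : 0 < ln 2 :> R. Proof. by rewrite ln_gt0// ltr1n. Qed.

Lemma truncn_log2 (X : R) : 1 <= X ->
  2 ^+ Num.truncn (log2 X) <= X < 2 ^+ (Num.truncn (log2 X)).+1.
Proof.
move=> X1; have X0 : 0 < X by lra.
have l0 : 0 <= log2 X by rewrite divr_ge0 ?ln_ge0 ?ler1n.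
have /andP[h1 h2] := truncn_itv l0.
have E n : (2 ^+ n : R) = expR (n%:R * ln 2) by rewrite expRM_natl lnK// posrE.
rewrite !E -[X in _ <= X < _]lnK ?posrE// ler_expR ltr_expR.
by rewrite -ler_pdivlMr// -ltr_pdivrMr//; apply/andP; split.
Qed.

(** [2 ^ J] is the largest power of 2 not exceeding [X = (L / sqrt (ln ln L)) ^ e] with
    [e = 2 / (4 dlt + 1)]. This balances the detection threshold [sqrt (2 ^ J * ln ln L) / L] and
    the Besov tail [2 ^ (- 2 J dlt)], both then of the order of the squared rate [w]. *)
Lemma level_part1 (dlt cx c : R) : 0 < dlt -> 1 <= cx -> 0 < c ->
  exists2 L1 : R, 1 <= L1 & forall L, 1 <= ln (ln L) -> L1 <= L ->
  let w := ((Num.sqrt (ln (ln L)) / L) `^ (2 * dlt / (4 * dlt + 1))) ^+ 2 in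
  exists J, [/\ [/\ J \in JJ3 L, (1 < size (JJ3 L))%N & 16 * (cx * ln (ln L)) <= 2 ^+ J],
    Num.sqrt (cx * ln (ln L) * 2 ^+ J) * (ln (2 ^+ J) + cx * ln (ln L)) <= c * L,
    Num.sqrt (2 ^+ J) * Num.sqrt (ln (ln L)) <= L * w &
    (2 `^ (- 2 * dlt)) ^+ J <= 4 `^ dlt * w].
Proof.
move=> d0 cx1 c0.
pose e : R := 2 / (4 * dlt + 1).
have e0 : 0 < e by rewrite divr_gt0//; lra.
have f0 : 0 < 4 * dlt / (4 * dlt + 1) by rewrite divr_gt0//; lra.
have eE : e / 2 = 1 - 4 * dlt / (4 * dlt + 1) by rewrite /e; field; clear -d0; lra.
(* These growth bounds yield, respectively, [J] in [JJ3 L], the lower bound on [2 ^ J], and the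
   condition involving [c * L]. *)
have [A1 A11 HA] := @ln_expr_le_powR 3 1 (2 - e) (ltac:(lra)).
have [A2 A21 HB] := @ln_expr_le_powR 3 (32 * cx) e e0.
have [A3 A31 HC] := @ln_expr_le_powR 2 (cx * (2 + cx) / c) (1 - e / 2) (ltac:(lra)).
exists (A1 + A2 + A3); first by lra.
move=> L ll LA w; have [L1 y1 ly yL] := lnln_ge1 ll.
have {}HA := HA L (ltac:(lra)); have {}HB := HB L (ltac:(lra)); have {}HC := HC L (ltac:(lra)).
set y := ln L in ll y1 ly yL HA HB HC *; set l := ln y in ll ly w *.
have L0 : 0 < L by lra.
have l0 : 0 < l by lra.
have y0 : 0 < y by lra.
have sl0 : 0 < Num.sqrt l by rewrite sqrtr_gt0.
have sl1 : 1 <= Num.sqrt l by rewrite -sqrtr1 ler_wsqrtr.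
have sl2 : Num.sqrt l ^+ 2 = l by rewrite sqr_sqrtr// ltW.
have sly : Num.sqrt l <= y by nra.
pose z := L / Num.sqrt l.
have z0 : 0 < z by rewrite divr_gt0.
have zL : z <= L by rewrite ler_pdivrMr// ler_peMr// ltW.
have zl : z * Num.sqrt l = L by rewrite divfK// gt_eqF.
pose X := z `^ e.
have X0 : 0 < X by exact: powR_gt0.
have XL : X <= L `^ e by rewrite ge0_ler_powR ?nnegrE ?(ltW e0) ?(ltW z0) ?(ltW L0).
have e2 : e <= 2 by lra.
(* As [sqrt l <= y] and [e <= 2], replacing [L ^ e] by [X] loses at most a factor [y ^ 2]; this
   explains the cube in [HB]. *)
have Xbig : 32 * cx * y <= X.
  have h1 : L `^ e <= X * y ^+ 2.
    rewrite -{1}zl powRM ?(ltW z0) ?(ltW sl0)// ler_wpM2l ?powR_ge0//.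
    apply: (@le_trans _ _ (y `^ e)).
      by rewrite ge0_ler_powR ?nnegrE ?(ltW e0) ?(ltW sl0) ?(ltW y0).
    by rewrite -powR_mulrn ?(ltW y0)// ler_powR.
  have y20 : 0 < y ^+ 2 by rewrite exprn_gt0.
  rewrite -(ler_pM2r y20); apply: le_trans h1; apply: le_trans HB.
  by rewrite le_eqVlt; apply/orP; left; apply/eqP; ring.
have X32 : 32 <= X by apply: le_trans Xbig; nra.
pose J := Num.truncn (log2 X).
have /andP[J1 J2] := truncn_log2 (ltac:(lra) : 1 <= X).
rewrite -/J in J1 J2.
have XJ : X < 2 * 2 ^+ J by rewrite -exprS.
have l3 : 0 < l ^+ 3 by rewrite exprn_gt0.
have XLl : X <= L ^+ 2 / l ^+ 3.
  rewrite ler_pdivlMr//; apply: le_trans (ler_wpM2r (ltW l3) XL) _.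
  have -> : L ^+ 2 = L `^ e * L `^ (2 - e).
    rewrite -powRD; last by rewrite (gt_eqF L0) implybT.
    have -> : e + (2 - e) = 2 by ring.
    by rewrite -(powR_mulrn 2 (ltW L0)).
  rewrite ler_wpM2l ?powR_ge0//; apply: le_trans HA.
  by rewrite mul1r lerXn2r ?nnegrE// ltW.
have JN : (J <= Num.truncn (log2 (L ^+ 2 / l ^+ 3)))%N.
  apply: le_truncn; rewrite ler_wpM2r ?invr_ge0 ?(ltW ln2)//.
  by rewrite ler_ln// posrE// (lt_le_trans X0).
clearbody J.
have J2' : (2 <= J)%N.
  rewrite leqNgt; apply/negP => Jlt.
  have : 2 ^+ J <= 2 ^+ 1 :> R by rewrite ler_weXn2l ?ler1n//.
  by rewrite expr1; clear -X32 XJ; lra.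
exists J.
have D0 : 0 < 2 ^+ J :> R by exact: two_expr_gt0.
have cx0 : 0 < cx := lt_le_trans ltr01 cx1.
have cly : cx * l <= cx * y by rewrite ler_wpM2l ?(ltW cx0).
have wE : w = z `^ (- (4 * dlt / (4 * dlt + 1))).
  rewrite /w -powR_mulrn ?powR_ge0// -powRrM.
  have -> : Num.sqrt l / L = z^-1 by rewrite /z invf_div.
  rewrite -powR_inv1 ?(ltW z0)// -powRrM; congr (_ `^ _).
  by field; clear -d0; lra.
have DX : Num.sqrt (2 ^+ J) <= z `^ (e / 2).
  rewrite -[leRHS]ger0_norm ?powR_ge0// -sqrtr_sqr.
  rewrite ler_wsqrtr//; suff -> : (z `^ (e / 2)) ^+ 2 = X by [].
  by rewrite -powR_mulrn ?powR_ge0// -powRrM divfK.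
split.
- split.
  + by rewrite /JJ3 mem_iota add1n ltnS JN andbT (ltnW J2').
  + by rewrite /JJ3 size_iota (leq_trans J2' JN).
  + by clear -cly Xbig XJ cx0 y0; lra.
- have cl0 : 0 < cx * l by exact: mulr_gt0.
  have cl1 : 1 <= cx * l by rewrite -[leLHS]mulr1 ler_pM.
  have sD : Num.sqrt (cx * l * 2 ^+ J) <= cx * y * L `^ (e / 2).
    rewrite sqrtrM ?(ltW cl0)//.
    apply: ler_pM; rewrite ?sqrtr_ge0//.
      apply: le_trans cly; rewrite -[leRHS](ger0_norm (ltW cl0)).
      by rewrite -sqrtr_sqr ler_wsqrtr// expr2 ler_peMr ?(ltW cl0).
    apply: le_trans DX _.
    have e20 : 0 <= e / 2 by clear -e0; lra.
    by rewrite ge0_ler_powR ?nnegrE ?(ltW z0) ?(ltW L0).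
  have lD : ln (2 ^+ J) + cx * l <= (2 + cx) * y.
    rewrite mulrDl lerD//.
    apply: (@le_trans _ _ (ln (L `^ e))).
      by rewrite ler_ln ?posrE ?powR_gt0// (le_trans J1).
    by rewrite ln_powR ler_wpM2r// ltW.
  have lD0 : 0 <= ln (2 ^+ J) + cx * l.
    by apply: addr_ge0 (ltW cl0); rewrite ln_ge0// -natrX ler1n expn_gt0.
  apply: le_trans (ler_pM (sqrtr_ge0 _) lD0 sD lD) _.
  have Le0 : 0 < L `^ (e / 2) by exact: powR_gt0.
  have LE : L `^ (e / 2) * L `^ (1 - e / 2) = L.
    rewrite -powRD; last by rewrite (gt_eqF L0) implybT.
    have -> : e / 2 + (1 - e / 2) = 1 by ring.
    by rewrite (powRr1 (ltW L0)).
  have := ler_wpM2l (ltW (mulr_gt0 c0 Le0)) HC.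
  have -> : c * L `^ (e / 2) * (cx * (2 + cx) / c * y ^+ 2) =
     cx * y * L `^ (e / 2) * ((2 + cx) * y) by field; rewrite gt_eqF.
  by rewrite -[c * _ * _]mulrA LE.
- apply: (@le_trans _ _ (z `^ (e / 2) * Num.sqrt l)).
    by rewrite ler_wpM2r// sqrtr_ge0.
  rewrite wE; set v := z `^ (- _).
  have -> : L * v = z * v * Num.sqrt l by rewrite -{1}zl; ring.
  rewrite ler_wpM2r ?(ltW sl0)// /v.
  rewrite eE powRD; last by rewrite (gt_eqF z0) implybT.
  by rewrite (powRr1 (ltW z0)).
- rewrite wE.
  have -> : (2 `^ (- 2 * dlt)) ^+ J = (2 ^+ J) `^ (- 2 * dlt).
    exact: powR_exprAC.
  have X2 : X / 2 <= 2 ^+ J by rewrite ler_pdivrMr// mulrC ltW.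
  apply: (@le_trans _ _ ((X / 2) `^ (- 2 * dlt))).
    have dd : - 2 * dlt = - (2 * dlt) by ring.
    rewrite dd !powRN lef_pV2 ?posrE ?powR_gt0 ?divr_gt0//.
    by rewrite ge0_ler_powR ?nnegrE ?(ltW D0) ?divr_ge0 ?(ltW X0) ?mulr_ge0 ?(ltW d0)//.
  rewrite powRM ?(ltW X0) ?invr_ge0// mulrC le_eqVlt; apply/orP; left; apply/eqP; congr (_ * _).
    rewrite -powR_inv1// -powRrM.
    have -> : (4 : R) = 2 `^ 2 by rewrite powR_mulrn//; ring.
    by rewrite -powRrM; congr (_ `^ _); ring.
  by rewrite /X -powRrM; congr (_ `^ _); rewrite /e; field; clear -d0; lra.
Qed.

End growth.

(** * Constants and the power of the first test for (i) *)

Lemma lt_bound_dist {R : realType} (s : R -> R) (r rho : R) : intensity s -> bounded_by r s ->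
  r <= rho -> 0 <= rho -> ~ (rho%:E < L2dist s constants)%E.
Proof.
by move=> ints bs rrho rho0 /(dist_lt_bound ints bs rho0); rewrite ltNge rrho.
Qed.

Lemma separation_rate_le {R : realType} {L : R} (M : poisson_experiment L)
    (Phi : sample M -> nat) (S1 : set (R -> R)) (beta rho : R) : 0 < rho ->
  (forall s, S1 s -> (rho%:E < L2dist s constants)%E ->
     (law M s [set w | Phi w = 0%N] <= beta%:E)%E) ->
  (separation_rate M Phi S1 beta <= rho%:E)%E.
Proof.
move=> rho0 H; apply: ereal_inf_lbound; exists rho => //; split => //.
by apply: ge_ereal_sup => _ [s [S1s rs] <-]; exact: H.
Qed.

Lemma expR_le_div {R : realType} (beta q : R) : 0 < beta ->
  12 * ln (4 / beta) <= q -> expR (- (q / 12)) <= beta / 4.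
Proof.
move=> b0 h; have b4 : 0 < beta / 4 by rewrite divr_gt0.
rewrite -[leRHS]lnK ?posrE// ler_expR.
by rewrite -[beta / 4]invf_div lnV ?posrE ?divr_gt0//; lra.
Qed.

(** [16 * X <= D] gives [sqrt (X * D) <= D / 4], so the term [3 * m / D] costs only [3 / 4 * m]. *)
Lemma quantile_condition {R : realType} (D X m : R) : 0 < D -> 0 < m ->
  0 < X -> 16 * X <= D -> Num.sqrt (X * D) * (ln D + X) <= m ->
  Num.sqrt (X * D) * (3 * m / D + ln D + X) <= 2 * m.
Proof.
move=> D0 m0 X0 XD h.
have sXD : Num.sqrt (X * D) <= D / 4.
  rewrite -[leRHS]ger0_norm; last lra.
  rewrite -sqrtr_sqr ler_wsqrtr//.
  by have := ler_wpM2r (ltW D0) XD; lra.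
have k0 : 0 <= 3 * m / D by rewrite divr_ge0 ?(ltW D0)//; lra.
have := ler_wpM2r k0 sXD.
have -> : D / 4 * (3 * m / D) = 3 / 4 * m by field; rewrite gt_eqF.
by rewrite -addrA mulrDr; lra.
Qed.

Lemma size_JJ3_le {R : realType} (L : R) : 1 <= ln (ln L) -> (0 < size (JJ3 L))%N ->
  (size (JJ3 L))%:R <= 2 * ln L / ln 2.
Proof.
move=> ll; have [L1 y1 ly _] := lnln_ge1 ll.
have L0 : 0 < L by lra.
have l0 : 0 < ln (ln L) by lra.
have ln2 : 0 < ln 2 :> R by rewrite ln_gt0// ltr1n.
rewrite /JJ3 size_iota; set x := log2 _ => tr.
have x0 : 0 <= x by move: tr; rewrite truncn_gt0; exact: le_trans.
have /andP[+ _] := truncn_itv x0; move/le_trans; apply.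
rewrite /x /log2 ler_wpM2r ?invr_ge0 ?(ltW ln2)//.
rewrite mulr_natl -lnXn// ler_ln ?posrE ?divr_gt0 ?exprn_gt0//.
by rewrite ler_pdivrMr ?exprn_gt0// ler_peMr ?sqr_ge0// exprn_ege1.
Qed.

(** The value of [cx] makes [expR (- (cx * ln y))] at most [alpha / (b * y)]. It is meant for
    [y = ln L], with [N] the number of levels of the first test, of order [ln L]. *)
Lemma level_condition {R : realType} (alpha cx y N b : R) : 0 < alpha -> 0 < b ->
  1 <= cx -> cx = 1 + ln (b / alpha) -> 1 <= ln y -> 0 < y -> 0 < N -> N <= b / 4 * y ->
  2 * expR (- (cx * ln y)) <= alpha / 2 / N.
Proof.
move=> al0 b0 cx1 cxE l1 y0 N0 Ny.
have ba : 0 < b / alpha by exact: divr_gt0.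
have cxl : ln y + ln (b / alpha) <= cx * ln y.
  rewrite cxE mulrDl mul1r lerD2l ler_peMr//; lra.
have ex : expR (- (cx * ln y)) <= alpha / (b * y).
  apply: (@le_trans _ _ (expR (- (ln y + ln (b / alpha))))); first by rewrite ler_expR lerN2.
  rewrite opprD expRD !expRN lnK ?posrE// lnK ?posrE// invf_div.
  by rewrite le_eqVlt; apply/orP; left; apply/eqP; field; rewrite !gt_eqF.
rewrite ler_pdivlMr//.
have by0 : 0 < alpha / (b * y) by rewrite divr_gt0// mulr_gt0.
have h : alpha / (b * y) * N <= alpha / 4.
  apply: le_trans (ler_wpM2l (ltW by0) Ny) _.
  by rewrite le_eqVlt; apply/orP; left; apply/eqP; field; rewrite !gt_eqF.
by have := ler_wpM2r (ltW N0) ex; lra.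
Qed.

Lemma sqrt_mul_le {R : realType} (cx l D : R) : 1 <= cx -> 0 < l -> 0 < D ->
  Num.sqrt (cx * l * D) <= cx * (Num.sqrt D * Num.sqrt l).
Proof.
move=> cx1 l0 D0; rewrite sqrtrM; last by apply: mulr_ge0; lra.
rewrite sqrtrM; last lra.
rewrite [Num.sqrt D * _]mulrC mulrA ler_wpM2r ?sqrtr_ge0// ler_wpM2r ?sqrtr_ge0//.
rewrite -[leRHS]ger0_norm; last lra.
by rewrite -sqrtr_sqr ler_wsqrtr//; nra.
Qed.

(** Each of the four terms is at most [beta / 4]. Taking [m = c * L] with [c = 4 * r / beta] settles
    the upper Poisson tail, as [p <= r]; the lower bounds on [C] settle the other three. *)
Lemma error_sum_le {R : realType} (L D w th p C c r beta : R) :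
  0 < L -> 0 < D -> 0 < w -> 0 < th -> 0 < r -> 0 < beta -> 0 < c ->
  c * beta = 4 * r -> p <= r -> C <= r * (L * p) ->
  1 <= L * w -> Num.sqrt D <= L * w -> C * w / 2 <= th ->
  1 <= C -> 32 * 32 * r / beta <= C -> 64 * 64 * r ^+ 2 / beta <= C ->
  12 * r * ln (4 / beta) <= C ->
  128 * r / (L * th) + 256 * r ^+ 2 * D / (L ^+ 2 * th ^+ 2) +
    expR (- (L * p / 12)) + L * p / (c * L) <= beta.
Proof.
move=> L0 D0 w0 th0 r0 b0 c0 cE pr CLp Lw1 sDw thw C1 C4 C5 C7.
have LT x : x <= L * w -> 0 <= x -> C * x / 2 <= L * th.
  move=> xw x0; apply: (@le_trans _ _ (L * (C * w / 2))); last by rewrite ler_wpM2l// ltW.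
  have -> : L * (C * w / 2) = C * (L * w) / 2 by ring.
  by rewrite ler_wpM2r// ler_wpM2l//; apply: le_trans C1.
have k1 : 128 * r / (L * th) <= beta / 4.
  have h1 := LT 1 Lw1 ler01.
  rewrite ler_pdivrMr ?mulr_gt0//.
  have h2 : 32 * 32 * r <= C * beta by rewrite -ler_pdivrMr.
  have := ler_wpM2r (ltW b0) h1; clear -h2; lra.
have k2 : 256 * r ^+ 2 * D / (L ^+ 2 * th ^+ 2) <= beta / 4.
  have h1 := LT _ sDw (sqrtr_ge0 D).
  rewrite ler_pdivrMr ?mulr_gt0 ?exprn_gt0// -exprMn.
  have h2 : 64 * 64 * r ^+ 2 <= C * beta by rewrite -ler_pdivrMr.
  have h3 : C ^+ 2 * D / 4 <= (L * th) ^+ 2.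
    have -> : C ^+ 2 * D / 4 = (C * Num.sqrt D / 2) ^+ 2.
      by rewrite -{1}(sqr_sqrtr (ltW D0)); field.
    have h4 : 0 <= C * Num.sqrt D / 2.
      by rewrite divr_ge0// mulr_ge0 ?sqrtr_ge0//; apply: le_trans C1.
    by rewrite lerXn2r// nnegrE; apply: le_trans h1.
  have h4 := ler_wpM2r (ltW D0) h2.
  have h5 : C * beta * D <= C ^+ 2 * D * beta.
    rewrite [leRHS]mulrAC ler_wpM2r ?(ltW D0)// ler_wpM2r ?(ltW b0)//.
    by rewrite expr2 ler_peMr//; apply: le_trans C1.
  have h6 := ler_wpM2r (ltW b0) h3.
  by clear -h4 h5 h6; lra.
have k3 : expR (- (L * p / 12)) <= beta / 4.
  by apply: expR_le_div => //; rewrite -(ler_pM2l r0); clear -CLp C7; lra.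
have k4 : L * p / (c * L) <= beta / 4.
  rewrite ler_pdivrMr ?mulr_gt0//.
  have -> : beta / 4 * (c * L) = r * L.
    have -> : beta / 4 * (c * L) = c * beta / 4 * L by field.
    by rewrite cE; field.
  by rewrite mulrC ler_wpM2r// ltW.
by clear -k1 k2 k3 k4; lra.
Qed.

(** For large [L], separation gives a squared distance above [C * w]; half of it covers the Besov
    tail, so the Haar energy of scales below [J] is at least [C * w / 2], enough for the first
    test. *)
Lemma part1_power_core {R : realType} (dlt alpha beta R1 r C c cx q : R) :
  0 < dlt -> 0 < alpha < 1 -> 0 < beta < 1 -> 0 < r ->
  0 < c -> c * beta = 4 * r ->
  1 <= cx -> cx = 1 + ln (8 / (alpha * ln 2)) ->
  0 < 1 - q -> 2 `^ (- 2 * dlt) = q ->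
  1 <= C -> 2 * (R1 ^+ 2 * 4 `^ dlt / (1 - q)) <= C ->
  24 * 16 * c * cx <= C -> 32 * 32 * r / beta <= C ->
  64 * 64 * r ^+ 2 / beta <= C -> 4 * r <= C ->
  12 * r * ln (4 / beta) <= C ->
  exists2 C' : R, 0 < C' & forall L, 1 <= ln (ln L) ->
  forall (M : poisson_experiment L) s, besov dlt R1 s -> bounded_by r s ->
  ((C' * (Num.sqrt (ln (ln L)) / L) `^ (2 * dlt / (4 * dlt + 1)))%:E < L2dist s constants)%E ->
  (law M s [set w | test3 M alpha w = 0%N] <= beta%:E)%E.
Proof.
move=> d0 al01 be01 r0 c0 cE cx1 cxE q1 qE C1 C2 C3 C4 C5 C6 C7.
have ln2 : 0 < ln 2 :> R by rewrite ln_gt0// ltr1n.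
have [al0 al1] := andP al01; have [b0 b1] := andP be01.
have [L1 L11 HL] := level_part1 d0 cx1 c0.
have g0 : 0 <= 2 * dlt / (4 * dlt + 1) by rewrite divr_ge0//; clear -d0; lra.
have L10 : 0 < L1 := lt_le_trans ltr01 L11.
have C0 : 0 < C := lt_le_trans ltr01 C1.
have cx0 : 0 < cx := lt_le_trans ltr01 cx1.
(* The second summand serves for [L < L1]: the rate is then at least [L1 ^ (- g)], with [g] its
   exponent, so the separation is at least [r] and no alternative is that far from the constants. *)
exists (C + r * L1 `^ (2 * dlt / (4 * dlt + 1))).
  by rewrite ltr_wpDr ?mulr_ge0 ?powR_ge0 ?(ltW r0).
move=> L ll M s bes bs; have ints := bes.1.
have [Lg1 y1 ly yL] := lnln_ge1 ll.
set l := ln (ln L) in ll ly *.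
set g := 2 * dlt / _ in g0 *; set C' := C + _; set rho0 := _ `^ g.
have L0 : 0 < L := lt_trans ltr01 Lg1.
have l0 : 0 < l := lt_le_trans ltr01 ll.
have sl1 : 1 <= Num.sqrt l by rewrite -sqrtr1 ler_wsqrtr.
have sl0 : 0 < Num.sqrt l := lt_le_trans ltr01 sl1.
have u0 : 0 < Num.sqrt l / L by rewrite divr_gt0.
have rho00 : 0 < rho0 by exact: powR_gt0.
have C'C : C <= C' by rewrite lerDl mulr_ge0 ?powR_ge0 ?(ltW r0).
have C'1 : 1 <= C' := le_trans C1 C'C.
have rhoge : 0 <= C' * rho0 by rewrite mulr_ge0 ?(ltW rho00)// (le_trans ler01).
have [LL1|LL1] := leP L1 L; last first.
  move=> h; exfalso; apply: (lt_bound_dist ints bs _ rhoge h).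
  have h1 : L1^-1 `^ g <= rho0.
    rewrite ge0_ler_powR ?nnegrE ?(ltW u0) ?invr_ge0 ?(ltW L10)//.
    rewrite ler_pdivlMr// mulrC ler_pdivrMr//.
    by apply: le_trans (ltW LL1) _; rewrite ler_peMl ?(ltW L10).
  have L1g : 0 < L1 `^ g by rewrite powR_gt0.
  apply: (@le_trans _ _ ((r * L1 `^ g) * rho0)).
    rewrite -mulrA ler_peMr ?(ltW r0)//; apply: le_trans (ler_wpM2l (ltW L1g) h1).
    rewrite -powR_inv1 ?(ltW L10)//.
    by rewrite -powRrM mulN1r powRN divff// gt_eqF.
  by rewrite ler_wpM2r ?(ltW rho00)// lerDr ltW.
move=> h.
have [J [[J1 J2 J3] J4 J5 J6]] := HL L ll LL1.
rewrite qE -/l in J6; rewrite -/l in J3 J4 J5; set w := _ ^+ 2 in J5 J6.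
have w0 : 0 < w by rewrite exprn_gt0.
pose D : R := 2 ^+ J.
have D0 : 0 < D by exact: two_expr_gt0.
have D1 : 1 <= D by rewrite /D -natrX ler1n expn_gt0.
have sD1 : 1 <= Num.sqrt D by rewrite -sqrtr1 ler_wsqrtr.
have sD2 : Num.sqrt D ^+ 2 = D by rewrite sqr_sqrtr// ltW.
have sDw : Num.sqrt D <= L * w by apply: le_trans J5; rewrite ler_peMr// sqrtr_ge0.
have Lw1 : 1 <= L * w := le_trans sD1 sDw.
have rhoC : C * w <= (C' * rho0) ^+ 2.
  rewrite exprMn -/w ler_wpM2r ?(ltW w0)//; apply: le_trans C'C _.
  by rewrite expr2 ler_peMr// (le_trans ler01).
pose p := mass s 0 0; pose th := energy s J - p ^+ 2.
have thw : C * w / 2 <= th.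
  have := besov_dist ints bs J d0 bes rhoge h; rewrite qE -/p -/th => h2.
  have h3 : R1 ^+ 2 * q ^+ J / (1 - q) <= R1 ^+ 2 * 4 `^ dlt / (1 - q) * w.
    rewrite [leRHS]mulrAC -[R1 ^+ 2 * _ * w]mulrA ler_wpM2r ?invr_ge0 ?(ltW q1)//.
    by rewrite ler_wpM2l ?sqr_ge0.
  have h4 := ler_wpM2r (ltW w0) C2.
  by clear -h2 h3 h4 rhoC; lra.
have Cw0 : 0 < C * w by exact: mulr_gt0.
have th0 : 0 < th by clear -Cw0 thw; lra.
have rp : C * w <= r * p by apply: le_trans rhoC _; exact: (ltW (dist_lt_mass ints bs rhoge h)).
have p0 : 0 < p by rewrite -(pmulr_rgt0 _ r0) (lt_le_trans Cw0).
have pr : p <= r by have := mass_le ints bs 0 0; rewrite expr0 mul1r.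
have CLp : C <= r * (L * p).
  rewrite mulrCA; apply: (@le_trans _ _ (L * (C * w))); last by rewrite ler_wpM2l// ltW.
  by rewrite mulrCA ler_peMr ?(ltW C0).
have cl0 : 0 < cx * l by exact: mulr_gt0.
pose N : R := (size (JJ3 L))%:R.
have N0 : 0 < N by rewrite ltr0n (ltn_trans _ J2).
have m0 : 0 < c * L by rewrite mulr_gt0.
have scx := sqrt_mul_le cx1 l0 D0.
apply: (@le_trans _ _ (128 * r / (L * th) + 256 * r ^+ 2 * D / (L ^+ 2 * th ^+ 2) +
    expR (- (L * p / 12)) + L * p / (c * L))%:E).
  apply: (@test1_power _ _ M L0 s r ints bs p0 alpha J (c * L) (cx * l)) => //.
  - exact: ltW.
  - exact: quantile_condition.
  - apply: (level_condition (b := 8 / ln 2)) => //; first exact: divr_gt0.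
        by rewrite cxE; congr (1 + ln _); field; rewrite !gt_eqF.
      exact: lt_le_trans y1.
    have -> : 8 / ln 2 / 4 * ln L = 2 * ln L / ln 2 by field; rewrite gt_eqF.
    by apply: size_JJ3_le => //; exact: ltnW.
  - apply: (@le_trans _ _ (12 * (c * L) * (cx * (L * w)))).
      apply: ler_wpM2l; first exact: mulr_ge0 (ler0n _ _) (ltW m0).
      by apply: le_trans scx _; rewrite ler_wpM2l ?(ltW cx0).
    rewrite -/p -/th.
    have h1 := ler_wpM2r (ltW w0) C3.
    have h2 : 24 * 16 * c * cx * w / 2 <= th by clear -h1 thw; lra.
    by have := ler_wpM2l (sqr_ge0 L) h2; clear; lra.
  - by rewrite -/p -(ler_pM2l r0); clear -C6 CLp; lra.
rewrite lee_fin -/p; exact: (error_sum_le (w := w) (C := C)).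
Qed.

Lemma ln2_lt1 {R : realType} : ln 2 < 1 :> R.
Proof.
rewrite -ltr_expR lnK ?posrE//.
have : 1 + 2^-1 <= expR (2^-1) :> R by exact: expR_ge1Dx.
have -> : expR 1 = expR (2^-1) ^+ 2 :> R by rewrite -expRM_natl divff.
by have := expR_gt0 (2^-1 : R); move: (expR _) => u; nra.
Qed.

Lemma level_const_ge1 {R : realType} (alpha b : R) : 0 < alpha < 1 -> 1 <= b ->
  1 <= 1 + ln (b / (alpha * ln 2)).
Proof.
move=> /andP[al0 al1] b1; have ln2 : 0 < ln 2 :> R by rewrite ln_gt0// ltr1n.
rewrite lerDl ln_ge0// ler_pdivlMr ?mulr_gt0// mul1r; apply: le_trans b1.
by rewrite -[leRHS]mulr1; apply: ler_pM; rewrite ?(ltW al0) ?(ltW ln2) ?(ltW al1) ?(ltW ln2_lt1).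
Qed.

Lemma besov_ratio_lt1 {R : realType} (dlt : R) : 0 < dlt -> 0 < 1 - 2 `^ (- 2 * dlt).
Proof.
move=> d0; rewrite subr_gt0 /powR gt_eqF// -[ltRHS]expR0 ltr_expR !mulNr oppr_lt0.
by rewrite !mulr_gt0// ln_gt0// ltr1n.
Qed.

Lemma ln_4div_ge0 {R : realType} (beta : R) : 0 < beta < 1 -> 0 <= ln (4 / beta).
Proof.
move=> /andP[b0 b1]; rewrite ln_ge0// ler_pdivlMr// mul1r.
by apply: le_trans (ltW b1) _; rewrite ler1n.
Qed.

Lemma part1_power {R : realType} (dlt alpha beta R1 r : R) :
  0 < dlt -> 0 < alpha < 1 -> 0 < beta < 1 -> 0 < r ->
  exists2 C : R, 0 < C & forall L, 1 <= ln (ln L) ->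
  forall (M : poisson_experiment L) s, besov dlt R1 s -> bounded_by r s ->
  ((C * (Num.sqrt (ln (ln L)) / L) `^ (2 * dlt / (4 * dlt + 1)))%:E < L2dist s constants)%E ->
  (law M s [set w | test3 M alpha w = 0%N] <= beta%:E)%E.
Proof.
move=> d0 al01 be01 r0; have [b0 _] := andP be01.
have c0 : 0 < 4 * r / beta by rewrite divr_gt0// mulr_gt0.
have cx1 : 1 <= 1 + ln (8 / (alpha * ln 2)) by apply: level_const_ge1; rewrite ?ler1n.
have q1 := besov_ratio_lt1 d0.
move: (4 * r / beta) (divfK (lt0r_neq0 b0) (4 * r)) c0 => c cE c0.
have [cx cxE] : {cx | cx = 1 + ln (8 / (alpha * ln 2))} by eexists.
rewrite -cxE in cx1.
have [q qE] : {q | 2 `^ (- 2 * dlt) = q} by eexists.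
rewrite qE in q1.
pose a1 := 2 * (R1 ^+ 2 * 4 `^ dlt / (1 - q)); pose a2 := 24 * 16 * c * cx.
pose a3 := 32 * 32 * r / beta; pose a4 := 64 * 64 * r ^+ 2 / beta.
pose a5 := 4 * r; pose a6 := 12 * r * ln (4 / beta).
have h1 : 0 <= a1.
  by rewrite mulr_ge0// divr_ge0 ?(ltW q1)// mulr_ge0 ?sqr_ge0 ?powR_ge0.
have h2 : 0 <= a2 by rewrite !mulr_ge0 ?(ltW c0) ?(le_trans ler01 cx1).
have h3 : 0 <= a3 by rewrite divr_ge0 ?(ltW b0)// mulr_ge0 ?(ltW r0).
have h4 : 0 <= a4 by rewrite divr_ge0 ?(ltW b0)// mulr_ge0 ?sqr_ge0.
have h5 : 0 <= a5 by rewrite mulr_ge0 ?(ltW r0).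
have h6 : 0 <= a6 by rewrite !mulr_ge0 ?(ltW r0) ?ln_4div_ge0.
apply: (@part1_power_core _ dlt alpha beta R1 r (1 + a1 + a2 + a3 + a4 + a5 + a6) c cx q) => //;
  rewrite -?/a1 -?/a2 -?/a3 -?/a4 -?/a5 -?/a6;
  by clearbody a1 a2 a3 a4 a5 a6; clear -h1 h2 h3 h4 h5 h6; lra.
Qed.

Lemma Jbar3_bounds {R : realType} (L : R) : 1 <= ln (ln L) -> 4 * ln L <= L ->
  [/\ (1 < Jbar3 L)%N, 2 ^+ Jbar3 L * ln L <= L, L < 2 * (2 ^+ Jbar3 L * ln L) &
      (Jbar3 L)%:R * ln 2 <= ln L].
Proof.
move=> ll yL4; have [L1 y1 _ _] := lnln_ge1 ll.
rewrite /Jbar3; set y := ln L in ll yL4 y1 *.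
have y0 : 0 < y by lra.
have X4 : 4 <= L / y by rewrite ler_pdivlMr.
have /andP[J1 J2] := truncn_log2 (ltac:(lra) : 1 <= L / y).
move: (Num.truncn _) J1 J2 => J; rewrite ler_pdivlMr// ltr_pdivrMr// => J1 J2.
split => //; last 2 first.
- by rewrite mulrA -exprS.
- rewrite mulr_natl -lnXn// /y ler_ln ?posrE ?exprn_gt0//; last lra.
  by apply: le_trans J1; rewrite ler_peMr ?exprn_ge0.
rewrite ltnNge; apply/negP => Jle.
have : 2 ^+ J.+1 <= 2 ^+ 2 :> R by rewrite ler_weXn2l ?ler1n//.
have : 4 * y < 2 ^+ J.+1 * y.
  by apply: le_lt_trans yL4 _; move: J2; rewrite exprS; lra.
rewrite ltr_pM2r//; have -> : 2 ^+ 2 = 4 :> R by ring.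
by move=> h1 h2; have := lt_le_trans h1 h2; rewrite ltxx.
Qed.

(** Since [2 ^ J > L / (2 y)], the tail is at most [(2 y / L) ^ (2 dlt)]. As [y / L <= 1] and
    [g <= dlt], the exponent of [y / L] can be lowered to [2 g]. *)
Lemma besov_tail_le {R : realType} (L y g dlt : R) J : 0 < y -> y <= L ->
  L < 2 * (2 ^+ J * y) -> 0 < dlt -> g <= dlt ->
  (2 `^ (- 2 * dlt)) ^+ J <= 4 `^ dlt * ((y / L) `^ g) ^+ 2.
Proof.
move=> y0 yL LJ d0 gd.
have L0 : 0 < L := lt_le_trans y0 yL.
have D0 : 0 < 2 ^+ J :> R by exact: two_expr_gt0.
have u01 : 0 < y / L <= 1 by rewrite divr_gt0//= ler_pdivrMr// mul1r.
have u0 : 0 < y / L by case/andP: u01.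
rewrite -!(powR_mulrn _ (powR_ge0 _ _)) -!powRrM.
have -> : 2 `^ (- 2 * dlt * J%:R) = (2 ^+ J)^-1 `^ (2 * dlt) :> R.
  rewrite -powR_inv1 ?(ltW D0)// -powR_mulrn// -!powRrM; congr (_ `^ _); ring.
apply: (@le_trans _ _ ((2 * (y / L)) `^ (2 * dlt))).
  rewrite ge0_ler_powR ?nnegrE ?invr_ge0 ?(ltW D0) ?mulr_ge0 ?invr_ge0 ?(ltW y0) ?(ltW L0) ?(ltW d0)//.
  rewrite -div1r ler_pdivrMr//.
  have -> : 2 * (y / L) * 2 ^+ J = 2 * (2 ^+ J * y) / L by ring.
  by rewrite ler_pdivlMr// mul1r ltW.
rewrite powRM ?(ltW u0)//.
have -> : 2 `^ (2 * dlt) = 4 `^ dlt :> R.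
  by rewrite powRrM powR_mulrn//; congr (_ `^ _); ring.
rewrite ler_wpM2l ?powR_ge0//; apply: ger_powR => //.
by rewrite mulrC ler_wpM2l.
Qed.

Lemma error2_sum_le {R : realType} (L al2 p C C2 y c r beta : R) :
  0 < L -> 0 < al2 -> 0 < r -> 0 < beta -> 0 < c ->
  4 * r <= c * beta -> p <= r -> C <= r * (L * p) -> 1 <= y ->
  C2 * y < L * al2 -> 0 <= C2 -> 96 * r / beta <= C2 -> 12 * r * ln (4 / beta) <= C ->
  24 * r / (L * al2) + expR (- (L * p / 12)) + L * p / (c * L) <= beta.
Proof.
move=> L0 a0 r0 b0 c0 cE pr CLp y1 alC C20 C3 C7.
have k1 : 24 * r / (L * al2) <= beta / 4.
  have h1 : C2 <= C2 * y by rewrite ler_peMr.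
  rewrite ler_pdivrMr ?mulr_gt0//.
  have h2 : 96 * r <= C2 * beta by rewrite -ler_pdivrMr.
  have := ler_wpM2r (ltW b0) (le_trans h1 (ltW alC)); clear -h2; lra.
have k3 : expR (- (L * p / 12)) <= beta / 4.
  by apply: expR_le_div => //; rewrite -(ler_pM2l r0); clear -CLp C7; lra.
have k4 : L * p / (c * L) <= beta / 4.
  rewrite ler_pdivrMr ?mulr_gt0//.
  have -> : beta / 4 * (c * L) = c * beta / 4 * L by field.
  rewrite mulrC ler_wpM2r ?(ltW L0)//; clear -cE pr; lra.
by clear -b0 k1 k3 k4; lra.
Qed.

(** [D * Jr] stands for [2 ^ j * Jbar], at most [L / ln 2]: a tail probability of order [1 / L] is
    enough, hence an exponent [x] of order [ln L]. *)
Lemma level_condition2 {R : realType} (alpha cx L y D Jr : R) : 0 < alpha ->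
  1 <= y -> expR y = L -> 0 < D -> 0 < Jr -> D * y <= L -> Jr * ln 2 <= y ->
  1 <= cx -> cx = 1 + ln (4 / (alpha * ln 2)) ->
  2 * expR (- (cx * y)) <= alpha / 2 / (D * Jr).
Proof.
move=> al0 y1 yE D0 J0 Dy Jy cx1 cxE.
have y0 : 0 < y by exact: lt_le_trans y1.
have ln2 : 0 < ln 2 :> R by rewrite ln_gt0// ltr1n.
have L0 : 0 < L by rewrite -yE expR_gt0.
have b0 : 0 < 4 / (alpha * ln 2) by rewrite divr_gt0// mulr_gt0.
have cxl : y + ln (4 / (alpha * ln 2)) <= cx * y.
  move: cxE cx1; set b := ln _ => -> cx1; rewrite mulrDl mul1r lerD2l ler_peMr//.
  by clear -cx1; lra.
have ex : expR (- (cx * y)) <= alpha * ln 2 / (4 * L).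
  apply: (@le_trans _ _ (expR (- (y + ln (4 / (alpha * ln 2)))))); first by rewrite ler_expR lerN2.
  rewrite opprD expRD !expRN yE lnK ?posrE// invf_div.
  by rewrite le_eqVlt; apply/orP; left; apply/eqP; field; rewrite !gt_eqF.
have DJ0 : 0 < D * Jr by exact: mulr_gt0.
rewrite ler_pdivlMr//.
have DJ : D * Jr * ln 2 <= L.
  by rewrite -mulrA; apply: le_trans Dy; rewrite ler_wpM2l// ltW.
have h : alpha * ln 2 / (4 * L) * (D * Jr) <= alpha / 4.
  rewrite mulrAC ler_pdivrMr ?mulr_gt0//.
  have -> : alpha * ln 2 * (D * Jr) = alpha * (D * Jr * ln 2) by ring.
  have -> : alpha / 4 * (4 * L) = alpha * L by field.
  by rewrite ler_wpM2l// ltW.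
have := ler_wpM2r (ltW DJ0) ex; clear -h; lra.
Qed.

(** With the threshold [t = C2 * y / L], the weak Besov condition bounds the energy by a multiple of
    [t ^ (2 g)], and [C2 ^ (2 g) <= C2] because [2 g <= 1]. The Besov tail beyond [J] has the same
    order. *)
Lemma part2_sparse {R : realType} (L y g dlt gamma q R1 R2 C2 : R) (s : R -> R)
    (r rho : R) J : intensity s -> bounded_by r s -> 0 < dlt -> g <= dlt ->
  g = gamma / (1 + 2 * gamma) -> 2 * g <= 1 -> 1 <= C2 -> q = 2 `^ (- 2 * dlt) -> 0 < 1 - q ->
  0 < y -> y <= L -> L < 2 * (2 ^+ J * y) ->
  besov dlt R1 s -> weak_besov gamma R2 s ->
  (forall j k : nat, (j < J)%N -> (k < 2 ^ j)%N ->
     haar_coef s (j, k) ^+ 2 <= C2 * (y / L)) ->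
  0 <= rho -> (rho%:E < L2dist s constants)%E ->
  rho ^+ 2 < (R2 ^+ 2 * C2 + R1 ^+ 2 * 4 `^ dlt / (1 - q)) * ((y / L) `^ g) ^+ 2.
Proof.
move=> ints bs d0 gd gE g1 C21 qE q1 y0 yL LJ bes wb H rho0 h.
have L0 : 0 < L := lt_le_trans y0 yL.
have u0 : 0 < y / L by exact: divr_gt0.
have C20 : 0 < C2 := lt_le_trans ltr01 C21.
have := besov_dist ints bs J d0 bes rho0 h; rewrite -qE; move/lt_le_trans; apply.
have := weak_besov_energy ints bs (mulr_gt0 C20 u0) wb H => e1.
rewrite mulrDl; apply: lerD.
  apply: le_trans e1 _; rewrite -[leRHS]mulrA ler_wpM2l ?sqr_ge0//.
  have -> : 2 * gamma / (1 + 2 * gamma) = 2 * g by rewrite gE mulrA.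
  rewrite [(C2 * _) `^ _]powRM ?(ltW C20) ?(ltW u0)//.
  have -> : ((y / L) `^ g) ^+ 2 = (y / L) `^ (2 * g).
    by rewrite -powR_mulrn ?powR_ge0// -powRrM [g * _]mulrC.
  by rewrite ler_wpM2r ?powR_ge0// ler1_powR.
have e2 := besov_tail_le y0 yL LJ d0 gd; rewrite -qE in e2.
rewrite [leRHS]mulrAC -[R1 ^+ 2 * _ * _ ^+ 2]mulrA ler_wpM2r ?invr_ge0 ?(ltW q1)//.
by rewrite ler_wpM2l ?sqr_ge0.
Qed.

(** Here [m = c * L] and [x = cx * ln L]. With [cx <= c], the bound [2 ^ Jbar * ln L <= L] is what
    makes the null tail of a single coefficient available at every scale below [Jbar]. *)
Lemma part2_coef {R : realType} (L : R) (M : poisson_experiment L) (s : R -> R)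
    (r alpha beta c cx C C2 : R) j k : 0 < L -> 1 <= ln (ln L) -> 4 * ln L <= L ->
  intensity s -> bounded_by r s -> 0 < mass s 0 0 ->
  0 < alpha < 1 -> 0 < beta -> 0 < r -> 0 < c -> 4 * r <= c * beta -> cx <= c ->
  1 <= cx -> cx = 1 + ln (4 / (alpha * ln 2)) ->
  0 < C2 -> 256 * c * cx <= C2 -> 96 * r / beta <= C2 ->
  C <= r * (L * mass s 0 0) -> 12 * r * ln (4 / beta) <= C ->
  (j < Jbar3 L)%N -> (k < 2 ^ j)%N -> C2 * (ln L / L) < haar_coef s (j, k) ^+ 2 ->
  (law M s [set w | test3 M alpha w = 0%N] <= beta%:E)%E.
Proof.
move=> L0 ll yL4 ints bs p0 al01 b0 r0 c0 cb cxc cx1 cxE C20 C2a C2b CLp C7 jJ kj.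
have [Lg1 y1 ly yL] := lnln_ge1 ll.
have [Jb1 J2 J3 J4] := Jbar3_bounds ll yL4.
have y0 : 0 < ln L := lt_le_trans ltr01 y1.
have cx0 : 0 < cx := lt_le_trans ltr01 cx1.
have [al0 _] := andP al01.
set al2 := haar_coef _ _ ^+ 2 => h.
have al20 : 0 < al2 by apply: lt_trans h; rewrite mulr_gt0 ?divr_gt0.
have Lal : C2 * ln L < L * al2.
  by move: h; rewrite mulrA ltr_pdivrMr// [al2 * _]mulrC.
have pr : mass s 0 0 <= r by have := mass_le ints bs 0 0; rewrite expr0 mul1r.
have jD : 2 ^+ j.+1 <= 2 ^+ Jbar3 L :> R by rewrite ler_weXn2l ?ler1n.
have jD' : 2 ^+ j <= 2 ^+ Jbar3 L :> R by rewrite ler_weXn2l ?ler1n// ltnW.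
apply: (@le_trans _ _ (24 * r / (L * al2) + expR (- (L * mass s 0 0 / 12)) + L * mass s 0 0 / (c * L))%:E).
  apply: (@test2_power _ _ M L0 s r ints bs p0 alpha j k (c * L) (cx * ln L)) => //.
  - by rewrite mulr_gt0.
  - by rewrite mulr_gt0.
  - rewrite -mulrA; apply: (@le_trans _ _ (c * L)).
      rewrite ler_pM ?(ltW cx0) ?mulr_ge0 ?exprn_ge0 ?(ltW y0)//.
      by rewrite mulrC; apply: le_trans J2; rewrite ler_wpM2r ?(ltW y0).
    by rewrite ler_peMl ?mulr_ge0 ?(ltW c0) ?(ltW L0)// ler1n.
  - apply: (level_condition2 (L := L)) => //.
    + by rewrite lnK ?posrE.
    + by rewrite ltr0n (ltn_trans _ Jb1).
    + by apply: le_trans J2; rewrite ler_wpM2r ?(ltW y0).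
  - rewrite -/al2 ler_pdivlMr//.
    have h1 := ler_wpM2r (ltW y0) C2a.
    have := ler_wpM2l (ltW L0) (le_trans h1 (ltW Lal)).
    by congr (_ <= _); ring.
rewrite lee_fin; apply: (error2_sum_le (C := C) (C2 := C2) (y := ln L)) => //.
exact: ltW.
Qed.

Lemma part2_power_core {R : realType} (dlt gamma alpha beta R1 R2 r C C2 c cx q g : R) :
  0 < dlt -> g = gamma / (1 + 2 * gamma) -> 0 <= g -> 2 * g <= 1 -> g <= dlt ->
  0 < alpha < 1 -> 0 < beta -> 0 < r -> 0 < c -> 4 * r <= c * beta -> cx <= c ->
  1 <= cx -> cx = 1 + ln (4 / (alpha * ln 2)) ->
  q = 2 `^ (- 2 * dlt) -> 0 < 1 - q ->
  1 <= C2 -> 256 * c * cx <= C2 -> 96 * r / beta <= C2 ->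
  1 <= C -> R2 ^+ 2 * C2 + R1 ^+ 2 * 4 `^ dlt / (1 - q) <= C ->
  12 * r * ln (4 / beta) <= C ->
  exists2 C' : R, 0 < C' & forall L, 1 <= ln (ln L) ->
  forall (M : poisson_experiment L) s,
  besov dlt R1 s -> weak_besov gamma R2 s -> bounded_by r s ->
  ((C' * (ln L / L) `^ g)%:E < L2dist s constants)%E ->
  (law M s [set w | test3 M alpha w = 0%N] <= beta%:E)%E.
Proof.
move=> d0 gE g0 g1 gd al01 b0 r0 c0 cb cxc cx1 cxE qE q1 C21 C2a C2b C1 Ca C7.
have [L1 L11 HL] := @ln_expr_le_powR R 1 4 1 ltr01.
have L10 : 0 < L1 := lt_le_trans ltr01 L11.
have L1g : 0 < L1 `^ g by rewrite powR_gt0.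
have C0 : 0 < C := lt_le_trans ltr01 C1.
exists (C + r * L1 `^ g); first by rewrite ltr_wpDr ?mulr_ge0 ?(ltW L1g) ?(ltW r0).
move=> L ll M s bes wb bs; have ints := bes.1.
have [Lg1 y1 ly yL] := lnln_ge1 ll.
have L0 : 0 < L := lt_trans ltr01 Lg1.
have y0 : 0 < ln L := lt_le_trans ltr01 y1.
set C' := C + _; set rho0 := _ `^ g.
have u0 : 0 < ln L / L by rewrite divr_gt0.
have rho00 : 0 < rho0 by exact: powR_gt0.
have C'C : C <= C' by rewrite lerDl mulr_ge0 ?(ltW L1g) ?(ltW r0).
have C'1 : 1 <= C' := le_trans C1 C'C.
have rhoge : 0 <= C' * rho0 by rewrite mulr_ge0 ?(ltW rho00)// (le_trans ler01).
have [LL1|LL1] := leP L1 L; last first.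
  move=> h; exfalso; apply: (lt_bound_dist ints bs _ rhoge h).
  have h1 : L1^-1 `^ g <= rho0.
    rewrite ge0_ler_powR ?nnegrE ?(ltW u0) ?invr_ge0 ?(ltW L10)//.
    rewrite ler_pdivlMr// mulrC ler_pdivrMr//.
    by apply: le_trans (ltW LL1) _; rewrite ler_peMl// ltW.
  apply: (@le_trans _ _ ((r * L1 `^ g) * rho0)).
    rewrite -mulrA ler_peMr ?(ltW r0)//; apply: le_trans (ler_wpM2l (ltW L1g) h1).
    rewrite -powR_inv1 ?(ltW L10)//.
    by rewrite -powRrM mulN1r powRN divff// gt_eqF.
  by rewrite ler_wpM2r ?(ltW rho00)// lerDr ltW.
have yL4 : 4 * ln L <= L by have := HL L LL1; rewrite expr1 powRr1// ltW.
move=> h.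
have rhoC : C * rho0 ^+ 2 <= (C' * rho0) ^+ 2.
  rewrite exprMn ler_wpM2r ?sqr_ge0//; apply: le_trans C'C _.
  by rewrite expr2 ler_peMr// (le_trans ler01).
(* Since [2 * g <= 1], the squared rate is at least [ln L / L]; a separated alternative thus has an
   expected number of points of at least [C / r]. *)
have ur : ln L / L <= rho0 ^+ 2.
  rewrite /rho0 -powR_mulrn ?powR_ge0// -powRrM [g * _]mulrC.
  by apply: ger1_powR => //; rewrite u0 ler_pdivrMr// mul1r.
have rp : C * rho0 ^+ 2 < r * mass s 0 0.
  exact: le_lt_trans rhoC (dist_lt_mass ints bs rhoge h).
have p0 : 0 < mass s 0 0.
  rewrite -(pmulr_rgt0 _ r0); apply: le_lt_trans rp.
  by rewrite mulr_ge0 ?sqr_ge0 ?(ltW C0).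
have CLp : C <= r * (L * mass s 0 0).
  rewrite mulrCA; apply: (@le_trans _ _ (L * (C * rho0 ^+ 2))); last first.
    by rewrite ler_wpM2l ?(ltW L0) ?(ltW rp).
  rewrite mulrCA ler_peMr ?(ltW C0)// mulrC -ler_pdivrMr//.
  by apply: le_trans ur; rewrite ler_pM2r ?invr_gt0.
have C20 : 0 < C2 := lt_le_trans ltr01 C21.
have [Jb1 J2 J3 J4] := Jbar3_bounds ll yL4.
have [[j [k [jJ kj jk]]]|H] := pselect (exists j k : nat, [/\ (j < Jbar3 L)%N, (k < 2 ^ j)%N &
    C2 * (ln L / L) < haar_coef s (j, k) ^+ 2]).
  exact: (part2_coef M (c := c) (cx := cx) (C2 := C2) (C := C) L0 ll yL4 ints bs p0 al01
    b0 r0 c0 cb cxc cx1 cxE C20 C2a C2b CLp C7 jJ kj jk).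
(* Without a detectable coefficient, the distance would be smaller than the separation imposed:
   there is no such alternative. *)
exfalso.
have : (C' * rho0) ^+ 2 < C * rho0 ^+ 2.
  apply: (@lt_le_trans _ _ ((R2 ^+ 2 * C2 + R1 ^+ 2 * 4 `^ dlt / (1 - q)) * rho0 ^+ 2)).
    apply: (part2_sparse (gamma := gamma) (r := r) (J := Jbar3 L) ints bs d0 gd gE g1 C21
      qE q1 y0 yL J3 bes wb _ rhoge h) => j k jJ kj.
    by rewrite leNgt; apply/negP => jk; apply: H; exists j, k.
  by rewrite ler_wpM2r ?sqr_ge0.
by rewrite ltNge rhoC.
Qed.

Lemma part2_power {R : realType} (dlt gamma alpha beta R1 R2 r : R) :
  0 < dlt -> 0 < gamma -> gamma / (1 + 2 * gamma) <= dlt ->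
  0 < alpha < 1 -> 0 < beta < 1 -> 0 < r ->
  exists2 C : R, 0 < C & forall L, 1 <= ln (ln L) ->
  forall (M : poisson_experiment L) s,
  besov dlt R1 s -> weak_besov gamma R2 s -> bounded_by r s ->
  ((C * (ln L / L) `^ (gamma / (1 + 2 * gamma)))%:E < L2dist s constants)%E ->
  (law M s [set w | test3 M alpha w = 0%N] <= beta%:E)%E.
Proof.
move=> d0 gam0 gd al01 be01 r0; have [b0 _] := andP be01.
have k0 : 0 < 1 + 2 * gamma by rewrite addr_gt0 ?mulr_gt0.
have g0 : 0 <= gamma / (1 + 2 * gamma) by rewrite divr_ge0 ?ltW.
have g1 : 2 * (gamma / (1 + 2 * gamma)) <= 1 by rewrite mulrA ler_pdivrMr// mul1r lerDr.
have cx1 : 1 <= 1 + ln (4 / (alpha * ln 2)) by apply: level_const_ge1; rewrite ?ler1n.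
have q1 := besov_ratio_lt1 d0.
have c0 : 0 < 4 * r / beta by rewrite divr_gt0// mulr_gt0.
move: (4 * r / beta) (divfK (lt0r_neq0 b0) (4 * r)) c0 => c' cE c'0.
have [cx cxE] : {cx | cx = 1 + ln (4 / (alpha * ln 2))} by eexists.
rewrite -cxE in cx1.
have [q qE] : {q | q = 2 `^ (- 2 * dlt)} by eexists.
rewrite -qE in q1.
have cx0 : 0 < cx := lt_le_trans ltr01 cx1.
(* [c'] controls the upper Poisson tail, and adding [cx] guarantees [cx <= c]. *)
pose c := c' + cx; have c0 : 0 < c by exact: addr_gt0.
pose a1 := 256 * c * cx; pose a2 := 96 * r / beta.
have h1 : 0 <= a1 by exact: mulr_ge0 (mulr_ge0 (ler0n _ _) (ltW c0)) (ltW cx0).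
have h2 : 0 <= a2 by rewrite divr_ge0 ?(ltW b0)// mulr_ge0 ?(ltW r0).
have C20 : 0 <= 1 + a1 + a2 by rewrite !addr_ge0.
pose a3 := R2 ^+ 2 * (1 + a1 + a2) + R1 ^+ 2 * 4 `^ dlt / (1 - q).
pose a4 := 12 * r * ln (4 / beta).
have h3 : 0 <= a3.
  apply: addr_ge0; first by rewrite mulr_ge0 ?sqr_ge0.
  by rewrite divr_ge0 ?(ltW q1)// mulr_ge0 ?sqr_ge0 ?powR_ge0.
have h4 : 0 <= a4 by rewrite !mulr_ge0 ?(ltW r0) ?ln_4div_ge0.
apply: (@part2_power_core _ dlt gamma alpha beta R1 R2 r (1 + a3 + a4) (1 + a1 + a2) c cx q) => //;
  rewrite -?/a1 -?/a2 -?/a3 -?/a4.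
- by rewrite -cE /c mulrDl lerDl mulr_ge0 ?(ltW cx0) ?(ltW b0).
- by rewrite lerDr ltW.
all: by clearbody a3 a4; clearbody a1 a2; clear -h1 h2 h3 h4; lra.
Qed.

Theorem corollary1 (R : realType) :
  (forall delta : R, 0 < delta ->
   exists2 L0 : R, 0 < L0 &
   forall alpha beta r r'' : R,
     0 < alpha < 1 -> 0 < beta < 1 -> 0 < r -> 0 < r'' ->
   exists2 C : R, 0 < C &
   forall gamma r' : R, 0 < gamma -> 0 < r' ->
   forall L : R, 1 <= ln (ln L) -> L0 < L ->
   forall M : poisson_experiment L,
     (separation_rate M (test3 M alpha)
        (besov delta r `&` weak_besov gamma r' `&` bounded_by r'') beta
      <= (C * (Num.sqrt (ln (ln L)) / L) `^ (2 * delta / (4 * delta + 1)))%:E)%E)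
  /\
  (forall delta gamma : R, 0 < delta -> 0 < gamma ->
     gamma / (2 * gamma + 1) <= delta ->
   exists2 L0 : R, 0 < L0 &
   forall alpha beta r r' r'' : R,
     0 < alpha < 1 -> 0 < beta < 1 -> 0 < r -> 0 < r' -> 0 < r'' ->
   exists2 C : R, 0 < C &
   forall L : R, 1 <= ln (ln L) -> L0 < L ->
   forall M : poisson_experiment L,
     (separation_rate M (test3 M alpha)
        (besov delta r `&` weak_besov gamma r' `&` bounded_by r'') beta
      <= (C * (ln L / L) `^ (gamma / (1 + 2 * gamma)))%:E)%E).
Proof.
have rate (a b e : R) : 0 < a -> 0 < b -> 0 < (a / b) `^ e.
  by move=> a0 b0; rewrite powR_gt0 ?divr_gt0.
(* [L0 = 1] serves every regularity, since the actual thresholds in [L] are already inside the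
   constants. *)
split=> [delta d0|delta gamma d0 g0 gd]; exists 1 => //.
- move=> alpha beta r r'' al01 be01 r0 r''0.
  have [C C0 H] := part1_power r d0 al01 be01 r''0; exists C => //.
  move=> gamma r' g0 r'0 L ll _ M; have [L1 _ _ _] := lnln_ge1 ll.
  apply: separation_rate_le => [|s [[bes _] bs]]; last exact: H.
  by rewrite mulr_gt0 ?rate ?sqrtr_gt0 ?(lt_le_trans ltr01 ll) ?(lt_trans ltr01 L1).
- move=> alpha beta r r' r'' al01 be01 r0 r'0 r''0.
  rewrite [2 * gamma + 1]addrC in gd.
  have [C C0 H] := part2_power r r' d0 g0 gd al01 be01 r''0; exists C => //.
  move=> L ll _ M; have [L1 y1 _ _] := lnln_ge1 ll.
  apply: separation_rate_le => [|s [[bes wb] bs]]; last exact: H.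
  by rewrite mulr_gt0 ?rate ?(lt_le_trans ltr01 y1) ?(lt_trans ltr01 L1).
Qed.
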